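(* Let $g$ be a kernel and $\rho$ a profile, and for $\beta>0$ let $(\mathscr{G}_\beta^{(n)}:n\in\mathbb{N})$ be the associated sequence of finite graphs defined in the context. Let $\sharp\mathscr{C}(\mathscr{G}_\beta^{(n)})$ denote the number of vertices of a largest connected component of $\mathscr{G}_\beta^{(n)}$. (a) If $$-\lim_{\mu\downarrow 0}\liminf_{n\to\infty}\frac{\log\left(\int_{n^{\mu-1}}^1\int_{n^{\mu-1}}^1 \rho(g(s,t)n)\,\mathrm{d}s\,\mathrm{d}t\right)}{\log n}<2,$$ then for all large enough $\beta$ the sequence $(\mathscr{G}_\beta^{(n)})$ contains a connected component that grows linearly in $n$: there is $c=c(\beta)>0$ such that $\mathbb{P}\{\sharp\mathscr{C}(\mathscr{G}_\beta^{(n)})\ge cn\}\to1$ as $n\to\infty$. (b) If $$-\lim_{\mu\uparrow 0}\limsup_{n\to\infty}\frac{\log\left(\int_{n^{\mu-1}}^1\int_{n^{\mu-1}}^1 \rho(g(s,t)n)\,\mathrm{d}s\,\mathrm{d}t\right)}{\log n}>2,$$ then for every $\beta>0$ there is no giant component: for every $c>0$, $\mathbb{P}\{\sharp\mathscr{C}(\mathscr{G}_\beta^{(n)})\ge cn\}\to0$ as $n\to\infty$.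
   Context: A kernel is a symmetric function $g:(0,1)^2\to(0,\infty)$, non-decreasing in both arguments, with $\int_0^1\int_0^1 \frac{1}{g(s,t)}\,\mathrm{d}s\,\mathrm{d}t<\infty$. A profile is a non-increasing, integrable function $\rho:(0,\infty)\to[0,1]$. The graph $\mathscr{G}_\beta^{(n)}$ has $n$ vertices whose locations are independent and uniform on $(-\tfrac12,\tfrac12)$, each carrying an independent mark uniform on $(0,1)$. Given locations and marks, each pair of vertices $(x,t)$, $(y,s)$ (location, mark) is joined by an edge independently with probability $\rho(\beta^{-1}g(s,t)\,n\,|x-y|)$. The weak local limit of this sequence is the weight-dependent random connection model on $\mathbb{R}$ with kernel $g$ and profile $\rho$: the vertices are the points of a unit intensity Poisson process (with a point added at the origin), with i.i.d. uniform marks on $(0,1)$, and pairs are connected independently with probability $\rho(\beta^{-1}g(t_x,t_y)|x-y|)$. Convention: $\log 0=-\infty$. *)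

(* Defs.v *)
From HB Require Import structures.
From mathcomp Require Import all_boot all_order all_algebra.
From mathcomp Require Import all_classical all_reals all_analysis.

Set Implicit Arguments.
Unset Strict Implicit.
Unset Printing Implicit Defensive.

Import Order.TTheory GRing.Theory Num.Theory.
Import numFieldNormedType.Exports.

Local Open Scope classical_set_scope.
Local Open Scope ring_scope.

(* Kernels and profiles are total functions here; their values outside (0,1)^2,
   resp. (0,oo), are unconstrained and only ever matter on null sets.  The
   iterated integrals below need no joint measurability hypothesis, since a
   kernel is monotone in each argument. *)
Record is_kernel (R : realType) (g : R -> R -> R) : Prop := IsKernel {
  kernel_gt0 : {in `]0, 1[ &, forall s t, 0 < g s t};
  kernel_sym : {in `]0, 1[ &, forall s t, g s t = g t s};
  kernel_homol : {in `]0, 1[, forall t,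
    {in `]0, 1[ &, {homo g^~ t : s s' / s <= s'}}};
  kernel_homor : {in `]0, 1[, forall s,
    {in `]0, 1[ &, {homo g s : t t' / t <= t'}}};
  kernel_integral : (\int[lebesgue_measure]_(s in `]0%R, 1%R[)
    \int[lebesgue_measure]_(t in `]0%R, 1%R[) ((g s t)^-1)%:E < +oo)%E
}.

Record is_profile (R : realType) (rho : R -> R) : Prop := IsProfile {
  profile_itv : {in `]0, +oo[, forall x, 0 <= rho x <= 1};
  profile_nonincr : {in `]0, +oo[ &, {homo rho : x y /~ x <= y}};
  profile_integrable :
    lebesgue_measure.-integrable `]0, +oo[ (EFin \o rho)
}.

Section random_variables.
Context d (T : measurableType d) (R : realType) (P : probability T R).

Definition mutually_independent (I : finType) (Z : I -> T -> R) :=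
  forall (J : {set I}) (B : I -> set R), (forall i, measurable (B i)) ->
    P (\bigcap_(i in [set` J]) Z i @^-1` B i) =
    (\prod_(i in J) P (Z i @^-1` B i))%E.

Definition uniformly_distributed (a b : R) (ab : a < b) (X : T -> R) :=
  forall B : set R, measurable B -> P (X @^-1` B) = uniform_prob ab B.

(* the sigma-algebra on T generated by the family Z *)
Definition sigma_of (I : Type) (Z : I -> T -> R) : set (set T) :=
  <<s [set A | exists i (B : set R), measurable B /\ A = Z i @^-1` B] >>.

End random_variables.

Lemma ltN_half (R : realType) : - 2^-1 < 2^-1 :> R.
Proof. by rewrite (@lt_trans _ _ 0) ?oppr_lt0 ?invr_gt0. Qed.

(* Locations and marks of the vertices, as one family of random variables. *)
Definition loc_mark (I T R : Type) (X M : I -> T -> R) (k : I + I) : T -> R :=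
  match k with inl i => X i | inr i => M i end.

Definition edge_prob (R : realType) (g : R -> R -> R) (rho : R -> R)
    (beta : R) (n : nat) (x t y s : R) : R :=
  rho (beta^-1 * g s t * n%:R * `|x - y|).

(* A realization, on an arbitrary probability space, of the random graph with
   vertex set 'I_n.  The last field says that, conditionally on the
   sigma-algebra of the locations and marks, the edges are independent and
   present with the prescribed probabilities: it is the product rule for every
   finite set S of pairs, integrated over each conditioning event A. *)
Record random_graph (R : realType) (g : R -> R -> R) (rho : R -> R)
    (beta : R) (n : nat) := RandomGraph {
  rg_disp : measure_display;
  rg_space : measurableType rg_disp;
  rg_prob : probability rg_space R;
  rg_loc : 'I_n -> {RV rg_prob >-> R};
  rg_mark : 'I_n -> {RV rg_prob >-> R};
  rg_adj : rg_space -> rel 'I_n;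
  rg_loc_uniform : forall i,
    uniformly_distributed rg_prob (ltN_half R) (rg_loc i);
  rg_mark_uniform : forall i,
    uniformly_distributed rg_prob (@ltr01 R) (rg_mark i);
  rg_indep : mutually_independent rg_prob
    (loc_mark (fun i => rg_loc i : _ -> R) (fun i => rg_mark i : _ -> R));
  rg_adj_sym : forall w, symmetric (rg_adj w);
  rg_adj_irr : forall w, irreflexive (rg_adj w);
  rg_adj_measurable : forall i j, measurable [set w | rg_adj w i j];
  rg_adj_law : forall (S : {set 'I_n * 'I_n}) (A : set rg_space),
    (forall e, e \in S -> (e.1 < e.2)%N) ->
    sigma_of
      (loc_mark (fun i => rg_loc i : _ -> R) (fun i => rg_mark i : _ -> R)) A ->
    rg_prob (A `&` \bigcap_(e in [set` S]) [set w | rg_adj w e.1 e.2]) =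
    (\int[rg_prob]_(w in A)
      (\prod_(e in S) edge_prob g rho beta n
         (rg_loc e.1 w) (rg_mark e.1 w) (rg_loc e.2 w) (rg_mark e.2 w))%:E)%E
}.

Arguments rg_prob {R g rho beta n} r.
Arguments rg_adj {R g rho beta n} r _ _ _.
Arguments rg_loc {R g rho beta n} r _.
Arguments rg_mark {R g rho beta n} r _.

(* number of vertices of a largest connected component *)
Definition largest_component (n : nat) (adj : rel 'I_n) : nat :=
  \max_(i < n) #|connect adj i|.

Definition prob_giant (R : realType) (g : R -> R -> R) (rho : R -> R)
    (beta : R) (n : nat) (G : random_graph g rho beta n) (c : R) : \bar R :=
  rg_prob G [set w | c * n%:R <= (largest_component (rg_adj G w))%:R].

(* lne 0 = -oo, as extended reals *)
Definition log_ratio (R : realType) (g : R -> R -> R) (rho : R -> R)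
    (mu : R) (n : nat) : \bar R :=
  let a : R := n%:R `^ (mu - 1) in
  (lne (\int[lebesgue_measure]_(s in `]a, 1%R[)
          \int[lebesgue_measure]_(t in `]a, 1%R[) (rho (g s t * n%:R)%R)%:E)
   * ((ln n%:R)^-1)%:E)%E.

(* Main.v *)
Require Import Defs.
From HB Require Import structures.
From mathcomp Require Import all_boot all_order all_algebra.
From mathcomp Require Import ring lra zify.

(**
   Write I(n, a) for the integral of rho(g(s,t) n) over the square (a,1)^2.

   Part (a). The hypothesis says that I(n, n^(mu-1)) is at least n^(-2+kappa) for some positive mu and
   kappa and all large n. Cutting the marks into boundedly many polynomial scales, [dominant_scale]
   extracts marks s, t with rho(g(s,t) n) s t >= n^(-2+kappa) and s, t >= n^(-1+kappa): between two sets of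
   order n vertices at distance n, the expected number of edges joining a mark below s to a mark below t
   is then a positive power of n. This drives a renormalization. Space is cut into base blocks, grouped
   into blocks of blocks with geometrically growing branching numbers. A large [beta] makes the base blocks
   dense, and clusters of neighbouring blocks merge with a probability that tends to one
   exponentially fast along the levels, because a fixed small proportion of vertices is kept untouched for
   each level and a second moment estimate [merge_fail] applies to their fresh marks. The recursion is
   run in a finite model with uniform discrete locations, marks and edge coins ([giant_in_model]), and
   [transfer] compares increasing events of the model with those of the random graph. That comparison
   needs the edge probabilities to be measurable up to a null set: a function that is monotone in each
   variable is not Borel in general, but the exceptional points lie on countably many monotone graphs.

   Part (b). Now I(n, n^(-mu-1)) is at most n^(-y) with y > 2. A window of width of order 1/n around a point
   is free of vertices with a probability q bounded below, and given this, an edge crosses the point with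
   a probability that is small when the window is wide: sum over dyadic lengths the probability that
   an endpoint has an exceptionally small mark and the mean number of edges with larger marks
   ([P_gap_crossed]). Windows are negatively correlated, so Chebyshev's inequality ([many_gaps]) gives an
   uncrossed gap in every macroscopic interval with high probability. Components are then confined to two
   adjacent macroscopic intervals, which is incompatible with a giant component ([giant_unlikely]).
*)

Set Implicit Arguments.
Unset Strict Implicit.
Unset Printing Implicit Defensive.

Import Order.TTheory GRing.Theory Num.Theory.
Local Open Scope ring_scope.

(** * Finite product measures *)

Section FiniteProduct.
Context {R : realFieldType} {I T : finType}.
Implicit Types (w : I -> T -> R) (J : {set I}) (f g : {ffun I -> T}).

Definition weight w f : R := \prod_i w i (f i).
Definition Ex w (F : {ffun I -> T} -> R) : R := \sum_f weight w f * F f.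
Definition Pr w (A : pred {ffun I -> T}) : R := Ex w (fun f => (A f)%:R).

Definition is_weight w := (forall i t, 0 <= w i t) /\ (forall i, \sum_t w i t = 1).

Definition depends_on J (U : Type) (F : {ffun I -> T} -> U) :=
  forall f g, {in J, f =1 g} -> F f = F g.

Definition mix J f g : {ffun I -> T} := [ffun i => if i \in J then f i else g i].

Section Theory.
Variable w : I -> T -> R.
Hypothesis ww : is_weight w.

Lemma weight_ge0 f : 0 <= weight w f.
Proof. by apply: prodr_ge0 => i _; case: ww. Qed.

Lemma Ex_cst c : Ex w (fun=> c) = c.
Proof.
rewrite /Ex -mulr_suml /weight.
have -> : \sum_(f : {ffun I -> T}) \prod_i w i (f i) = \prod_i \sum_t w i t.
  by rewrite bigA_distr_bigA.
by rewrite big1 ?mul1r// => i _; case: ww.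
Qed.

Lemma eq_Ex F G : F =1 G -> Ex w F = Ex w G.
Proof. by move=> FG; apply: eq_bigr => f _; rewrite FG. Qed.

Lemma le_Ex F G : (forall f, F f <= G f) -> Ex w F <= Ex w G.
Proof. by move=> FG; apply: ler_sum => f _; rewrite ler_wpM2l// weight_ge0. Qed.

Lemma Ex_ge0 F : (forall f, 0 <= F f) -> 0 <= Ex w F.
Proof. by move=> F0; apply: sumr_ge0 => f _; rewrite mulr_ge0// weight_ge0. Qed.

Lemma ExD F G : Ex w (fun f => F f + G f) = Ex w F + Ex w G.
Proof. by rewrite /Ex -big_split; apply: eq_bigr => f _; rewrite mulrDr. Qed.

Lemma ExZ c F : Ex w (fun f => c * F f) = c * Ex w F.
Proof. by rewrite /Ex mulr_sumr; apply: eq_bigr => f _; rewrite mulrCA. Qed.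

Lemma ExB F G : Ex w (fun f => F f - G f) = Ex w F - Ex w G.
Proof.
rewrite -[in RHS]mulN1r -ExZ -ExD.
by apply: eq_Ex => f; rewrite mulN1r.
Qed.

Lemma Ex_sum (K : Type) (s : seq K) (P : pred K) F :
  Ex w (fun f => \sum_(k <- s | P k) F k f) = \sum_(k <- s | P k) Ex w (F k).
Proof.
by rewrite /Ex exchange_big; apply: eq_bigr => f _; rewrite mulr_sumr.
Qed.

Lemma mix_bij J : involutive (fun p => (mix J p.1 p.2, mix J p.2 p.1)).
Proof.
by move=> [f g]; congr (_, _); apply/ffunP => i; rewrite !ffunE /=; case: (i \in J).
Qed.

Lemma weight_mix J f g :
  weight w (mix J f g) * weight w (mix J g f) = weight w f * weight w g.
Proof.
rewrite /weight -!big_split; apply: eq_bigr => i _ /=; rewrite !ffunE.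
by case: (i \in J) => //; rewrite mulrC.
Qed.

(** Resampling: exchanging the coordinates of [J] between two independent
    samples is a measure preserving involution. *)
Lemma Ex_resample J F : Ex w (fun g => Ex w (fun f => F (mix J f g))) = Ex w F.
Proof.
rewrite -[RHS]mulr1 -[X in _ * X](Ex_cst 1).
rewrite /Ex mulr_suml; under eq_bigr do rewrite mulr_sumr.
under [RHS]eq_bigr do rewrite mulr_sumr.
rewrite exchange_big/= !pair_big/=.
rewrite (reindex_inj (can_inj (mix_bij J)))/=.
apply: eq_bigr => -[f g] _ /=.
have -> : mix J (mix J f g) (mix J g f) = f.
  by apply/ffunP => i; rewrite !ffunE; case: (i \in J).
by rewrite mulrA [X in X * _]mulrC weight_mix mulr1 mulrAC.
Qed.

Lemma ExM J1 J2 F G : [disjoint J1 & J2] ->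
  depends_on J1 F -> depends_on J2 G ->
  Ex w (fun f => F f * G f) = Ex w F * Ex w G.
Proof.
move=> J12 dF dG; rewrite -(Ex_resample J1 (fun f => F f * G f)).
transitivity (Ex w (fun g => G g * Ex w F)); last first.
  by rewrite -ExZ; apply: eq_Ex => f; rewrite mulrC.
apply: eq_Ex => g; rewrite -ExZ; apply: eq_Ex => f; rewrite mulrC; congr (_ * _).
  apply: dG => i iJ2; rewrite ffunE; case: ifPn => // iJ1.
  by have := disjointFr J12 iJ1; rewrite iJ2.
by apply: dF => i iJ1; rewrite ffunE iJ1.
Qed.

Lemma Ex_le_resample J F c :
  (forall g, Ex w (fun f => F (mix J f g)) <= c) -> Ex w F <= c.
Proof. by move=> Fc; rewrite -(Ex_resample J) -[leRHS]Ex_cst le_Ex. Qed.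

Lemma Ex_prod (K : finType) (s : seq K) (J : K -> {set I}) (F : K -> _ -> R) :
  uniq s -> {in s &, forall k l, k != l -> [disjoint J k & J l]} ->
  {in s, forall k, depends_on (J k) (F k)} ->
  Ex w (fun f => \prod_(k <- s) F k f) = \prod_(k <- s) Ex w (F k).
Proof.
elim: s => [_ _ _|k s IH /= /andP[ks us] dJ dF].
  by rewrite big_nil; under eq_Ex do rewrite big_nil; rewrite Ex_cst.
have dJ' : {in s &, forall k l, k != l -> [disjoint J k & J l]}.
  by move=> i j iS jS; apply: dJ; rewrite inE ?iS ?jS orbT.
have dF' : {in s, forall k, depends_on (J k) (F k)}.
  by move=> i iS; apply: dF; rewrite inE iS orbT.
rewrite big_cons -IH//; under eq_Ex do rewrite big_cons.
rewrite (@ExM (J k) (\bigcup_(l <- s) J l))//.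
- rewrite disjoints_subset; apply/subsetP => i iJk; rewrite inE.
  apply/negP; rewrite bigcup_seq => /bigcupP[l ls iJl].
  have kl : k != l by apply: contraNneq ks => ->.
  have := dJ k l; rewrite !inE eqxx ls orbT => /(_ isT isT kl) D.
  by have := disjointFr D iJk; rewrite iJl.
- by apply: dF; rewrite inE eqxx.
- move=> f g fg; rewrite !big_seq; apply: eq_bigr => l ls; apply: dF' => // i iJ; apply: fg.
  by rewrite bigcup_seq; apply/bigcupP; exists l.
Qed.

Lemma Pr_ge0 A : 0 <= Pr w A.
Proof. by apply: Ex_ge0 => f; rewrite ler0n. Qed.

Lemma le_Pr (A B : pred _) : (forall f, A f -> B f) -> Pr w A <= Pr w B.
Proof.
move=> AB; apply: le_Ex => f; rewrite ler_nat; case: (boolP (A f)) => // /AB ->.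
by [].
Qed.

Lemma PrC A : Pr w (fun f => ~~ A f) = 1 - Pr w A.
Proof.
rewrite -[X in X - _]Ex_cst -ExB; apply: eq_Ex => f.
by case: (A f); rewrite ?subrr ?subr0.
Qed.

Lemma Ex_coord (i : I) (F : T -> R) : Ex w (fun f => F (f i)) = \sum_t w i t * F t.
Proof.
have -> : Ex w (fun f => F (f i)) =
   \sum_(f : {ffun I -> T}) \prod_j (if j == i then w j (f j) * F (f j) else w j (f j)).
  apply: eq_bigr => f _; rewrite /weight (bigD1 i)//= [in RHS](bigD1 i)//= eqxx.
  by rewrite mulrAC; congr (_ * _); apply: eq_bigr => j /negPf ->.
rewrite -(bigA_distr_bigA (fun j t => if j == i then w j t * F t else w j t)).
rewrite (bigD1 i)//= eqxx [X in _ * X]big1 ?mulr1// => j /negPf ji.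
by under eq_bigr do rewrite ji; case: ww.
Qed.

End Theory.
End FiniteProduct.

Section Uniform.
Context {R : realFieldType} {I T : finType}.
Definition unif : I -> T -> R := fun _ _ => #|T|%:R^-1.
Hypothesis T0 : (0 < #|T|)%N.
Lemma unif_weight : is_weight unif.
Proof.
split=> [i t|i]; first by rewrite invr_ge0 ler0n.
by rewrite sumr_const -[_ *+ _]mulr_natl divff// pnatr_eq0 -lt0n.
Qed.

Lemma Pr_coord (i : I) (A : pred T) :
  Pr unif (fun f : {ffun I -> T} => A (f i)) = #|A|%:R / #|T|%:R.
Proof.
rewrite /Pr (Ex_coord unif_weight i (fun t => (A t)%:R)) /unif -mulr_sumr mulrC; congr (_ / _).
by rewrite -natr_sum -sum1_card [in RHS]big_mkcond; congr (_%:R).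
Qed.
End Uniform.

(** * Merging two sets by a second moment estimate *)

Lemma alg1 (R : comRingType) (h1 h2 s t p : R) :
  h1 * (h2 * (h1 * h2 * (s * (t * p)) ^+ 2 + h2 * (s * (t * p) ^+ 2) +
   h1 * (t * (s * p) ^+ 2) + s * (t * p))) =
  (h1 * h2 * (s * (t * p))) ^+ 2 + h1 * h2 ^+ 2 * (s * (t * p) ^+ 2) +
  h1 ^+ 2 * h2 * (t * (s * p) ^+ 2) + h1 * h2 * (s * (t * p)).
Proof. ring. Qed.

Lemma sum_cst (R : pzSemiRingType) (J : finType) (K : {set J}) (c : R) :
  \sum_(x in K) c = #|K|%:R * c.
Proof. by rewrite sumr_const mulr_natl. Qed.

Lemma eq_ler (R : numDomainType) (x y : R) : x = y -> x <= y.
Proof. by move=> ->. Qed.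

Lemma alg2 (R : realFieldType) (h h1 h2 s t p : R) : 0 < h -> h <= h1 -> h <= h2 ->
  0 < s -> 0 < t -> 0 < p ->
  (h1 * s)^-1 + (h2 * t)^-1 + (h1 * h2 * (s * t * p))^-1 <=
  (h * s)^-1 + (h * t)^-1 + (h ^+ 2 * (s * t * p))^-1.
Proof.
move=> h0 hh1 hh2 s0 t0 p0.
have h10 := lt_le_trans h0 hh1; have h20 := lt_le_trans h0 hh2.
rewrite !lerD// lef_pV2 ?posrE ?mulr_gt0 ?exprn_gt0// ler_pM2r ?mulr_gt0//.
by rewrite expr2 ler_pM// ltW.
Qed.

Lemma alg3 (R : realFieldType) (h1 h2 s t p : R) : 0 < h1 -> 0 < h2 ->
  0 < s -> 0 < t -> 0 < p ->
  h1 * h2 ^+ 2 * (s * (t * p) ^+ 2) + h1 ^+ 2 * h2 * (t * (s * p) ^+ 2) + h1 * h2 * (s * (t * p)) =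
  (h1 * h2 * (s * (t * p))) ^+ 2 * ((h1 * s)^-1 + (h2 * t)^-1 + (h1 * h2 * (s * t * p))^-1).
Proof. by move=> *; field; rewrite !gt_eqF. Qed.

Section MergeBound.
Context {R : realFieldType} {n M : nat}.
Hypothesis M0 : (0 < M)%N.
Notation coins := {ffun 'I_n * 'I_n -> 'I_M}.
Let w : 'I_n * 'I_n -> 'I_M -> R := unif.
Let cardM : (0 < #|'I_M|)%N. Proof. by rewrite card_ord. Qed.
Let ww : is_weight w := unif_weight cardM.

Definition coin (x y : 'I_n) : 'I_n * 'I_n := if (x < y)%N then (x, y) else (y, x).

Lemma coinC x y : coin x y = coin y x.
Proof.
rewrite /coin; case: ltngtP => // /val_inj ->; by [].
Qed.

Lemma coin_eq x y x' y' : coin x y = coin x' y' -> (x = x' /\ y = y') \/ (x = y' /\ y = x').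
Proof. by rewrite /coin; do 2 case: ifP => _; case=> -> ->; auto. Qed.

Lemma coin_diag x y z : x != y -> coin x y != (z, z).
Proof.
move=> xy; apply/eqP; rewrite /coin; case: ifP => _ [] e1 e2; move: xy; rewrite e1 e2 eqxx//.
Qed.

Lemma Pr_lt c (k : nat) : (k <= M)%N -> Pr w (fun f : coins => (f c < k)%N) = k%:R / M%:R.
Proof.
move=> kM; rewrite /w (Pr_coord cardM c (fun i : 'I_M => (i < k)%N)) card_ord; congr (_%:R / _).
rewrite -sum1_card -(big_ord_widen_cond M predT (fun=> 1%N) kM).
by rewrite sum1_card card_ord.
Qed.

Lemma depends1 c k : depends_on [set c] (fun f : coins => ((f c < k)%N)%:R : R).
Proof. by move=> f g fg /=; rewrite fg ?inE. Qed.

Lemma dependsM J1 J2 (F G : coins -> R) : depends_on J1 F -> depends_on J2 G ->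
  depends_on (J1 :|: J2) (fun f => F f * G f).
Proof.
move=> dF dG f g fg; rewrite (dF f g) ?(dG f g)// => i iJ; apply: fg; rewrite inE iJ ?orbT//.
Qed.

Section Fixed.
Variables (S T P : nat) (K1 K2 : {set 'I_n}).
Hypotheses (SM : (S <= M)%N) (TM : (T <= M)%N) (PM : (P <= M)%N).
Hypothesis K12 : [disjoint K1 & K2].
Let s : R := S%:R / M%:R.
Let t : R := T%:R / M%:R.
Let p : R := P%:R / M%:R.
Hypotheses (S0 : (0 < S)%N) (T0 : (0 < T)%N) (P0 : (0 < P)%N).

Let al x (f : coins) : R := (f (x, x) < S)%N%:R.
Let be y (f : coins) : R := (f (y, y) < T)%N%:R.
Let ga x y (f : coins) : R := (f (coin x y) < P)%N%:R.
Let xi x y f := al x f * (be y f * ga x y f).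

Let exal x : Ex w (al x) = s. Proof. exact: Pr_lt. Qed.
Let exbe x : Ex w (be x) = t. Proof. exact: Pr_lt. Qed.
Let exga x y : Ex w (ga x y) = p. Proof. exact: Pr_lt. Qed.
Let dal x : depends_on [set (x, x)] (al x). Proof. exact: depends1. Qed.
Let dbe x : depends_on [set (x, x)] (be x). Proof. exact: depends1. Qed.
Let dga x y : depends_on [set coin x y] (ga x y). Proof. exact: depends1. Qed.

Let K12n x y : x \in K1 -> y \in K2 -> x != y.
Proof. by move=> xK yK; apply/eqP => xy; have := disjointFr K12 xK; rewrite xy yK. Qed.

Let disj1 (c : 'I_n * 'I_n) (J : {set 'I_n * 'I_n}) : c \notin J -> [disjoint [set c] & J].
Proof. by move=> cJ; rewrite disjoints1. Qed.

Let exbg x y : x \in K1 -> y \in K2 -> Ex w (fun f => be y f * ga x y f) = t * p.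
Proof.
move=> xK yK; rewrite (ExM ww _ (@dbe y) (@dga x y)) ?exbe ?exga//.
by apply: disj1; rewrite inE eq_sym coin_diag// K12n.
Qed.

Let exag x y : x \in K1 -> y \in K2 -> Ex w (fun f => al x f * ga x y f) = s * p.
Proof.
move=> xK yK; rewrite (ExM ww _ (@dal x) (@dga x y)) ?exal ?exga//.
by apply: disj1; rewrite inE eq_sym coin_diag// K12n.
Qed.

Let dbg x y : depends_on [set (y, y); coin x y] (fun f => be y f * ga x y f).
Proof. exact: dependsM. Qed.

Let dag x y : depends_on [set (x, x); coin x y] (fun f => al x f * ga x y f).
Proof. exact: dependsM. Qed.

Let dxi x y : depends_on [set (x, x); (y, y); coin x y] (xi x y).
Proof. by rewrite -setUA; apply: dependsM. Qed.

Let exxi x y : x \in K1 -> y \in K2 -> Ex w (xi x y) = s * (t * p).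
Proof.
move=> xK yK; have xy := K12n xK yK.
rewrite (ExM ww _ (@dal x) (@dbg x y)) ?exal ?exbg//.
apply: disj1; rewrite !inE eq_sym xpair_eqE eq_sym (negPf xy)/=.
by rewrite eq_sym coin_diag.
Qed.

Let xi01 x y f : xi x y f = 0 \/ xi x y f = 1.
Proof.
by rewrite /xi /al /be /ga; do 3 case: (_ < _)%N; rewrite /= ?mulr1n ?mulr0n; [right|left..]; ring.
Qed.

Lemma sqr_nat (c : bool) : c%:R * c%:R = c%:R :> R.
Proof. by case: c; rewrite /= ?mulr1n ?mulr0n ?mulr1 ?mulr0. Qed.

Let s0 : 0 < s. Proof. by rewrite divr_gt0 ?ltr0n. Qed.
Let t0 : 0 < t. Proof. by rewrite divr_gt0 ?ltr0n. Qed.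
Let p0 : 0 < p. Proof. by rewrite divr_gt0 ?ltr0n. Qed.

Let exxixi x y x' y' : x \in K1 -> y \in K2 -> x' \in K1 -> y' \in K2 ->
  Ex w (fun f => xi x y f * xi x' y' f) <=
  (s * (t * p)) ^+ 2 + (x == x')%:R * (s * (t * p) ^+ 2)
   + (y == y')%:R * (t * (s * p) ^+ 2) + (x == x')%:R * (y == y')%:R * (s * (t * p)).
Proof.
move=> xK yK x'K y'K.
have xy := K12n xK yK; have xy' := K12n xK y'K; have x'y := K12n x'K yK.
have x'y' := K12n x'K y'K.
have a1 := mulr_gt0 t0 p0; have a2 := mulr_gt0 s0 p0; have a3 := mulr_gt0 s0 a1.
have a4 : 0 < s * (t * p) ^+ 2 by rewrite mulr_gt0// exprn_gt0.
have a5 : 0 < t * (s * p) ^+ 2 by rewrite mulr_gt0// exprn_gt0.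
have a6 : 0 < (s * (t * p)) ^+ 2 by rewrite exprn_gt0.
case: (eqVneq x x') => [xx'|xx']; case: (eqVneq y y') => [yy'|yy'] /=;
   rewrite ?mulr1n ?mulr0n ?mul1r ?mul0r ?addr0.
- subst x' y'; rewrite (@eq_Ex _ _ _ w _ (xi x y)); last first.
    by move=> f; case: (xi01 x y f) => ->; rewrite ?mulr0 ?mulr1.
  by rewrite exxi// lerDr ltW// !addr_gt0.
- subst x'; rewrite (@eq_Ex _ _ _ w _ (fun f => al x f * ((be y f * ga x y f) * (be y' f * ga x y' f)))); last first.
    move=> f; rewrite /xi mulrACA; congr (_ * _); exact: sqr_nat.
  have d1 : [disjoint [set (y, y); coin x y] & [set (y', y'); coin x y']].
    rewrite disjoints_subset; apply/subsetP => c; rewrite !inE => /orP[] /eqP ->; rewrite negb_or.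
      by rewrite xpair_eqE (negPf yy')/= eq_sym coin_diag.
    rewrite coin_diag//=; apply/eqP => /coin_eq[][] e1 e2; first by rewrite e2 eqxx in yy'.
    by rewrite e1 eqxx in xy'.
  rewrite (ExM ww _ (@dal x) (dependsM (@dbg x y) (@dbg x y'))); last first.
    apply: disj1; rewrite !inE !xpair_eqE (negPf xy) (negPf xy') /=.
    by rewrite eq_sym (negPf (coin_diag _ _))// eq_sym (negPf (coin_diag _ _)).
  rewrite (ExM ww d1 (@dbg x y) (@dbg x y')) exal !exbg//.
  by rewrite -expr2 lerDr ltW.
- subst y'; rewrite (@eq_Ex _ _ _ w _ (fun f => be y f * ((al x f * ga x y f) * (al x' f * ga x' y f)))); last first.
    move=> f; transitivity (be y f * be y f * ((al x f * ga x y f) * (al x' f * ga x' y f))).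
      rewrite /xi; ring.
    by rewrite sqr_nat.
  have d1 : [disjoint [set (x, x); coin x y] & [set (x', x'); coin x' y]].
    rewrite disjoints_subset; apply/subsetP => c; rewrite !inE => /orP[] /eqP ->; rewrite negb_or.
      by rewrite xpair_eqE (negPf xx')/= eq_sym coin_diag.
    rewrite coin_diag//=; apply/eqP => /coin_eq[][] e1 e2; first by rewrite e1 eqxx in xx'.
    by rewrite e1 eqxx in xy.
  rewrite (ExM ww _ (@dbe y) (dependsM (@dag x y) (@dag x' y))); last first.
    apply: disj1; rewrite !inE !xpair_eqE ![y == _]eq_sym (negPf xy) (negPf x'y) /=.
    by rewrite eq_sym (negPf (coin_diag _ _))// eq_sym (negPf (coin_diag _ _)).
  rewrite (ExM ww d1 (@dag x y) (@dag x' y)) exbe !exag//.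
  by rewrite -expr2 lerDr ltW.
- rewrite (ExM ww _ (@dxi x y) (@dxi x' y')) ?exxi// -?expr2//.
  rewrite disjoints_subset; apply/subsetP => c; rewrite !inE => /orP[/orP[]|] /eqP ->; rewrite !negb_or ?xpair_eqE.
  + by rewrite (negPf xx') (negPf xy')/= eq_sym coin_diag.
  + by rewrite ![y == _]eq_sym (negPf x'y) [y' == _]eq_sym (negPf yy')/= eq_sym coin_diag.
  + rewrite !coin_diag//=; apply/eqP => /coin_eq[][] e1 e2; first by rewrite e1 eqxx in xx'.
    by rewrite e1 eqxx in xy'.
Qed.

Let h1 : R := #|K1|%:R.
Let h2 : R := #|K2|%:R.

Let Y f := \sum_(x in K1) \sum_(y in K2) xi x y f.
Let mu := h1 * h2 * (s * (t * p)).

Let exY : Ex w Y = mu.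
Proof.
rewrite /Y (Ex_sum w); under eq_bigr => x xK.
  rewrite (Ex_sum w); under eq_bigr => y yK do rewrite exxi//.
  rewrite sum_cst; over.
by rewrite sum_cst mulrA.
Qed.

Let sum_eq (K : {set 'I_n}) x : x \in K -> \sum_(y in K) (x == y)%:R = 1 :> R.
Proof.
move=> xK; rewrite (bigD1 x)//= eqxx big1 ?addr0// => y /andP[_].
by rewrite eq_sym => /negPf ->.
Qed.

Let exY2 : Ex w (fun f => Y f ^+ 2) <=
  mu ^+ 2 + h1 * h2 ^+ 2 * (s * (t * p) ^+ 2) + h1 ^+ 2 * h2 * (t * (s * p) ^+ 2)
  + h1 * h2 * (s * (t * p)).
Proof.
rewrite (@eq_Ex _ _ _ w _ (fun f => \sum_(x in K1) \sum_(y in K2) \sum_(x' in K1)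
    \sum_(y' in K2) (xi x y f * xi x' y' f))); last first.
  move=> f; rewrite expr2 /Y mulr_suml; apply: eq_bigr => x xK.
  rewrite mulr_suml; apply: eq_bigr => y yK; rewrite mulr_sumr; apply: eq_bigr => x' x'K.
  by rewrite mulr_sumr.
rewrite (Ex_sum w).
apply: (@le_trans _ _ (\sum_(x in K1) \sum_(y in K2)
  (h1 * h2 * (s * (t * p)) ^+ 2 + h2 * (s * (t * p) ^+ 2) + h1 * (t * (s * p) ^+ 2) + (s * (t * p))))); last first.
  rewrite !sum_cst /mu -/h1 -/h2; apply: eq_ler; exact: alg1.
apply: ler_sum => x xK; rewrite (Ex_sum w); apply: ler_sum => y yK.
rewrite (Ex_sum w); under eq_bigr do rewrite (Ex_sum w).
apply: (le_trans (ler_sum _ (fun x' x'K => ler_sum _ (fun y' y'K => exxixi xK yK x'K y'K)))).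
apply: eq_ler.
transitivity (\sum_(x' in K1) (h2 * (s * (t * p)) ^+ 2 + h2 * ((x == x')%:R * (s * (t * p) ^+ 2))
   + t * (s * p) ^+ 2 + (x == x')%:R * (s * (t * p)))).
  apply: eq_bigr => x' _; rewrite !big_split/= !sum_cst -/h2.
  congr (_ + _ + _ + _); first by rewrite -mulr_suml sum_eq// mul1r.
  by rewrite -mulr_suml -mulr_sumr sum_eq// mulr1.
rewrite !big_split/= !sum_cst -/h1 -mulr_sumr -!mulr_suml sum_eq//.
by rewrite !mul1r !mulrA.
Qed.

(** Second moment method: the number of triples (entry vertex, exit vertex, edge) has mean [h^2 s t p],
    and the three error terms are the contributions to its variance of pairs of triples that share the
    first vertex, the second vertex, or both. *)
Lemma merge_fail (h : nat) : (0 < h)%N -> (h <= #|K1|)%N -> (h <= #|K2|)%N ->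
  Pr w (fun f => [forall x in K1, forall y in K2,
     ~~ [&& (f (x, x) < S)%N, (f (y, y) < T)%N & (f (coin x y) < P)%N]])
   <= (h%:R * s)^-1 + (h%:R * t)^-1 + (h%:R ^+ 2 * (s * t * p))^-1.
Proof.
move=> h0 hK1 hK2; set A := fun f => _.
have h10 : 0 < h1 by rewrite ltr0n (leq_trans h0).
have h20 : 0 < h2 by rewrite ltr0n (leq_trans h0).
have hh1 : h%:R <= h1 by rewrite ler_nat.
have hh2 : h%:R <= h2 by rewrite ler_nat.
have h0' : 0 < h%:R :> R by rewrite ltr0n.
have mu0 : 0 < mu by exact: (mulr_gt0 (mulr_gt0 h10 h20) (mulr_gt0 s0 (mulr_gt0 t0 p0))).
have le1 : mu ^+ 2 * Pr w A <= Ex w (fun f => (Y f - mu) ^+ 2).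
  rewrite -ExZ; apply: (le_Ex ww) => f; case: (boolP (A f)) => [Af|_]; last first.
    by rewrite mulr0n mulr0 sqr_ge0.
  rewrite mulr1n mulr1 [Y f]big1 ?sub0r ?sqrrN// => x xK; apply: big1 => y yK.
  move: Af => /forall_inP/(_ x xK)/forall_inP/(_ y yK).
  rewrite /xi /al /be /ga; do 3 case: (_ < _)%N => //=; rewrite ?mul0r ?mulr0//.
have le2 : Ex w (fun f => (Y f - mu) ^+ 2) = Ex w (fun f => Y f ^+ 2) - mu ^+ 2.
  rewrite (@eq_Ex _ _ _ w _ (fun f => Y f ^+ 2 - ((2 * mu) * Y f - mu ^+ 2))); last first.
    by move=> f; ring.
  by rewrite !ExB ExZ exY (Ex_cst ww); ring.
have le3 : Pr w A <= (h1 * s)^-1 + (h2 * t)^-1 + (h1 * h2 * (s * t * p))^-1.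
  rewrite -(ler_pM2l (exprn_gt0 2 mu0)) (le_trans le1)// le2 lerBlDl (le_trans exY2)// -!addrA lerD2l !addrA.
  by apply: eq_ler; apply: alg3.
by apply: (le_trans le3); apply: alg2.
Qed.

End Fixed.
End MergeBound.

(** * Hierarchical clusters *)

Section Cluster.
Context {n M : nat}.
Notation coins := {ffun 'I_n * 'I_n -> 'I_M}.
Variables (b sp : nat -> nat) (pos : 'I_n -> nat) (rich : pred nat).
Variables (P0 : nat) (S T P : nat -> nat).
Hypothesis b0 : forall k, (0 < b k)%N.

Definition len k : nat := \prod_(j < k) b j.
Definition digit j x : nat := ((pos x %/ len j) %% b j)%N.
Definition free k x := all (fun j => sp j <= digit j x)%N (iota 0 k).
Definition is_class k x := free k x && (digit k x < sp k)%N.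
Definition block k a : {set 'I_n} := [set x | (pos x %/ len k.+1)%N == a].

Definition base_edge (f : coins) x y := (x != y) && (f (coin x y) < P0)%N.
Definition merge_edge k (f : coins) x y :=
  [&& is_class k x, is_class k y, (f (x, x) < S k)%N, (f (y, y) < T k)%N & (f (coin x y) < P k)%N].

Definition dense_base (f : coins) (B : {set 'I_n}) :=
  [forall x in B, forall y in B, (x != y) ==> [exists z in B, base_edge f x z && base_edge f y z]].

Definition mergeable k (f : coins) (C1 C2 : {set 'I_n}) :=
  [exists x in C1, exists y in C2, merge_edge k f x y].

Definition assemble k m (f : coins) (C : 'I_m -> {set 'I_n}) :=
  if (#|[set i | C i == set0]| <= 2)%N &&
     [forall i : 'I_m, forall j : 'I_m, [&& (i < j)%N, C i != set0 & C j != set0] ==>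
        mergeable k f (C i) (C j)]
  then \bigcup_i C i else set0.

Lemma assemble_ext k m (f g : coins) (C D : 'I_m -> {set 'I_n}) :
  C =1 D -> (forall i j, mergeable k f (C i) (C j) = mergeable k g (D i) (D j)) ->
  assemble k f C = assemble k g D.
Proof.
move=> CD fg; rewrite /assemble (eq_bigr _ (fun i _ => CD i)).
have -> : [set i | C i == set0] = [set i | D i == set0] by apply/setP => i; rewrite !inE CD.
congr (if _ && _ then _ else _).
by apply: eq_forallb => i; apply: eq_forallb => j; rewrite fg !CD.
Qed.

Fixpoint cluster k a (f : coins) : {set 'I_n} :=
  match k with
  | 0 => if rich a && dense_base f (block 0 a) then block 0 a else set0
  | k'.+1 => assemble k' f (fun i : 'I_(b k) => cluster k' (a * b k + i)%N f)
  end.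

Lemma lenS k : len k.+1 = (len k * b k)%N.
Proof. by rewrite /len big_ord_recr. Qed.

Lemma block_parent k a (i : 'I_(b k.+1)) x :
  x \in block k (a * b k.+1 + i)%N -> x \in block k.+1 a.
Proof.
rewrite !inE (lenS k.+1) divnMA => /eqP ->.
by rewrite divnMDl// divn_small ?addn0.
Qed.

Lemma block_digit k a (i : 'I_(b k.+1)) x :
  x \in block k (a * b k.+1 + i)%N -> digit k.+1 x = i.
Proof. by rewrite inE /digit => /eqP ->; rewrite modnMDl modn_small. Qed.

Lemma block_disjoint k a a' : a != a' -> [disjoint block k a & block k a'].
Proof.
move=> aa'; rewrite disjoints_subset; apply/subsetP => x; rewrite !inE => /eqP ->.
exact: aa'.
Qed.

Lemma child_neq k a (i j : 'I_(b k)) : i != j -> (a * b k + i != a * b k + j)%N.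
Proof. by rewrite eqn_add2l. Qed.

Lemma cluster_block k a f : cluster k a f \subset block k a.
Proof.
elim: k a => [|k IH] a /=; first by case: ifP => _; rewrite ?sub0set.
rewrite /assemble; case: ifP => _; rewrite ?sub0set//.
apply/bigcupsP => i _; apply/subsetP => x /(subsetP (IH _)).
exact: block_parent.
Qed.

(** The marks of the vertices that are still free after level [k] have not been
    looked at by the clusters of level [k]. *)
Definition scope k a : {set 'I_n * 'I_n} :=
  [set p | [&& p.1 \in block k a, p.2 \in block k a & (p.1 != p.2) || ~~ free k p.1]].

Lemma in_scope k a p : (p \in scope k a) =
  [&& p.1 \in block k a, p.2 \in block k a & (p.1 != p.2) || ~~ free k p.1].
Proof. by rewrite inE. Qed.

Lemma coin_scope k a x y : x \in block k a -> y \in block k a -> x != y ->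
  coin x y \in scope k a.
Proof.
by move=> xB yB xy; rewrite in_scope /coin; case: ifP => _ /=; rewrite xB yB// ?xy// eq_sym xy.
Qed.

Lemma freeS k x : free k.+1 x = free k x && (sp k <= digit k x)%N.
Proof. by rewrite /free -addn1 iotaD all_cat /= andbT. Qed.

Lemma scope_child k a (i : 'I_(b k.+1)) : scope k (a * b k.+1 + i)%N \subset scope k.+1 a.
Proof.
apply/subsetP => p; rewrite !in_scope => /and3P[p1 p2 p3].
rewrite (block_parent p1) (block_parent p2)/=.
by case/orP: p3 => [->//|p3]; rewrite freeS (negPf p3) orbT.
Qed.

Lemma scope_disjoint k a a' : a != a' -> [disjoint scope k a & scope k a'].
Proof.
move=> aa'; rewrite disjoints_subset; apply/subsetP => p; rewrite in_setC !in_scope => /and3P[p1 _ _].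
by rewrite negb_and (disjointFr (block_disjoint k aa') p1).
Qed.

Lemma is_class_free k x : is_class k x -> ~~ free k.+1 x.
Proof. by rewrite freeS /is_class => /andP[_ H]; rewrite negb_and -ltnNge H orbT. Qed.

(** A cluster only looks at marks and coins inside its own block, which makes sibling clusters
    independent. *)
Lemma cluster_depends k a : depends_on (scope k a) (cluster k a).
Proof.
elim: k a => [|k IH] a f g fg /=.
  suff -> : dense_base f (block 0 a) = dense_base g (block 0 a) by [].
  apply: eq_forallb_in => x xB; apply: eq_forallb_in => y yB.
  congr (_ ==> _); apply: eq_existsb_in => z zB; rewrite /base_edge.
  case: (eqVneq x z) => //= xz; case: (eqVneq y z) => //= yz; first by rewrite !andbF.
  by rewrite !fg// coin_scope.
have CE (i : 'I_(b k.+1)) : cluster k (a * b k.+1 + i)%N f = cluster k (a * b k.+1 + i)%N g.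
  by apply: IH => p pS; apply: fg; exact: (subsetP (scope_child _ _) _ pS).
apply: assemble_ext => // i j; rewrite -!CE.
apply: eq_existsb_in => x xC; apply: eq_existsb_in => y yC.
have xB := block_parent (subsetP (cluster_block _ _ _) _ xC).
have yB := block_parent (subsetP (cluster_block _ _ _) _ yC).
rewrite /merge_edge; case: (boolP (is_class k x)) => //= /is_class_free xk.
case: (boolP (is_class k y)) => //= /is_class_free yk.
rewrite !fg// ?in_scope/= ?xB ?yB ?xk ?yk ?orbT//.
case: (eqVneq x y) => [->|xy]; last by have := coin_scope xB yB xy; rewrite in_scope.
by rewrite /coin ltnn/= yB yk orbT.
Qed.


Lemma card_bigcup_ge m (C : 'I_m -> {set 'I_n}) (G : {set 'I_m}) (N : nat) :
  (forall i j, i != j -> [disjoint C i & C j]) -> {in G, forall i, (N <= #|C i|)%N} ->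
  (#|G| * N <= #|\bigcup_i C i|)%N.
Proof.
move=> dC GN; rewrite -[leqRHS]sum1_card (partition_disjoint_bigcup addn (fun=> 1%N) dC) -sum_nat_const.
rewrite big_mkcond; apply: leq_sum => i _; case: ifP => // /GN.
by rewrite sum1_card.
Qed.

Lemma cluster_children_disjoint k a f (i j : 'I_(b k.+1)) : i != j ->
  [disjoint cluster k (a * b k.+1 + i)%N f & cluster k (a * b k.+1 + j)%N f].
Proof.
move=> ij; apply: disjointWl (cluster_block _ _ _) _.
apply: disjointWr (cluster_block _ _ _) _.
exact: block_disjoint (child_neq _ ij).
Qed.

Hypothesis richP : forall a, rich a -> exists2 v : 'I_(b 0) -> 'I_n,
  (forall r, pos (v r) = a * b 0 + r)%N & {subset block 0 a <= codom v}.
Hypothesis spS : forall k, sp k.+1 = 3%N.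
Hypothesis sp0 : (sp 0 <= b 0)%N.

Lemma block0 a : rich a -> exists2 v : 'I_(b 0) -> 'I_n, injective v &
  block 0 a = v @: setT /\ forall r, digit 0 (v r) = r.
Proof.
move=> /richP[v vP sv]; exists v.
  by move=> r r' e; apply/val_inj; have := vP r; rewrite e vP => /addnI.
have len1 : len 1 = b 0 by rewrite /len big_ord1.
split; last first.
  by move=> r; rewrite /digit /len big_ord0 divn1 vP modnMDl modn_small.
apply/setP => x; apply/idP/imsetP => [xB|[r _ ->]].
  by have /codomP[r ->] := sv _ xB; exists r.
by rewrite inE vP len1 divnMDl// divn_small// addn0.
Qed.

Lemma card_block0 a : rich a -> #|block 0 a| = b 0.
Proof. by move=> /block0[v vi [-> _]]; rewrite card_imset// cardsT card_ord. Qed.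

Lemma card_ord_lt m k : (k <= m)%N -> #|[set i : 'I_m | (i < k)%N]| = k.
Proof.
by move=> km; rewrite -sum1_card (eq_bigl (fun i : 'I_m => (i < k)%N)) => [|i];
  rewrite ?inE// -(big_ord_widen m (fun=> 1%N) km) sum1_card card_ord.
Qed.

Lemma card_ord_ge m k : (k <= m)%N -> #|[set i : 'I_m | (k <= i)%N]| = (m - k)%N.
Proof.
move=> km; have -> : [set i : 'I_m | (k <= i)%N] = ~: [set i : 'I_m | (i < k)%N].
  by apply/setP => i; rewrite !inE -leqNgt.
by rewrite cardsCs setCK card_ord card_ord_lt.
Qed.

Lemma card_class0 a : rich a -> #|block 0 a :&: [set x | is_class 0 x]| = sp 0.
Proof.
move=> /block0[v vi [-> dv]].
have -> : v @: setT :&: [set x | is_class 0 x] = v @: [set i : 'I_(b 0) | (i < sp 0)%N].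
  apply/setP => x; rewrite !inE; apply/andP/imsetP => [[/imsetP[r _ ->]]|[r]].
    by rewrite /is_class/= dv => ?; exists r; rewrite ?inE.
  by rewrite inE => rs ->; rewrite imset_f// /is_class/= dv.
by rewrite card_imset// card_ord_lt.
Qed.

Lemma card_free0 a : rich a -> #|block 0 a :&: [set x | free 1 x]| = (b 0 - sp 0)%N.
Proof.
move=> /block0[v vi [-> dv]].
have -> : v @: setT :&: [set x | free 1 x] = v @: [set i : 'I_(b 0) | (sp 0 <= i)%N].
  apply/setP => x; rewrite !inE; apply/andP/imsetP => [[/imsetP[r _ ->]]|[r]].
    by rewrite /free/= dv andbT => ?; exists r; rewrite ?inE.
  by rewrite inE => rs ->; rewrite imset_f// /free/= dv andbT.
by rewrite card_imset// card_ord_ge.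
Qed.

Fixpoint nfree k : nat := if k is k'.+1 then ((b k - 5) * nfree k')%N else (b 0 - sp 0)%N.
Fixpoint ntot k : nat := if k is k'.+1 then ((b k - 2) * ntot k')%N else b 0.
Definition nclass k : nat := if k is k'.+1 then nfree k' else sp 0.

(** Each level loses at most two children outright, and three digits are reserved for later merges; hence
    the factors [b - 2] and [b - 5]. *)
Lemma card_cluster k a f : cluster k a f != set0 ->
  (ntot k <= #|cluster k a f|)%N /\
  (nfree k <= #|cluster k a f :&: [set x | free k.+1 x]|)%N.
Proof.
elim: k a => [|k IH] a.
  rewrite /=; case: ifP => [/andP[ra _] _|]; last by rewrite eqxx.
  by rewrite card_block0 ?card_free0.
pose C (i : 'I_(b k.+1)) := cluster k (a * b k.+1 + i)%N f.
rewrite (_ : cluster k.+1 a f = assemble k f C)// /assemble.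
case: ifP => [|]; last by rewrite eqxx.
move=> /andP[e2 _] _.
pose G := [set i | C i != set0].
have cG : (b k.+1 - 2 <= #|G|)%N.
  have -> : G = ~: [set i | C i == set0] by apply/setP => i; rewrite !inE.
  by rewrite cardsCs setCK card_ord leq_sub2l.
split=> /=.
  apply: leq_trans (card_bigcup_ge _ (_ : {in G, _})).
  - exact: leq_mul cG (leqnn _).
  - by move=> i j ij; apply: cluster_children_disjoint.
  - by move=> i; rewrite inE => Ci0; have [] := IH _ Ci0.
have -> : (\bigcup_i C i) :&: [set x | free k.+2 x] = \bigcup_i (C i :&: [set x | free k.+2 x]).
  by rewrite -big_distrl.
apply: leq_trans (card_bigcup_ge _ (_ : {in G :\: [set i : 'I_(b k.+1) | (i < 3)%N], _})).
- apply: leq_mul (leqnn _).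
  rewrite cardsD -[5%N]/(2 + 3)%N subnDA; apply: leq_sub cG _.
  case: (leqP 3 (b k.+1)) => [b3|b3].
    by apply: leq_trans (subset_leq_card (subsetIr _ _)) _; rewrite card_ord_lt.
  by apply: leq_trans (max_card _) _; rewrite card_ord ltnW.
- move=> i j ij; apply: disjointWl (subsetIl _ _) _; apply: disjointWr (subsetIl _ _) _.
  exact: cluster_children_disjoint.
- move=> i; rewrite !inE -leqNgt => /andP[i3 Ci0]; have [_ /leq_trans-> //] := IH _ Ci0.
  apply/subset_leq_card/subsetP => x; rewrite !inE => /andP[xC xf].
  rewrite xC freeS xf/= spS (block_digit (subsetP (cluster_block _ _ _) _ xC))//.
Qed.

Lemma card_cluster_class k a f : ((0 < k) ==> (3 <= b k))%N ->
  cluster k a f != set0 ->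
  (nclass k <= #|cluster k a f :&: [set x | is_class k x]|)%N.
Proof.
case: k => [|k] bk.
  rewrite /=; case: ifP => [/andP[ra _] _|]; last by rewrite eqxx.
  by rewrite card_class0.
pose C (i : 'I_(b k.+1)) := cluster k (a * b k.+1 + i)%N f.
rewrite (_ : cluster k.+1 a f = assemble k f C)// /assemble.
case: ifP => [|]; last by rewrite eqxx.
move=> /andP[e2 _] _.
have [i i3 Ci0] : exists2 i : 'I_(b k.+1), (i < 3)%N & C i != set0.
  apply/exists_inP; rewrite -[X in is_true X]negbK negb_exists_in; apply/negP => /forall_inP H.
  suff : (3 <= #|[set i | C i == set0]|)%N by rewrite leqNgt ltnS e2.
  rewrite -(card_ord_lt (implyP bk isT)); apply/subset_leq_card/subsetP => i; rewrite !inE => /H.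
  by rewrite negbK.
have [_ /leq_trans->//] := card_cluster Ci0.
apply/subset_leq_card/subsetP => x; rewrite !inE => /andP[xC xf].
apply/andP; split; first by apply/bigcupP; exists i.
by rewrite /is_class xf/= spS (block_digit (subsetP (cluster_block _ _ _) _ xC)).
Qed.

Lemma cluster_rich k a f x : x \in cluster k a f -> rich (pos x %/ len 1)%N.
Proof.
elim: k a => [|k IH] a /=.
  by case: ifP => [/andP[ra _]|]; rewrite ?inE// => /eqP ->.
by rewrite /assemble; case: ifP => _; rewrite ?inE// => /bigcupP[i _ /IH].
Qed.

(** Clusters are connected inside any graph that contains the edges used to build them: base blocks are
    joined through common neighbours, and all surviving children of a block are joined pairwise. *)
Lemma cluster_connected K (e : rel 'I_n) f :
  (forall a x y, rich a -> x \in block 0 a -> y \in block 0 a ->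
     base_edge f x y -> e x y) ->
  (forall k a1 a2 x y, (k < K)%N -> (a1 < a2)%N -> (a1 %/ b k.+1 = a2 %/ b k.+1)%N ->
     x \in block k a1 -> y \in block k a2 ->
     rich (pos x %/ len 1)%N -> rich (pos y %/ len 1)%N ->
     merge_edge k f x y -> e x y) ->
  symmetric e ->
  forall k a, (k <= K)%N -> {in cluster k a f &, forall x y, connect e x y}.
Proof.
move=> ebase emerge es; elim=> [|k IH] a kK x y.
  rewrite /=; case: ifP => [/andP[ra /forall_inP db] xB yB|]; last by rewrite inE.
  case: (eqVneq x y) => [->//|xy].
  have := db x xB => /forall_inP/(_ y yB); rewrite xy => /exists_inP[z zB /andP[xz yz]].
  apply: (@connect_trans _ _ z); apply: connect1; first exact: ebase xB zB xz.
  by rewrite es; apply: ebase yB zB yz.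
pose C (i : 'I_(b k.+1)) := cluster k (a * b k.+1 + i)%N f.
rewrite (_ : cluster k.+1 a f = assemble k f C)// /assemble.
case: ifP => [/andP[_ /forallP mg]|]; last by rewrite inE.
have cs : connect_sym e by exact: sym_connect_sym.
have lt_join (i j : 'I_(b k.+1)) u v : (i < j)%N -> u \in C i -> v \in C j -> connect e u v.
  move=> ij uC vC; have /forallP/(_ j) := mg i; rewrite ij => /implyP.
  have -> : C i != set0 by apply/set0Pn; exists u.
  have -> : C j != set0 by apply/set0Pn; exists v.
  move=> /(_ isT) /exists_inP[u' u'C /exists_inP[v' v'C mE]].
  apply: (connect_trans (IH _ (ltnW kK) _ _ uC u'C)).
  apply: (@connect_trans _ _ v'); last exact: IH (ltnW kK) _ _ v'C vC.
  apply/connect1/(emerge k (a * b k.+1 + i)%N (a * b k.+1 + j)%N) => //.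
  - by rewrite ltn_add2l.
  - by rewrite !divnMDl// !divn_small.
  - exact: (subsetP (cluster_block _ _ _) _ u'C).
  - exact: (subsetP (cluster_block _ _ _) _ v'C).
  - exact: cluster_rich u'C.
  - exact: cluster_rich v'C.
move=> /bigcupP[i _ xC] /bigcupP[j _ yC].
case: (ltngtP i j) => [ij|ji|/val_inj ij]; first exact: lt_join xC yC.
  by rewrite cs; apply: lt_join yC xC.
by subst j; apply: IH (ltnW kK) _ _ xC yC.
Qed.

Fixpoint sparse k a : bool :=
  match k with
  | 0 => ~~ rich a
  | k'.+1 => (1 < #|[set i : 'I_(b k) | sparse k' (a * b k + i)%N]|)%N
  end.

Section Probability.
Context {R : realFieldType}.
Hypothesis M0 : (0 < M)%N.
Let w : 'I_n * 'I_n -> 'I_M -> R := unif.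
Let cardM : (0 < #|'I_M|)%N. Proof. by rewrite card_ord. Qed.
Let ww : is_weight w := unif_weight cardM.

Lemma Pr_dense_base a : rich a -> (P0 <= M)%N ->
  Pr w (fun f => ~~ dense_base f (block 0 a)) <=
   (b 0 ^ 2)%:R * (1 - (P0%:R / M%:R) ^+ 2) ^+ (b 0 - 2).
Proof.
move=> ra PM; set B := block 0 a; set p : R := P0%:R / M%:R.
have cB : #|B| = b 0 by rewrite card_block0.
pose F x y z (f : coins) : R := 1 - (f (coin x z) < P0)%N%:R * (f (coin y z) < P0)%N%:R.
pose N x y := enum (B :\ x :\ y).
have p01 : 0 <= p <= 1.
  by rewrite divr_ge0 ?ler0n//= ler_pdivrMr ?ltr0n// mul1r ler_nat.
have q01 : 0 <= 1 - p ^+ 2 <= 1.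
  case/andP: p01 => p0 p1; rewrite subr_ge0 gerBl exprn_ge0// andbT.
  by rewrite expr_le1.
have le1 f : (~~ dense_base f B)%:R <= \sum_(x in B) \sum_(y in B | x != y) \prod_(z <- N x y) F x y z f.
  have F0 x y : 0 <= \prod_(z <- N x y) F x y z f.
    apply: prodr_ge0 => z _; rewrite /F; do 2 case: (_ < _)%N => //=; rewrite ?mulr1n ?mulr0n; lra.
  case: (boolP (dense_base _ _)) => [_|]; first by rewrite !sumr_ge0// => x _; rewrite sumr_ge0.
  rewrite negb_forall_in => /exists_inP[x xB]; rewrite negb_forall_in => /exists_inP[y yB].
  rewrite negb_imply => /andP[xy]; rewrite negb_exists_in => /forall_inP H.
  rewrite (bigD1 x)//= (bigD1 y) ?yB//= big1_seq => [|z /andP[_]].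
    by rewrite -addrA lerDl addr_ge0// ?sumr_ge0// => ? _; rewrite ?sumr_ge0// => ? _.
  rewrite mem_enum !inE => /and3P[zy zx zB]; have := H z; rewrite inE zB => /(_ isT).
  rewrite /base_edge ![_ == z]eq_sym zx zy /= /F negb_and.
  by do 2 case: (_ < _)%N => //=; rewrite ?mulr1n ?mulr0n ?mulr0 ?mul0r subr0.
apply: (le_trans (le_Ex ww le1)).
rewrite (Ex_sum w); under eq_bigr do rewrite (Ex_sum w).
have exF x y : x \in B -> y \in B -> x != y ->
    Ex w (fun f => \prod_(z <- N x y) F x y z f) = (1 - p ^+ 2) ^+ (b 0 - 2).
  move=> xB yB xy.
  have inN z : z \in N x y -> (z != y) /\ (z != x).
    by rewrite mem_enum !inE => /and3P[].
  rewrite (Ex_prod ww (J := fun z => [set coin x z; coin y z])) ?enum_uniq//; last 2 first.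
  - move=> z z' /inN[zy zx] /inN[z'y z'x] zz'; rewrite disjoints_subset; apply/subsetP => c; rewrite !inE.
    by move=> /orP[] /eqP -> ; rewrite negb_or; apply/andP; split; apply/eqP => /coin_eq[][] e1 e2;
      move: zy zx z'y z'x zz' xy; rewrite ?e1 ?e2 ?eqxx// -?e1 -?e2 ?eqxx//.
  - move=> z _ f g fg; rewrite /F !fg// !inE eqxx ?orbT//.
  have cN : size (N x y) = (b 0 - 2)%N.
    by rewrite -cardE; have := cardsD1 x B; have := cardsD1 y (B :\ x); rewrite in_setD1 eq_sym xy yB xB cB /=; lia.
  rewrite -cN; elim: (N x y) inN => [|z s IH] inN; first by rewrite big_nil.
  rewrite big_cons IH ?exprS; last by move=> z' z's; apply: inN; rewrite inE z's orbT.
  have [zy zx] : z != y /\ z != x by apply: inN; rewrite inE eqxx.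
  congr (_ * _); rewrite /F ExB (Ex_cst ww).
  rewrite (ExM ww _ (@depends1 R n M (coin x z) P0) (@depends1 R n M (coin y z) P0)).
    by rewrite [Ex _ _](Pr_lt M0)// [X in _ * X](Pr_lt M0)// mulr1.
  rewrite disjoints1 inE; apply/eqP => /coin_eq[][] e1 e2; first by rewrite e1 eqxx in xy.
  by rewrite e1 eqxx in zx.
apply: (@le_trans _ _ (\sum_(x in B) \sum_(y in B) (1 - p ^+ 2) ^+ (b 0 - 2))).
  apply: ler_sum => x xB; rewrite big_mkcondr; apply: ler_sum => y yB.
  case: ifPn => xy; first by rewrite exF.
  by rewrite exprn_ge0//; case/andP: q01.
rewrite !sum_cst cB natrX expr2 mulrA; exact: lexx.
Qed.

Variable K : nat.
Variables (e m : nat -> R).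
Hypothesis b3 : forall k, (k < K)%N -> (3 <= b k.+1)%N.
Hypothesis thr : forall k, (k < K)%N ->
  [/\ (0 < S k <= M)%N, (0 < T k <= M)%N & (0 < P k <= M)%N].
Hypothesis ncl0 : forall k, (k < K)%N -> (0 < nclass k)%N.
Hypothesis m_ge : forall k, (k < K)%N ->
  ((nclass k)%:R * ((S k)%:R / M%:R))^-1 + ((nclass k)%:R * ((T k)%:R / M%:R))^-1
   + ((nclass k)%:R ^+ 2 * ((S k)%:R / M%:R * ((T k)%:R / M%:R) * ((P k)%:R / M%:R)))^-1 <= m k.
Hypothesis e0_ge : (P0 <= M)%N /\
  (b 0 ^ 2)%:R * (1 - (P0%:R / M%:R) ^+ 2) ^+ (b 0 - 2) <= e 0.
Hypothesis eS_ge : forall k, (k < K)%N -> (b k.+1)%:R ^+ 2 * (e k ^+ 2 + m k) <= e k.+1.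

(** Given the clusters of the two children, the marks of the class reserved for this level are still
    fresh, so the second moment bound applies conditionally. *)
Lemma Pr_not_mergeable k a (i j : 'I_(b k.+1)) : (k < K)%N -> (i < j)%N ->
  Pr w (fun f => let C l := cluster k (a * b k.+1 + l)%N f in
     [&& C i != set0, C j != set0 & ~~ mergeable k f (C i) (C j)]) <= m k.
Proof.
move=> kK ij; have [/andP[S0 SM] /andP[T0 TM] /andP[PP0 PM]] := thr kK.
apply: le_trans (m_ge kK).
set Bi := block k (a * b k.+1 + i)%N; set Bj := block k (a * b k.+1 + j)%N.
have dB : [disjoint Bi & Bj] by apply/block_disjoint/child_neq; rewrite -val_eqE/= neq_ltn ij.
pose J : {set 'I_n * 'I_n} := [set p | [|| [&& p.1 == p.2 & is_class k p.1],
   (p.1 \in Bi) && (p.2 \in Bj) | (p.2 \in Bi) && (p.1 \in Bj)]].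
have inJ p : (p \in J) = [|| [&& p.1 == p.2 & is_class k p.1],
   (p.1 \in Bi) && (p.2 \in Bj) | (p.2 \in Bi) && (p.1 \in Bj)] by rewrite inE.
apply: (Ex_le_resample ww (J := J)) => g.
pose C l := cluster k (a * b k.+1 + l)%N g.
have CE (f : coins) (l : 'I_(b k.+1)) : l = i \/ l = j -> cluster k (a * b k.+1 + l)%N (mix J f g) = C l.
  move=> lij; apply: cluster_depends => p; rewrite in_scope ffunE => /and3P[p1 p2 p3].
  case: ifPn => //; rewrite inE => /or3P[/andP[/eqP p12 pc]|/andP[p1i p2j]|/andP[p2i p1j]].
  - by move: p3; rewrite p12 eqxx /= -p12; case/andP: pc => ->.
  - case: lij => ll; subst l; first by have := disjointFr dB p2; rewrite p2j.
    by have := disjointFr dB p1i; rewrite p1.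
  - case: lij => ll; subst l; first by have := disjointFr dB p1; rewrite p1j.
    by have := disjointFr dB p2i; rewrite p2.
rewrite (@eq_Ex _ _ _ w _ (fun f => ([&& C i != set0, C j != set0 &
  ~~ mergeable k (mix J f g) (C i) (C j)])%:R)); last first.
  by move=> f /=; rewrite (CE f i (or_introl erefl)) (CE f j (or_intror erefl)).
case: (boolP (C i != set0)) => Ci /=; last first.
  rewrite [Ex _ _]big1 => [|f _]; last by rewrite mulr0.
  by rewrite !addr_ge0// ?invr_ge0 ?mulr_ge0 ?invr_ge0 ?exprn_ge0 ?ler0n.
case: (boolP (C j != set0)) => Cj /=; last first.
  rewrite [Ex _ _]big1 => [|f _]; last by rewrite mulr0.
  by rewrite !addr_ge0// ?invr_ge0 ?mulr_ge0 ?invr_ge0 ?exprn_ge0 ?ler0n.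
pose K1 := C i :&: [set x | is_class k x]; pose K2 := C j :&: [set x | is_class k x].
have CiB : C i \subset Bi by apply: cluster_block.
have CjB : C j \subset Bj by apply: cluster_block.
have dK : [disjoint K1 & K2].
  apply: disjointWl (subsetIl _ _) _; apply: disjointWr (subsetIl _ _) _.
  by apply: disjointWl CiB _; apply: disjointWr CjB _.
have b3k : ((0 < k) ==> (3 <= b k))%N by case: (k) kK => // k' /ltnW/b3.
have MF := (merge_fail (R := R) M0 SM TM PM dK S0 T0 PP0 (ncl0 kK) (card_cluster_class b3k Ci) (card_cluster_class b3k Cj)).
apply: (le_trans _ MF).
apply: (le_Ex ww) => f; rewrite ler_nat; apply: (@leq_trans (~~ mergeable k (mix J f g) (C i) (C j))) => //.
case: (boolP (mergeable _ _ _ _)) => //= nm; rewrite lt0b.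
apply/forall_inP => x; rewrite inE => /andP[xC]; rewrite inE => xc.
apply/forall_inP => y; rewrite inE => /andP[yC]; rewrite inE => yc.
have cJ : coin x y \in J.
  rewrite inJ /coin; have xB := subsetP CiB _ xC; have yB := subsetP CjB _ yC.
  by case: ifP => _ /=; rewrite xB yB ?orbT.
have dJ z : is_class k z -> (z, z) \in J by rewrite inJ /= eqxx => ->.
move: nm; rewrite negb_exists_in => /forall_inP/(_ x xC).
rewrite negb_exists_in => /forall_inP/(_ y yC).
by rewrite /merge_edge xc yc /= !ffunE cJ !dJ.
Qed.

(** A cluster fails when two of its non-sparse children fail (whence the squared error) or when two
    successful children do not merge; one bad child is tolerated, and so is one sparse child. *)
Lemma Pr_cluster k a : (k <= K)%N -> ~~ sparse k a ->
  Pr w (fun f => cluster k a f == set0) <= e k.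
Proof.
elim: k a => [|k IH] a kK ns.
  have ra : rich a by move: ns; rewrite negbK.
  have [PM /(le_trans _)-> //] := e0_ge.
  apply: le_trans (Pr_dense_base ra PM); apply: (le_Pr ww) => f /=.
  rewrite ra /=; case: (dense_base _ _) => //= /eqP B0.
  by have := card_block0 ra; rewrite B0 cards0 => /eqP; rewrite eq_sym -leqn0 leqNgt b0.
pose C f (i : 'I_(b k.+1)) := cluster k (a * b k.+1 + i)%N f.
pose D (i : 'I_(b k.+1)) := ~~ sparse k (a * b k.+1 + i)%N.
pose F1 i j f : R := [&& D i, D j, C f i == set0 & C f j == set0]%:R.
pose F2 i j f : R := [&& C f i != set0, C f j != set0 & ~~ mergeable k f (C f i) (C f j)]%:R.
have le1 f : (cluster k.+1 a f == set0)%:R <= \sum_(i < b k.+1) \sum_(j < b k.+1 | (i < j)%N) (F1 i j f + F2 i j f).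
  have F0 i j : 0 <= F1 i j f + F2 i j f by rewrite addr_ge0 ?ler0n.
  case: eqP => [c0|_]; last by rewrite !sumr_ge0// => i _; rewrite sumr_ge0.
  suff [i [j [ij H]]] : exists i j : 'I_(b k.+1), (i < j)%N /\ 1 <= F1 i j f + F2 i j f.
    rewrite (bigD1 i)//= (bigD1 j)//= (le_trans H)//.
    by rewrite -addrA lerDl addr_ge0// ?sumr_ge0// => ? _; rewrite ?sumr_ge0// => ? _.
  move: c0; rewrite (_ : cluster k.+1 a f = assemble k f (C f))// /assemble.
  case: ifPn => [/andP[c2 _] /eqP U0|].
    exfalso; move: c2; rewrite leqNgt => /negP; apply; rewrite (leq_trans (b3 kK))//.
    rewrite -[leqLHS]card_ord -cardsT subset_leq_card//; apply/subsetP => i _; rewrite inE.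
    by rewrite -subset0 -(eqP U0) bigcup_sup.
  rewrite negb_and -ltnNge => /orP[c3 _|].
    pose A := [set i | C f i == set0] :\: [set i | ~~ D i].
    have : (1 < #|A|)%N.
      rewrite cardsD; have : (#|[set i | ~~ D i]| <= 1)%N.
        rewrite leqNgt; apply: contraNN ns => H; rewrite /=; apply: leq_trans H _.
        by apply/subset_leq_card/subsetP => i; rewrite !inE negbK.
      have := subset_leq_card (subsetIr [set i | C f i == set0] [set i | ~~ D i]).
      by move: c3; lia.
    case/card_gt1P => i [j []]; rewrite !inE !negbK => /andP[Di Ci] /andP[Dj Cj] ij.
    wlog ij' : i j ij Di Ci Dj Cj / (i < j)%N.
      move=> H; case: (ltngtP i j) => [|ji|/val_inj e']; first exact: H.
        by apply: (H j i) => //; rewrite eq_sym.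
      by rewrite e' eqxx in ij.
    by exists i, j; rewrite /F1 /F2 Di Dj Ci Cj/=; split=> //; rewrite mulr0n addr0.
  rewrite negb_forall => /existsP[i]; rewrite negb_forall => /existsP[j].
  rewrite negb_imply => /andP[/and3P[ij Ci Cj] nm] _.
  by exists i, j; split=> //; rewrite /F2 Ci Cj nm lerDr /F1 ler0n.
apply: (le_trans (le_Ex ww le1)); apply: le_trans (eS_ge kK).
have m0 (i j : 'I_(b k.+1)) : (i < j)%N -> 0 <= m k.
  by move=> ij; apply: le_trans (Pr_ge0 ww _) (@Pr_not_mergeable k a i j kK ij).
rewrite (Ex_sum w); under eq_bigr do rewrite (Ex_sum w).
apply: (@le_trans _ _ (\sum_(i < b k.+1) \sum_(j < b k.+1 | (i < j)%N) (e k ^+ 2 + m k))).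
  apply: ler_sum => i _; apply: ler_sum => j ij; rewrite ExD; apply: lerD; last first.
    exact: Pr_not_mergeable kK ij.
  case: (boolP (D i && D j)) => [/andP[Di Dj]|nD]; last first.
    rewrite /Ex big1 ?sqr_ge0// => f _; rewrite /F1 andbA (negPf nD)/= mulr0n mulr0//.
  pose G i f : R := (C f i == set0)%:R.
  rewrite (@eq_Ex _ _ _ w _ (fun f => G i f * G j f)); last first.
    by move=> f; rewrite /F1 /G Di Dj /= -natrM mulnb.
  have dG (l : 'I_(b k.+1)) : depends_on (scope k (a * b k.+1 + l)%N) (G l).
    by move=> f g fg; rewrite /G /C (cluster_depends fg).
  rewrite (ExM ww _ (dG i) (dG j)).
    have GE l : D l -> 0 <= Ex w (G l) <= e k.
      by move=> Dl; apply/andP; split; [exact: Pr_ge0|exact: IH (ltnW kK) Dl].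
    have /andP[? ?] := GE i Di; have /andP[? ?] := GE j Dj.
    by rewrite expr2 ler_pM.
  by apply/scope_disjoint/child_neq; rewrite -val_eqE/= neq_ltn ij.
case: (ltnP 1 (b k.+1)) => [b1|b1]; last by have := b3 kK; lia.
have mk : 0 <= m k by apply: (m0 (Ordinal (ltnW b1)) (Ordinal b1)).
apply: (@le_trans _ _ (\sum_(i < b k.+1) \sum_(j < b k.+1) (e k ^+ 2 + m k))).
  apply: ler_sum => i _; rewrite big_mkcond; apply: ler_sum => j _.
  by case: ifP => // _; rewrite addr_ge0 ?sqr_ge0.
have SC (c : R) : \sum_(i < b k.+1) c = (b k.+1)%:R * c by rewrite sumr_const card_ord mulr_natl.
by rewrite !SC mulrA expr2.
Qed.
End Probability.
End Cluster.

(** * Blocks with too few useful vertices *)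

Section SparseTail.
Context {R : realFieldType} {I T : finType} (w : I -> T -> R).
Hypothesis ww : is_weight w.
Variables (b : nat -> nat) (rich : {ffun I -> T} -> pred nat) (Nb : nat).
Hypothesis b0 : forall k, (0 < b k)%N.

Definition width k : nat := \prod_(j < k) b j.+1.

Lemma widthS k : width k.+1 = (width k * b k.+1)%N.
Proof. by rewrite /width big_ord_recr. Qed.

Lemma len_width k : len b k.+1 = (b 0 * width k)%N.
Proof. by rewrite /len big_ord_recl. Qed.

Variables (q : R) (r : nat -> R).
Hypothesis poor_tail : forall s : seq nat, uniq s -> {in s, forall t, (t < Nb)%N} ->
  Pr w (fun f => all (fun t => ~~ rich f t) s) <= q ^+ size s.
Hypothesis q0 : 0 <= q.
Hypothesis r0 : q <= r 0.
Hypothesis rS : forall k, (b k.+1)%:R ^+ 2 * r k ^+ 2 <= r k.+1.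

Let r_ge0 k : 0 <= r k.
Proof.
case: k => [|k]; first exact: le_trans r0.
by apply: le_trans (rS k); rewrite mulr_ge0 ?sqr_ge0.
Qed.

Let inrange k a := (a.+1 * width k <= Nb)%N.

Let range_child k a (i : 'I_(b k.+1)) : inrange k.+1 a -> inrange k (a * b k.+1 + i).
Proof.
rewrite /inrange widthS [(_ * b _)%N]mulnC mulnA; apply: leq_trans; rewrite leq_mul2r.
by apply/orP; right; have := ltn_ord i; lia.
Qed.

Lemma sparse_family k (s : seq nat) : uniq s -> {in s, forall a, inrange k a} ->
  Pr w (fun f => all (sparse b (rich f) k) s) <= r k ^+ size s.
Proof.
elim: k s => [|k IH] s us sr.
  apply: (le_trans (@poor_tail s us _)).
    by move=> t /sr; rewrite /inrange /width big_ord0 muln1.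
  by rewrite lerXn2r// nnegrE.
suff H (s1 s2 : seq nat) : uniq s1 -> uniq s2 -> {in s1, forall a, inrange k.+1 a} ->
    {in s2, forall a, inrange k a} -> {in s2, forall c, (c %/ b k.+1)%N \notin s1} ->
    Pr w (fun f => all (sparse b (rich f) k.+1) s1 && all (sparse b (rich f) k) s2)
      <= r k.+1 ^+ size s1 * r k ^+ size s2.
  have := H s [::] us isT sr (fun _ => _) (fun _ => _); rewrite mulr1; move=> {}H.
  apply: le_trans (H _ _) => //; apply: (le_Pr ww) => f ->; by [].
elim: s1 s2 => [|a s1 IHs] s2 us1 us2 sr1 sr2 s12 /=.
  by rewrite mul1r; apply: IH.
have ar : inrange k.+1 a by apply: sr1; rewrite inE eqxx.
case/andP: us1 => as1 us1.
pose F i j f : R := (all (sparse b (rich f) k.+1) s1 && all (sparse b (rich f) k)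
   [:: (a * b k.+1 + i)%N, (a * b k.+1 + j)%N & s2])%:R.
have le1 f : ((sparse b (rich f) k.+1 a && all (sparse b (rich f) k.+1) s1) && all (sparse b (rich f) k) s2)%:R
   <= \sum_(i < b k.+1) \sum_(j < b k.+1 | i != j) F i j f.
  have F0 i j : 0 <= F i j f by rewrite ler0n.
  case: (boolP (_ && _)) => [/andP[/andP[/card_gt1P[i [j []]]]]|_]; last first.
    by rewrite !sumr_ge0// => i _; rewrite sumr_ge0.
  rewrite !inE => si sj ij h1 h2.
  have {}si : sparse b (rich f) k (a * b k.+1 + i)%N by exact: si.
  have {}sj : sparse b (rich f) k (a * b k.+1 + j)%N by exact: sj.
  rewrite (bigD1 i)//= (bigD1 j)//= {1}/F /= h1 h2 si sj /=.
  by rewrite -addrA lerDl addr_ge0// ?sumr_ge0// => ? _; rewrite ?sumr_ge0// => ? _.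
apply: (le_trans (le_Ex ww le1)); rewrite (Ex_sum w).
under eq_bigr do rewrite (Ex_sum w).
have rr : 0 <= r k.+1 ^+ size s1 * r k ^+ (size s2).+2.
  by rewrite mulr_ge0 ?exprn_ge0 ?r_ge0.
apply: (@le_trans _ _ (\sum_(i < b k.+1) \sum_(j < b k.+1) (r k.+1 ^+ size s1 * r k ^+ (size s2).+2))).
  apply: ler_sum => i _; rewrite big_mkcond; apply: ler_sum => j _.
  case: ifPn => // ij.
  have dv (l : 'I_(b k.+1)) : ((a * b k.+1 + l) %/ b k.+1 = a)%N by rewrite divnMDl// divn_small ?addn0.
  have ns2 (l : 'I_(b k.+1)) : (a * b k.+1 + l)%N \notin s2.
    by apply/negP => /s12; rewrite dv inE eqxx.
  apply: IHs => //.
  - by rewrite /= inE negb_or ns2 ns2 us2 eqn_add2l !andbT; exact: ij.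
  - by move=> c cs; apply: sr1; rewrite inE cs orbT.
  - by move=> c; rewrite !inE => /or3P[/eqP ->|/eqP ->|/sr2//]; apply: range_child.
  - move=> c; rewrite !inE => /or3P[/eqP ->|/eqP ->|/s12]; rewrite ?dv//.
    by rewrite inE negb_or => /andP[].
have SC (c : R) : \sum_(i < b k.+1) c = (b k.+1)%:R * c by rewrite sumr_const card_ord mulr_natl.
rewrite !SC; apply: le_trans (_ : _ <= (b k.+1)%:R ^+ 2 * r k ^+ 2 * (r k.+1 ^+ size s1 * r k ^+ size s2)) _; last first.
  rewrite [leRHS](_ : _ = r k.+1 * (r k.+1 ^+ size s1 * r k ^+ size s2)); last by rewrite [in LHS]exprS mulrA.
  by rewrite ler_wpM2r// mulr_ge0 ?exprn_ge0 ?r_ge0.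
by apply: eq_ler; rewrite !exprS; ring.
Qed.

(** A block is sparse only when two of its children are; disjoint blocks being sparse is controlled as a
    family, because occupation numbers are not independent. This is what squares the error. *)
Lemma Pr_sparse k a : (a.+1 * width k <= Nb)%N ->
  Pr w (fun f => sparse b (rich f) k a) <= r k.
Proof.
move=> ra; rewrite -[leRHS]expr1; apply: le_trans (@sparse_family k [:: a] isT _).
  by apply: (le_Pr ww) => f /= ->.
by move=> c; rewrite inE => /eqP ->.
Qed.
End SparseTail.

Section Occupancy.
Context {R : realFieldType} {n : nat} (Nb Th m : nat).
Hypotheses (Nb0 : (0 < Nb)%N) (Th0 : (0 < Th)%N).
Notation config := {ffun 'I_n -> 'I_Nb * 'I_Th}.
Implicit Types (f : config).

Definition users f t : {set 'I_n} := [set v | (val (f v).1 == t) && (val (f v).2 == 0%N)].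
Definition crowded f : pred nat := fun t => (m <= #|users f t|)%N.

Let cardT : #|{: 'I_Nb * 'I_Th}| = (Nb * Th)%N.
Proof. by rewrite card_prod !card_ord. Qed.
Let cardT0 : (0 < #|{: 'I_Nb * 'I_Th}|)%N.
Proof. by rewrite cardT muln_gt0 Nb0. Qed.
Let w : 'I_n -> 'I_Nb * 'I_Th -> R := unif.
Let ww : is_weight w := unif_weight cardT0.

Lemma bernoulli_le (x : R) k : 0 <= x <= 1 -> 1 - k%:R * x <= (1 - x) ^+ k.
Proof.
move=> /andP[x0 x1]; elim: k => [|k IH]; first by rewrite mul0r subr0.
rewrite exprS; apply: le_trans (ler_wpM2l _ IH); last by rewrite subr_ge0.
rewrite -subr_ge0 (_ : _ - _ = k%:R * x ^+ 2) ?mulr_ge0 ?ler0n ?sqr_ge0//.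
by rewrite -natr1; ring.
Qed.

Lemma card_val_mem (s : seq nat) : uniq s -> {in s, forall t, (t < Nb)%N} ->
  #|[set i : 'I_Nb | val i \in s]| = size s.
Proof.
move=> us sN; rewrite cardE -(size_map val); apply/perm_size/uniq_perm => //.
  by rewrite map_inj_uniq ?enum_uniq//; apply: val_inj.
move=> t; apply/mapP/idP => [[i]|ts]; first by rewrite mem_enum inE => ? ->.
by exists (Ordinal (sN t ts)) => //; rewrite mem_enum inE.
Qed.

(** Exponential Chebyshev bound: [2^m] times the mean of two to the power minus the number of useful
    vertices in each block of the family. *)
Lemma poor_tail_crowded (s : seq nat) : uniq s -> {in s, forall t, (t < Nb)%N} ->
  Pr w (fun f => all (fun t => ~~ crowded f t) s) <=
   (2 ^+ m * (1 - (2 * (Nb * Th))%:R^-1) ^+ n) ^+ size s.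
Proof.
move=> us sN.
pose h (c : 'I_Nb * 'I_Th) : R := if (val c.1 \in s) && (val c.2 == 0%N) then 2^-1 else 1.
have le1 f : (all (fun t => ~~ crowded f t) s)%:R <= 2 ^+ (m * size s) * \prod_(v <- enum 'I_n) h (f v).
  have -> : \prod_(v <- enum 'I_n) h (f v) = 2^-1 ^+ (\sum_(t <- s) #|users f t|)%N.
    rewrite big_enum/= (eq_bigr (fun v => 2^-1 ^+ ((val (f v).1 \in s) && (val (f v).2 == 0%N)))); last first.
      by move=> v _; rewrite /h; case: (_ && _).
    rewrite prodrXr; congr (_ ^+ _).
    under [RHS]eq_bigr do rewrite -sum1_card big_mkcond/=.
    rewrite exchange_big; apply: eq_bigr => v _ /=.
    case: (boolP (val (f v).2 == 0%N)) => f2; last first.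
      by rewrite andbF big1// => t _; rewrite inE (negPf f2) andbF.
    rewrite andbT; under eq_bigr do rewrite inE f2 andbT.
    rewrite -big_mkcond/= sum1_count; rewrite -(count_uniq_mem _ us).
    by apply: eq_count => t /=; rewrite eq_sym.
  have p0 (i : nat) : 0 <= 2^-1 ^+ i :> R by rewrite exprn_ge0// invr_ge0 ler0n.
  case: allP => [H|_]; last by rewrite mulr_ge0 ?p0 ?exprn_ge0 ?ler0n.
  apply: (@le_trans _ _ (2 ^+ (m * size s) * 2^-1 ^+ (m * size s))).
    by rewrite -exprMn divff ?expr1n// pnatr_eq0.
  rewrite ler_wpM2l ?exprn_ge0// ler_wiXn2l ?invr_ge0 ?ler0n ?invf_le1 ?ler1n//.
  elim: (s) H => [|t s' IHs] H; first by rewrite big_nil.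
  rewrite big_cons /= mulnS leq_add//; last by apply: IHs => u us'; apply: H; rewrite inE us' orbT.
  by have := H t (mem_head _ _); rewrite -ltnNge; apply: ltnW.
apply: (le_trans (le_Ex ww le1)); rewrite ExZ.
rewrite (Ex_prod ww (J := fun v => [set v]) (F := fun v f => h (f v))) ?enum_uniq//; last 2 first.
- by move=> v v' _ _ vv'; rewrite disjoints1 inE.
- by move=> v _ f g fg; rewrite fg ?inE.
set x := (2 * (Nb * Th))%:R^-1.
have NT0 : (0 < (Nb * Th)%:R :> R) by rewrite ltr0n muln_gt0 Nb0.
have sNb : (size s <= Nb)%N.
  by rewrite -(card_val_mem us sN) (leq_trans (max_card _))// card_ord.
have hE v : Ex w (fun f => h (f v)) = 1 - (size s)%:R * x.
  rewrite (Ex_coord ww); under eq_bigr do rewrite /w /unif.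
  rewrite -mulr_sumr cardT.
  pose U : {set 'I_Nb * 'I_Th} := setX [set i : 'I_Nb | val i \in s] [set Ordinal Th0].
  have cU : #|U| = size s by rewrite cardsX cards1 muln1 card_val_mem.
  rewrite (eq_bigr (fun c => 1 - (c \in U)%:R * 2^-1)); last first.
    move=> c _; rewrite /h !inE -val_eqE /=; case: (_ && _); rewrite ?mul0r ?subr0//=.
    by rewrite mulr1n mul1r; lra.
  have sU : \sum_c (c \in U)%:R = (size s)%:R :> R.
    rewrite -cU -sum1_card natr_sum [RHS]big_mkcond; apply: eq_bigr => c _.
    by case: ifP.
  rewrite sumrB sumr_const cardT -mulr_suml sU.
  rewrite /x natrM; field; by rewrite ?pnatr_eq0 ?muln_eq0 ?negb_or -?lt0n ?Nb0 ?Th0.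
under eq_bigr do rewrite hE.
rewrite big_enum/= prodr_const card_ord exprMn -exprM ler_wpM2l ?exprn_ge0//.
rewrite -exprM mulnC exprM lerXn2r ?nnegrE ?exprn_ge0//.
  rewrite subr_ge0 /x ler_pdivrMr ?ltr0n ?muln_gt0 ?Nb0// mul1r ler_nat.
  by apply: (leq_trans sNb); rewrite mulnC -mulnA leq_pmulr// muln_gt0 Th0.
all: have x01 : 0 <= x <= 1 by rewrite /x invr_ge0 ler0n invf_le1 ?ltr0n ?ler1n muln_gt0 ?muln_gt0 ?Nb0 ?Th0.
  by case/andP: x01; rewrite subr_ge0.
exact: bernoulli_le.
Qed.

(** Reads off a vertex its slot: block number and rank among the first [m]
    useful vertices of that block; the other vertices are sent out of range. *)
Definition slot f v : nat :=
  let t := val (f v).1 in let r := index v (enum (users f t)) in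
  if (val (f v).2 == 0%N) && (r < m)%N then (t * m + r)%N else (Nb * m)%N.

Lemma slot_rich (b : nat -> nat) f a : (0 < m)%N -> b 0%N = m -> crowded f a ->
  exists2 v : 'I_(b 0%N) -> 'I_n, (forall r, slot f (v r) = a * b 0%N + r)%N &
    {subset block b (slot f) 0 a <= codom v}.
Proof.
move=> m0 bm ra.
have len1 : len b 1 = m by rewrite /len big_ord1 bm.
have [v0 v0U] : exists v0, v0 \in users f a.
  by apply/card_gt0P; apply: leq_trans ra.
have aNb : (a < Nb)%N by move: v0U; rewrite inE => /andP[/eqP <- _]; exact: ltn_ord.
exists (fun r => nth v0 (enum (users f a)) r).
  move=> r; have rm : (r < m)%N by rewrite -bm.
  have ru : (r < size (enum (users f a)))%N by rewrite -cardE (leq_trans rm).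
  have := mem_nth v0 ru; rewrite mem_enum inE => /andP[/eqP e1 e2].
  by rewrite /slot e1 e2 index_uniq ?enum_uniq// rm /=; congr (_ * _ + _)%N; rewrite bm.
move=> x; rewrite inE len1 /slot; case: ifP => [/andP[x2 xr]|_]; last first.
  by rewrite mulnK// => /eqP e; move: aNb; rewrite e ltnn.
rewrite divnMDl// divn_small// addn0 => /eqP e; rewrite e in xr.
have xr' : (index x (enum (users f a)) < b 0%N)%N by rewrite bm.
by apply/codomP; exists (Ordinal xr'); rewrite /= nth_index// mem_enum inE e eqxx x2.
Qed.
End Occupancy.

(** * A large component in the finite model *)

Section FiniteModel.
Context {R : realFieldType}.
Variables (n Nb Th M : nat).
Notation config := {ffun 'I_n -> 'I_Nb * 'I_Th}.
Notation coins := {ffun 'I_n * 'I_n -> 'I_M}.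
Variable thr : config -> 'I_n -> 'I_n -> 'I_M -> 'I_M -> nat.
Hypothesis thrC : forall s v w i j, thr s v w i j = thr s w v j i.

Definition model_graph (s : config) (f : coins) : rel 'I_n := fun v w =>
  (v != w) && (f (coin v w) < thr s v w (f (v, v)) (f (w, w)))%N.

Lemma model_graphC s f : symmetric (model_graph s f).
Proof. by move=> v w; rewrite /model_graph eq_sym thrC coinC. Qed.

Variables (b sp : nat -> nat) (P0 : nat) (S T P : nat -> nat) (K : nat).
Hypothesis Nb0 : (0 < Nb)%N.
Hypothesis Th0 : (0 < Th)%N.
Hypothesis M0 : (0 < M)%N.
Hypothesis b0 : forall k, (0 < b k)%N.
Hypothesis spS : forall k, sp k.+1 = 3%N.
Hypothesis sp0 : (sp 0 <= b 0)%N.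

Definition useful (s : config) v := val (s v).2 == 0%N.

Hypothesis thr_base : forall s v w i j, useful s v -> useful s w ->
  val (s v).1 = val (s w).1 -> (P0 <= thr s v w i j)%N.
Hypothesis thr_merge : forall k s v w (i j : 'I_M), (k < K)%N -> useful s v -> useful s w ->
  (val (s v).1 %/ width b k.+1 = val (s w).1 %/ width b k.+1)%N ->
  (i < S k)%N -> (j < T k)%N -> (P k <= thr s v w i j)%N.

Variables (e m r : nat -> R).
Hypothesis b3 : forall k, (k < K)%N -> (3 <= b k.+1)%N.
Hypothesis thr_range : forall k, (k < K)%N ->
  [/\ (0 < S k <= M)%N, (0 < T k <= M)%N & (0 < P k <= M)%N].
Hypothesis ncl0 : forall k, (k < K)%N -> (0 < nclass b sp k)%N.
Hypothesis m_ge : forall k, (k < K)%N ->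
  ((nclass b sp k)%:R * ((S k)%:R / M%:R))^-1 + ((nclass b sp k)%:R * ((T k)%:R / M%:R))^-1
   + ((nclass b sp k)%:R ^+ 2 * ((S k)%:R / M%:R * ((T k)%:R / M%:R) * ((P k)%:R / M%:R)))^-1 <= m k.
Hypothesis e0_ge : (P0 <= M)%N /\
  (b 0 ^ 2)%:R * (1 - (P0%:R / M%:R) ^+ 2) ^+ (b 0 - 2) <= e 0.
Hypothesis eS_ge : forall k, (k < K)%N -> (b k.+1)%:R ^+ 2 * (e k ^+ 2 + m k) <= e k.+1.
Hypothesis eK0 : 0 <= e K.
Hypothesis r0 : 2 ^+ b 0 * (1 - (2 * (Nb * Th))%:R^-1) ^+ n <= r 0.
Hypothesis rS : forall k, (b k.+1)%:R ^+ 2 * r k ^+ 2 <= r k.+1.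
Hypothesis widthK : (width b K <= Nb)%N.

Let ws : 'I_n -> 'I_Nb * 'I_Th -> R := unif.
Let wf : 'I_n * 'I_n -> 'I_M -> R := unif.

Let wws : is_weight ws.
Proof. by apply: unif_weight; rewrite card_prod !card_ord muln_gt0 Nb0. Qed.
Let wwf : is_weight wf.
Proof. by apply: unif_weight; rewrite card_ord. Qed.

Let slot_useful s v : crowded (b 0) s (slot (b 0) s v %/ len b 1)%N ->
  useful s v /\ forall k, (slot (b 0) s v %/ len b k.+1 = val (s v).1 %/ width b k)%N.
Proof.
have len1 : len b 1 = b 0 by rewrite /len big_ord1.
rewrite /slot len1; case: ifP => [/andP[u ri] _|_]; last first.
  rewrite mulnK// /crowded => rN; suff: (0 < #|users s Nb|)%N.
    by move/card_gt0P => [x]; rewrite inE => /andP[/eqP] e1; have := ltn_ord (s x).1; rewrite e1 ltnn.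
  exact: leq_trans rN.
split=> // k; rewrite len_width divnMA divnMDl// (divn_small ri) addn0//.
Qed.

Lemma cluster_in_model s f : ~~ (cluster b sp (slot (b 0) s) (crowded (b 0) s) P0 S T P K 0 f == set0) ->
  exists x, (ntot b K <= #|connect (model_graph s f) x|)%N.
Proof.
set C := cluster _ _ _ _ _ _ _ _ _ _ _ => C0.
have richP a : crowded (b 0) s a -> exists2 v : 'I_(b 0%N) -> 'I_n,
    (forall r, slot (b 0) s (v r) = a * b 0%N + r)%N &
    {subset block b (slot (b 0) s) 0 a <= codom v} by exact: slot_rich.
have [nC _] := card_cluster b0 richP spS sp0 C0.
have /set0Pn[x xC] := C0.
exists x; apply: leq_trans nC _; apply/subset_leq_card/subsetP => y yC.
apply: (cluster_connected (K := K) b0 _ _ _ (leqnn _) xC yC); last exact: model_graphC.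
- move=> a u v ra; rewrite !inE => /eqP ua /eqP va /andP[uv fP].
  have [|uu /(_ 0%N) ut] := @slot_useful s u; first by rewrite ua.
  have [|vu /(_ 0%N) vt] := @slot_useful s v; first by rewrite va.
  rewrite /model_graph uv (leq_trans fP)// thr_base//.
  by move: ut vt; rewrite ua va /width big_ord0 !divn1 => <- <-.
- move=> k a1 a2 u v kK a12 ap ua va /slot_useful[uu ut] /slot_useful[vu vt].
  move=> /and5P[_ _ fS fT fP].
  have uv : u != v.
    apply/eqP => uv; move: ua va; rewrite !inE uv => /eqP -> /eqP e12.
    by rewrite e12 ltnn in a12.
  rewrite /model_graph uv (leq_trans fP)// thr_merge//.
  by rewrite widthS !divnMA -ut -vt; move: ua va; rewrite !inE => /eqP -> /eqP ->.
Qed.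

(** Combines the two recursions: the probability that the top block is sparse and the probability that
    its cluster fails although it is not. *)
Lemma giant_in_model :
  1 - (r K + e K) <= Ex ws (fun s => Pr wf (fun f =>
    [exists x, (ntot b K <= #|connect (model_graph s f) x|)%N])).
Proof.
have Prs : Pr ws (fun s => sparse b (crowded (b 0) s) K 0) <= r K.
  apply: (Pr_sparse wws (rich := crowded (b 0)) (Nb := Nb) b0 _ _ r0 rS); rewrite ?mul1n//.
    by move=> t ut tN; apply: poor_tail_crowded.
  rewrite mulr_ge0 ?exprn_ge0// subr_ge0 invf_le1 ?ltr0n ?ler1n ?muln_gt0 ?Nb0 ?Th0//.
apply: (@le_trans _ _ (Ex ws (fun s => (1 - e K) - (sparse b (crowded (b 0) s) K 0)%:R))).
  rewrite (ExB ws) (Ex_cst wws) opprD addrA -addrA [- r K - _]addrC addrA lerB//.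
apply: (le_Ex wws) => s.
have richP a : crowded (b 0) s a -> exists2 v : 'I_(b 0%N) -> 'I_n,
    (forall r, slot (b 0) s (v r) = a * b 0%N + r)%N &
    {subset block b (slot (b 0) s) 0 a <= codom v} by exact: slot_rich.
have PC ns := @Pr_cluster n M b sp (slot (b 0) s) (crowded (b 0) s) P0 S T P b0 richP spS sp0 R M0 K e m b3
  thr_range ncl0 m_ge e0_ge eS_ge K 0 (leqnn _) ns.
case: (boolP (sparse _ _ _ _)) => [_|ns].
  by apply: le_trans (Pr_ge0 wwf _); rewrite mulr1n addrAC subrr sub0r oppr_le0.
rewrite subr0; set Q := fun f : coins => cluster b sp (slot (b 0) s) (crowded (b 0) s) P0 S T P K 0 f == set0.
apply: (@le_trans _ _ (1 - Pr wf Q)).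
  by rewrite lerD2l lerN2; apply: PC.
rewrite -(PrC wwf); apply: (le_Pr wwf) => f /cluster_in_model[x xP].
by apply/existsP; exists x.
Qed.
End FiniteModel.

(** * Monotonicity of product Bernoulli measures *)

Section Change.
Context {R : realFieldType} {I T : finType}.
Implicit Types (w : I -> T -> R).

(** Exchanging the coordinates of [J] between a sample of [w] and a sample of
    [w'] preserves their joint law. *)
Lemma Ex_change (J : {set I}) w w' (F : {ffun I -> T} -> R) :
  is_weight w -> is_weight w' -> {in J, forall i, w i =1 w' i} -> depends_on J F -> Ex w F = Ex w' F.
Proof.
move=> ww ww' wJ dF.
transitivity (Ex w (fun f => Ex w' (fun g => F f))).
  by apply: eq_Ex => f; rewrite Ex_cst.
transitivity (Ex w (fun f => Ex w' (fun g => F g))); last by rewrite Ex_cst.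
rewrite /Ex; under eq_bigr do rewrite mulr_sumr.
under [RHS]eq_bigr do rewrite mulr_sumr.
rewrite !pair_big/= (reindex_inj (can_inj (mix_bij (~: J))))/=; apply: eq_bigr => -[f g] _ /=.
rewrite (dF (mix (~: J) f g) g); last by move=> i iJ; rewrite !ffunE inE iJ.
rewrite !mulrA; congr (_ * _).
rewrite /weight -!big_split; apply: eq_bigr => i _ /=; rewrite !ffunE inE.
by case: (boolP (i \in J)) => //= iJ; rewrite !wJ// mulrC.
Qed.

Definition upd (f : {ffun I -> T}) i t : {ffun I -> T} := [ffun j => if j == i then t else f j].

Lemma Ex_split w i F : is_weight w -> Ex w F = \sum_t w i t * Ex w (fun f => F (upd f i t)).
Proof.
move=> ww; rewrite -(Ex_resample ww [set i]).
rewrite (@eq_Ex _ _ _ w _ (fun g => \sum_t w i t * F (upd g i t))); last first.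
  move=> g; rewrite -(Ex_coord ww i (fun t => F (upd g i t))); apply: eq_Ex => f; congr F.
  by apply/ffunP => j; rewrite !ffunE inE; case: eqP => [->|].
by rewrite (Ex_sum w); apply: eq_bigr => t _; rewrite ExZ.
Qed.

Lemma Ex_map (T' : finType) w (phi : I -> T -> T') (F : {ffun I -> T'} -> R) :
  Ex w (fun f => F [ffun i => phi i (f i)]) =
  Ex (fun i t' => \sum_(t | phi i t == t') w i t) F.
Proof.
rewrite /Ex (partition_big (fun f : {ffun I -> T} => [ffun i => phi i (f i)]) xpredT)//=.
apply: eq_bigr => g _; rewrite /weight.
rewrite (bigA_distr_big_dep (fun i t => phi i t == g i)) mulr_suml.
apply: eq_big => [f|f /eqP ->//].
apply/eqP/familyP => [<- i|H]; first by rewrite unfold_in /= ffunE eqxx.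
by apply/ffunP => i; rewrite ffunE; apply/eqP; have := H i; rewrite unfold_in.
Qed.
End Change.

Section Bernoulli.
Context {R : realFieldType} {I : finType}.
Implicit Types (p q : I -> R) (f g : {ffun I -> bool}).

Definition bern p : I -> bool -> R := fun i b => if b then p i else 1 - p i.

Lemma bern_weight p : (forall i, 0 <= p i <= 1) -> is_weight (bern p).
Proof.
move=> p01; split=> [i b|i]; last by rewrite big_bool /bern /= addrC subrK.
by have /andP[p0 p1] := p01 i; case: b => //=; rewrite subr_ge0.
Qed.

Definition increasing (U : pred {ffun I -> bool}) :=
  forall f g, (forall i, f i -> g i) -> U f -> U g.

Lemma bern_mono1 p q i0 U : (forall i, 0 <= p i <= 1) -> (forall i, 0 <= q i <= 1) ->
  p i0 <= q i0 -> (forall i, i != i0 -> p i = q i) -> increasing U ->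
  Pr (bern p) U <= Pr (bern q) U.
Proof.
move=> p01 q01 pq0 pq inc; have wp := bern_weight p01; have wq := bern_weight q01.
rewrite /Pr (Ex_split i0 _ wp) (Ex_split i0 _ wq) !big_bool /=.
have E b : Ex (bern p) (fun f => (U (upd f i0 b))%:R) = Ex (bern q) (fun f => (U (upd f i0 b))%:R).
  apply: (Ex_change (J := [set~ i0])) => // [i|f g fg].
    by rewrite !inE => ii0 c; rewrite /bern pq.
  congr (_%:R); congr U; apply/ffunP => i; rewrite !ffunE; case: eqP => // /eqP ii0.
  by rewrite fg// !inE.
rewrite !E /bern.
have : Ex (bern q) (fun f => (U (upd f i0 false))%:R) <= Ex (bern q) (fun f => (U (upd f i0 true))%:R).
  apply: (le_Ex wq) => f; rewrite ler_nat.
  case: (boolP (U (upd f i0 false))) => // Uf; rewrite lt0b.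
  by apply: inc Uf => i; rewrite !ffunE; case: eqP.
set a := Ex _ _; set b := Ex _ _ => ab.
rewrite -subr_ge0 (_ : _ - _ = (q i0 - p i0) * (b - a)); last by ring.
by rewrite mulr_ge0// subr_ge0.
Qed.

(** The coordinates are changed one at a time; along one coordinate the probability of an increasing
    event is affine with nonnegative slope. *)
Lemma bern_mono p q U : (forall i, 0 <= p i <= 1) -> (forall i, 0 <= q i <= 1) ->
  (forall i, p i <= q i) -> increasing U -> Pr (bern p) U <= Pr (bern q) U.
Proof.
move=> p01 q01 pq inc.
pose h s i := if i \in (s : seq I) then q i else p i.
have h01 s i : 0 <= h s i <= 1 by rewrite /h; case: ifP.
have H s : Pr (bern p) U <= Pr (bern (h s)) U.
  elim: s => [|j s IH]; first exact: lexx.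
  apply: (le_trans IH); apply: (@bern_mono1 _ _ j) => //.
    by rewrite /h inE eqxx; case: ifP.
  by move=> i ij; rewrite /h inE (negPf ij).
apply: (le_trans (H (enum I))); rewrite le_eqVlt; apply/orP; left; apply/eqP.
apply: eq_bigr => f _; congr (_ * _); apply: eq_bigr => i _.
by rewrite /bern /h mem_enum.
Qed.

(** Comparing uniform coins with thresholds realizes a product Bernoulli measure. *)
Lemma Pr_threshold (M : nat) (thr : I -> nat) (U : pred {ffun I -> bool}) :
  (0 < M)%N -> (forall i, thr i <= M)%N ->
  Pr unif (fun u : {ffun I -> 'I_M} => U [ffun i => (u i < thr i)%N]) =
  Pr (bern (fun i => (thr i)%:R / M%:R : R)) U.
Proof.
move=> M0 tM; rewrite /Pr (Ex_map unif (fun i (t : 'I_M) => (t < thr i)%N) (fun f => (U f)%:R)).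
apply: eq_bigr => f _; congr (_ * _); apply: eq_bigr => i _.
have E : \sum_(t < M | (t < thr i)%N) (M%:R^-1 : R) = (thr i)%:R / M%:R.
  by rewrite -(big_ord_widen M (fun=> M%:R^-1) (tM i)) sumr_const card_ord mulr_natl.
rewrite /bern /unif card_ord; case: (f i) => /=.
  by rewrite -E; apply: eq_bigl => t; case: (_ < _)%N.
have S1 : \sum_(t < M) (M%:R^-1 : R) = 1.
  by rewrite sumr_const card_ord -[_ *+ _]mulr_natl divff// pnatr_eq0 -lt0n.
have S2 : \sum_(t < M) (M%:R^-1 : R) =
    (thr i)%:R / M%:R + \sum_(t < M | ~~ (t < thr i)%N) M%:R^-1.
  by rewrite -E (bigID (fun t : 'I_M => (t < thr i)%N)).
move: S2; rewrite S1 => S3; apply/eqP; rewrite eq_sym subr_eq addrC; apply/eqP.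
rewrite [LHS]S3; congr (_ + _).
by apply: eq_bigl => t; case: (_ < _)%N.
Qed.
End Bernoulli.

Section Marginal.
Context {R : realFieldType} {I J T : finType}.
Variables (k : J -> I) (w : I -> T -> R).
Hypothesis kI : injective k.
Hypothesis ww : is_weight w.

Let ext (f : {ffun I -> T}) (g : {ffun J -> T}) : {ffun I -> T} :=
  [ffun i => if [pick j | k j == i] is Some j then g j else f i].
Let res (f : {ffun I -> T}) : {ffun J -> T} := [ffun j => f (k j)].

Let extk f g j : ext f g (k j) = g j.
Proof.
by rewrite ffunE; case: pickP => [j' /eqP/kI -> //|/(_ j)]; rewrite eqxx.
Qed.

Let ext_out f g i : i \notin codom k -> ext f g i = f i.
Proof.
move=> ik; rewrite ffunE; case: pickP => // j /eqP ji.
by rewrite -ji codom_f in ik.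
Qed.

Let swap_inv : involutive (fun p : {ffun I -> T} * {ffun J -> T} => (ext p.1 p.2, res p.1)).
Proof.
move=> [f g]; congr (_, _); apply/ffunP => i /=; last by rewrite ffunE extk.
case: (boolP (i \in codom k)) => [/codomP[j ->]|ik]; last by rewrite !ext_out.
by rewrite extk ffunE.
Qed.

Let wr : is_weight (fun j => w (k j)).
Proof. by split=> [j t|j]; case: ww. Qed.

Let prod_split (F : I -> R) : \prod_i F i = \prod_j F (k j) * \prod_(i | i \notin codom k) F i.
Proof.
rewrite (bigID (mem (codom k)))/=; congr (_ * _).
rewrite -(big_imset F (h := k) (A := predT)); last by move=> ? ? _ _ /kI.
apply: eq_bigl => i; apply/codomP/imsetP => [[j ->]|[j _ ->]]; by exists j.
Qed.

Lemma Ex_marginal (F : {ffun J -> T} -> R) :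
  Ex w (fun f => F [ffun j => f (k j)]) = Ex (fun j => w (k j)) F.
Proof.
transitivity (Ex w (fun f => Ex (fun j => w (k j)) (fun g => F (res f)))).
  by apply: eq_Ex => f; rewrite (Ex_cst wr).
transitivity (Ex w (fun f => Ex (fun j => w (k j)) (fun g => F g))); last by rewrite (Ex_cst ww).
rewrite /Ex; under eq_bigr do rewrite mulr_sumr.
under [RHS]eq_bigr do rewrite mulr_sumr.
rewrite !pair_big/= (reindex_inj (can_inj swap_inv))/=; apply: eq_bigr => -[f g] _ /=.
have -> : res (ext f g) = g by apply/ffunP => j; rewrite ffunE extk.
rewrite !mulrA; congr (_ * _); rewrite /weight [\prod_i w i (ext f g i)]prod_split [\prod_i w i (f i)]prod_split.
rewrite [LHS]mulrC [RHS]mulrAC mulrA; congr (_ * _ * _).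
- by apply: eq_bigr => j _; rewrite ffunE.
- by apply: eq_bigr => j _; rewrite extk.
- by apply: eq_bigr => i ik; rewrite ext_out.
Qed.
End Marginal.

From mathcomp Require Import all_classical all_reals all_analysis.
From mathcomp Require Import measurable_realfun.
Import Order.TTheory GRing.Theory Num.Theory.
Import numFieldNormedType.Exports.
Local Open Scope classical_set_scope.
Local Open Scope ring_scope.

(** * Measure-theoretic preliminaries *)

Section LowerIntegral.
Context d (T : measurableType d) (R : realType).
Variable mu : {measure set T -> \bar R}.
Local Open Scope ereal_scope.
Implicit Types (A B N : set T) (f g : T -> \bar R).

(** The integral of a nonnegative function is a supremum over the simple
    functions below it, hence monotone even without measurability. *)
Lemma ge0_integral_mono A B f g :
  (forall x, A x -> 0 <= f x) -> (forall x, B x -> 0 <= g x) ->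
  (forall x, A x -> B x /\ f x <= g x) ->
  \int[mu]_(x in A) f x <= \int[mu]_(x in B) g x.
Proof.
move=> f0 g0 fg; rewrite integral_mkcond [leRHS]integral_mkcond.
rewrite !ge0_integralTE; [|exact: erestrict_ge0..].
apply: le_ereal_sup => _ [h hf <-]; exists h => // x.
apply: (le_trans (hf x)); rewrite !patchE.
case: ifPn => [/set_mem /fg[Bx fgx]|_]; first by rewrite mem_set.
by case: ifPn => // /set_mem; exact: g0.
Qed.

Lemma integral_off_null A N f g : measurable A -> measurable N -> mu N = 0 ->
  measurable_fun A g -> (forall x, A x -> 0 <= g x) ->
  (forall x, A x -> ~ N x -> f x = g x) ->
  \int[mu]_(x in A) f x = \int[mu]_(x in A) g x.
Proof.
move=> mA mN N0 mg g0 fg.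
pose c : T -> \bar R := (cst +oo) \_ N.
have mc : measurable_fun A c.
  apply: measurable_funTS; rewrite /c; apply/(measurable_restrictT _ mN).
  exact: measurable_cst.
have c0 x : 0 <= c x by rewrite /c patchE; case: ifP => _ /=; rewrite ?leey.
have aeN h1 h2 : (forall x, ~ N x -> h1 x = h2 x) -> ae_eq mu A h1 h2.
  move=> h12; exists N; split => // x /= nE; apply: contrapT => Nx; apply: nE => Ax; exact: h12.
have cN x : N x -> c x = +oo by move=> Nx; rewrite /c patchE mem_set.
have cN0 x : ~ N x -> c x = 0 by move=> Nx; rewrite /c patchE memNset.
have intc : \int[mu]_(x in A) c x = 0.
  rewrite (@ge0_ae_eq_integral _ _ _ mu A c (cst 0))// ?integral0//.
  by apply: aeN => x /cN0.
have intgc : \int[mu]_(x in A) (g x + c x) = \int[mu]_(x in A) g x.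
  apply: ge0_ae_eq_integral => //.
  - exact: emeasurable_funD.
  - by move=> x Ax; rewrite adde_ge0// g0.
  - by apply: aeN => x /cN0 ->; rewrite adde0.
pose g' := g \_ (~` N).
have mg' : measurable_fun A g'.
  apply/(measurable_restrict _ _ _).
  - exact: measurableC.
  - by [].
  - exact: measurable_funS mg.
have g'0 x : A x -> 0 <= g' x.
  by move=> Ax; rewrite /g' patchE; case: ifP => // _; exact: g0.
have intg' : \int[mu]_(x in A) g' x = \int[mu]_(x in A) g x.
  apply: ge0_ae_eq_integral => //.
  by apply: aeN => x Nx; rewrite /g' patchE mem_set.
rewrite integralE (_ : \int[mu]_(x in A) f^\- x = 0) ?sube0; last first.
  apply/eqP; rewrite eq_le integral_ge0 ?andbT// -intc.
  apply: ge0_integral_mono => // x Ax; split => //.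
  have [Nx|Nx] := pselect (N x); first by rewrite cN// leey.
  by rewrite cN0// funenegE fg// maxEle (le_trans _ (_ : 0 <= 0))// ?leeN0// oppe_le0 g0.
apply/eqP; rewrite eq_le; apply/andP; split.
  rewrite -intgc; apply: ge0_integral_mono => //.
  by move=> x Ax; rewrite adde_ge0// g0.
  move=> x Ax; split=> //.
  have [Nx|Nx] := pselect (N x); first by rewrite cN// addey ?leey// gt_eqF// (lt_le_trans _ (g0 _ Ax)).
  by rewrite cN0// adde0 funeposE fg// maxEle; case: ifP => // _; exact: g0.
rewrite -intg'; apply: ge0_integral_mono => //.
move=> x Ax; split=> //; rewrite /g' patchE.
  case: ifPn => [h|_]; last exact: funepos_ge0.
by have Nx := set_mem h; rewrite funeposE fg// le_max lexx.
Qed.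

Lemma integral_le_cst A f (c : R) : measurable A -> (forall x, A x -> 0 <= f x <= c%:E) ->
  \int[mu]_(x in A) f x <= c%:E * mu A.
Proof.
move=> mA fc; rewrite -integral_cst//; apply: ge0_integral_mono.
- by move=> x /fc/andP[].
- by move=> x /fc/andP[f0 /(le_trans f0)].
- by move=> x Ax; split => //; have /andP[] := fc x Ax.
Qed.
End LowerIntegral.

Lemma uniform_prob1E (R : realType) (a b : R) (ab : a < b) (U : set R) : measurable U ->
  b - a = 1 -> uniform_prob ab U = lebesgue_measure (U `&` `[a, b]).
Proof.
move=> mU ba; rewrite /uniform_prob integral_uniform_pdf (eq_integral (cst 1%E)).
  by rewrite integral_cst ?mul1e//; apply: measurableI.
move=> x; rewrite inE => -[_]; rewrite /= in_itv/= => xab.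
by rewrite /uniform_pdf xab ba invr1.
Qed.

Lemma uniform_prob_itv (R : realType) (a b c d : R) (ab : a < b) : b - a = 1 -> 
  a <= c -> c <= d -> d <= b -> uniform_prob ab `]c, d] = (d - c)%:E.
Proof.
move=> ba ac cd db; rewrite uniform_prob1E// (_ : _ `&` _ = `]c, d]%classic).
  by rewrite lebesgue_measure_itv/= lte_fin; case: ltgtP cd => // ->; rewrite subrr.
apply/seteqP; split => [x []//|x /=]; rewrite !in_itv/= => /andP[cx xd].
by rewrite cx xd (ltW (le_lt_trans ac cx)) (le_trans xd db).
Qed.

Section FiniteUnions.
Context d (T : measurableType d) (R : realType).
Variable mu : {measure set T -> \bar R}.
Context (I : finType).
Implicit Types (F : I -> set T) (Q : pred I) (A : set T).
Local Open Scope ereal_scope.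

Let unionS F (i : I) s : [set w | exists2 j, j \in i :: s & F j w] =
  F i `|` [set w | exists2 j, j \in s & F j w].
Proof.
apply/seteqP; split => w /=.
  by case=> j; rewrite inE => /orP[/eqP ->|js] Fj; [left|right; exists j].
by case=> [Fi|[j js Fj]]; [exists i; rewrite ?inE ?eqxx|exists j; rewrite // inE js orbT].
Qed.

Let union0 F : [set w | exists2 j, j \in [::] & F j w] = set0.
Proof. by apply/seteqP; split => // w [j]. Qed.

Lemma measurable_finU F Q : (forall i, Q i -> measurable (F i)) ->
  measurable [set w | exists2 i, Q i & F i w].
Proof.
move=> mF; rewrite (_ : [set w | _] = [set w | exists2 i, i \in enum Q & F i w]); last first.
  by apply/seteqP; split => w [i Qi Fi]; exists i => //; move: Qi; rewrite mem_enum.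
have : {in enum Q, forall i, measurable (F i)} by move=> i; rewrite mem_enum; apply: mF.
elim: (enum Q) => [_|i s IH mFs]; first by rewrite union0.
rewrite unionS; apply: measurableU; first by apply: mFs; rewrite inE eqxx.
by apply: IH => j js; apply: mFs; rewrite inE js orbT.
Qed.

Lemma measure_finU_le F Q A : measurable A -> (forall i, Q i -> measurable (F i)) ->
  (forall w, A w -> exists2 i, Q i & F i w) -> mu A <= \sum_(i | Q i) mu (F i).
Proof.
move=> mA mF AF.
have -> : \sum_(i | Q i) mu (F i) = \sum_(i <- enum Q) mu (F i) by rewrite big_enum.
have mS : {in enum Q, forall i, measurable (F i)} by move=> i; rewrite mem_enum; apply: mF.
have {}AF w : A w -> exists2 i, i \in enum Q & F i w.
  by move=> /AF[i Qi Fi]; exists i; rewrite ?mem_enum.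
elim: (enum Q) A mA mS AF => [|i s IH] A mA mS AF.
  rewrite big_nil (_ : A = set0) ?measure0//.
  by apply/seteqP; split => // w /AF[].
have mFi : measurable (F i) by apply: mS; rewrite inE eqxx.
rewrite big_cons (measureDI _ mA mFi) addeC; apply: leeD.
  by apply: le_measure; rewrite ?inE//; apply: measurableI.
apply: IH; first exact: measurableD.
  by move=> j js; apply: mS; rewrite inE js orbT.
by move=> w [/AF[j]]; rewrite inE => /orP[/eqP -> //|js Fj _]; exists j.
Qed.

Lemma measure_finU_eq F Q A : measurable A -> (forall i, Q i -> measurable (F i)) ->
  (forall i j w, Q i -> Q j -> F i w -> F j w -> i = j) ->
  (forall w, A w <-> exists2 i, Q i & F i w) -> mu A = \sum_(i | Q i) mu (F i).
Proof.
move=> mA mF dF AF.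
have -> : \sum_(i | Q i) mu (F i) = \sum_(i <- enum Q) mu (F i) by rewrite big_enum.
have mS : {in enum Q, forall i, measurable (F i)} by move=> i; rewrite mem_enum; apply: mF.
have {}AF w : A w <-> exists2 i, i \in enum Q & F i w.
  by rewrite AF; split => -[i Qi Fi]; exists i => //; move: Qi; rewrite mem_enum.
have {}dF : {in enum Q &, forall i j w, F i w -> F j w -> i = j}.
  by move=> i j; rewrite !mem_enum => Qi Qj w; apply: dF.
have us := enum_uniq Q.
elim: (enum Q) A mA mS AF dF us => [|i s IH] A mA mS AF dF /=.
  move=> _; rewrite big_nil (_ : A = set0) ?measure0//.
  by apply/seteqP; split => // w /AF[].
move=> /andP[si us].
have mFi : measurable (F i) by apply: mS; rewrite inE eqxx.
rewrite big_cons (measureDI _ mA mFi) addeC; congr (_ + _).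
  congr (mu _); apply/seteqP; split => w; first by case.
  by move=> Fi; split => //; apply/AF; exists i; rewrite ?inE ?eqxx.
apply: IH => //; first exact: measurableD.
- by move=> j js; apply: mS; rewrite inE js orbT.
- move=> w; split.
    by move=> [/AF[j]]; rewrite inE => /orP[/eqP -> //|js Fj _]; exists j.
  move=> [j js Fj]; split; first by apply/AF; exists j; rewrite // inE js orbT.
  move=> Fi; move: si; rewrite (dF i j _ _ w Fi Fj) ?js// ?inE ?eqxx ?js ?orbT//.
- by move=> j k js ks; apply: dF; rewrite inE ?js ?ks orbT.
Qed.
End FiniteUnions.

Definition cell (R : realType) (a h : R) (u : nat) : set R := `]a + u%:R * h, a + u.+1%:R * h]%classic.

Lemma measurable_cell (R : realType) (a h : R) u : measurable (cell a h u).
Proof. exact: measurable_itv. Qed.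

Lemma cell_exists (R : realType) (a h x : R) (H : nat) : 0 < h -> a < x <= a + H%:R * h ->
  exists u : 'I_H, cell a h u x.
Proof.
move=> h0 /andP[ax xH].
have ex : exists m, x <= a + m%:R * h by exists H.
case: (ex_minnP ex) => [[|m] xm minm].
  by move: (lt_le_trans ax xm); rewrite mul0r addr0 ltxx.
have mH : (m < H)%N by have := minm _ xH; lia.
exists (Ordinal mH); rewrite /cell /= in_itv/= xm andbT ltNge.
by apply/negP => /minm; rewrite ltnn.
Qed.

Lemma cell_inj (R : realType) (a h x : R) (u v : nat) : 0 < h -> cell a h u x -> cell a h v x -> u = v.
Proof.
move=> h0; rewrite /cell /= !in_itv/= => /andP[u1 u2] /andP[v1 v2].
have := lt_le_trans u1 v2; have := lt_le_trans v1 u2.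
rewrite !ltrD2l !ltr_pM2r// !ltr_nat; lia.
Qed.

Lemma null_bigcup_countable d (T : measurableType d) (R : realType) (mu : {measure set T -> \bar R})
    (I : countType) (F : I -> set T) :
  (forall i, measurable (F i)) -> (forall i, mu (F i) = 0%E) -> measurable (\bigcup_i F i) ->
  mu (\bigcup_i F i) = 0%E.
Proof.
move=> mF F0; pose F' (k : nat) := if unpickle k is Some i then F i else set0.
have -> : \bigcup_i F i = \bigcup_k F' k.
  apply/seteqP; split => w [k _ wk].
    by exists (pickle k) => //; rewrite /F' pickleK.
  by move: wk; rewrite /F'; case: (unpickle k) => // i wi; exists i.
move=> mU; apply: measure_negligible => //.
apply: negligible_bigcup => k; rewrite /F'; case: (unpickle k) => [i|]; last exact: negligible_set0.
by exists (F i); split.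
Qed.

(** * Boxes of locations and marks *)

Section Boxes.
Context {R : realType} {g : R -> R -> R} {rho : R -> R} {beta : R} {n : nat}.
Variable G : random_graph g rho beta n.
Notation X := (rg_loc G).
Notation M := (rg_mark G).
Notation XM := (loc_mark (fun i => X i : _ -> R) (fun i => M i : _ -> R)).
Implicit Types (B C : 'I_n -> set R).

Definition box B C := [set w | forall i, B i (X i w) /\ C i (M i w)].

Let boxE B C : box B C = \bigcap_(k in [set` [set: 'I_n + 'I_n]%SET])
   (XM k @^-1` (match k with inl i => B i | inr i => C i end)).
Proof.
apply/seteqP; split => w /= H.
  by case=> i _; have [] := H i.
by move=> i; split; [apply: (H (inl i)); rewrite /= inE|apply: (H (inr i)); rewrite /= inE].
Qed.

Lemma box_sigma B C : (forall i, measurable (B i)) -> (forall i, measurable (C i)) ->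
  sigma_of XM (box B C).
Proof.
move=> mB mC; rewrite boxE /sigma_of.
set GG := (X in <<s X >>).
apply: (@fin_bigcap_measurable _ (g_sigma_algebraType GG)).
  exact: finite_finset.
move=> k _; apply: sub_sigma_algebra; exists k.
by case: k => i; [exists (B i)|exists (C i)].
Qed.

Lemma measurable_XM k (B : set R) : measurable B -> measurable (XM k @^-1` B).
Proof. by case: k => i mB; rewrite /= -[X in measurable X]setTI; apply: measurable_funP. Qed.

Lemma sigma_measurable A : sigma_of XM A -> measurable A.
Proof.
apply: smallest_sub; first exact: sigma_algebra_measurable.
by move=> _ [k [B [mB ->]]]; apply: measurable_XM.
Qed.

Lemma P_box B C : (forall i, measurable (B i)) -> (forall i, measurable (C i)) ->
  rg_prob G (box B C) = (\prod_i (uniform_prob (ltN_half R) (B i) * uniform_prob (@ltr01 R) (C i)))%E.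
Proof.
move=> mB mC; rewrite boxE rg_indep; last by case.
rewrite (eq_bigl xpredT) => [|k]; last by rewrite inE.
rewrite big_sumType/= big_split/=; congr (_ * _)%E; apply: eq_bigr => i _.
  by rewrite rg_loc_uniform.
by rewrite rg_mark_uniform.
Qed.
End Boxes.

(** * A null set off which the edge probabilities are Borel *)

Section EdgeMeasurability.
Context {R : realType} {g : R -> R -> R} {rho : R -> R} {beta : R} {n : nat}.
Variable G : random_graph g rho beta n.
Notation P := (rg_prob G).
Notation X := (rg_loc G).
Notation M := (rg_mark G).
Notation XM := (loc_mark (fun i => X i : _ -> R) (fun i => M i : _ -> R)).

Definition left_end (k : 'I_n + 'I_n) : R := match k with inl _ => - 2^-1 | inr _ => 0 end.

Lemma P_pair k l (B1 B2 : set R) : k != l -> measurable B1 -> measurable B2 ->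
  P (XM k @^-1` B1 `&` XM l @^-1` B2) = (P (XM k @^-1` B1) * P (XM l @^-1` B2))%E.
Proof.
move=> kl m1 m2.
have := rg_indep G [set k; l]%SET (B := fun i => if i == k then B1 else B2).
rewrite (_ : \bigcap_(i in _) _ = XM k @^-1` B1 `&` XM l @^-1` B2); last first.
  apply/seteqP; split => w /=.
    move=> H; split; first by have := H k; rewrite /= eqxx; apply; rewrite !inE eqxx.
    by have := H l; rewrite /= eq_sym (negPf kl); apply; rewrite !inE eqxx orbT.
  by case=> w1 w2 i /=; rewrite !inE => /orP[] /eqP ->; rewrite ?eqxx// eq_sym (negPf kl).
move=> ->; last by move=> i; case: ifP.
rewrite (bigD1 k) ?inE ?eqxx//= (bigD1 l) ?inE ?eqxx ?orbT//= 1?eq_sym// big1 ?mule1.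
  by rewrite ?eqxx ?[l == k]eq_sym ?(negPf kl).
by move=> i; rewrite !inE => /andP[/andP[/orP[]/eqP ->]]; rewrite ?eqxx.
Qed.

Lemma P_XM_itv k (c d : R) : left_end k <= c -> c <= d -> d <= left_end k + 1 ->
  P (XM k @^-1` `]c, d]) = (d - c)%:E.
Proof.
case: k => i /= c1 cd d1.
  rewrite rg_loc_uniform// uniform_prob_itv//; [lra|].
  by apply: (le_trans d1); lra.
by rewrite rg_mark_uniform// uniform_prob_itv//; lra.
Qed.

Lemma XM_range k : P (XM k @^-1` (~` `]left_end k, left_end k + 1])) = 0%E.
Proof.
have mI : measurable (XM k @^-1` `]left_end k, left_end k + 1]) by apply: measurable_XM.
rewrite preimage_setC probability_setC// P_XM_itv//; last by lra.
by rewrite addrAC subrr add0r subee.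
Qed.

(** The graph of a measurable function is not seen by two independent
    coordinates one of which is uniform. *)
Lemma null_graph k l (tau : R -> R) : k != l -> measurable_fun setT tau ->
  P [set w | XM l w = tau (XM k w)] = 0%E.
Proof.
move=> kl mtau; set A := [set w | _].
have mXM j : measurable_fun setT (XM j) by case: j => i; exact: measurable_funP.
have mA : measurable A.
  rewrite (_ : A = (fun w => XM l w - tau (XM k w)) @^-1` [set 0]).
    rewrite -[X in measurable X]setTI.
    by apply: measurable_funB => //; apply: measurableT_comp.
  by apply/seteqP; split => w /= => [->|/eqP]; rewrite ?subrr// subr_eq0 => /eqP.
pose a := left_end l.
have bound (H : nat) : (0 < H)%N -> (P A <= (H%:R^-1)%:E)%E.
  move=> H0; have h0 : 0 < H%:R^-1 :> R by rewrite invr_gt0 ltr0n.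
  have h1 : H%:R * H%:R^-1 = 1 :> R by rewrite divff// pnatr_eq0 -lt0n.
  pose F (u : 'I_H) := XM k @^-1` (tau @^-1` cell a H%:R^-1 u) `&` XM l @^-1` cell a H%:R^-1 u.
  have mtc u : measurable (tau @^-1` cell a H%:R^-1 u).
    by rewrite -[X in measurable X]setTI; apply: mtau => //; apply: measurable_cell.
  have mF u : measurable (F u).
    by apply: measurableI; apply: measurable_XM => //; apply: measurable_cell.
  have PF u : P (F u) = (P (XM k @^-1` (tau @^-1` cell a H%:R^-1 u)) * (H%:R^-1)%:E)%E.
    rewrite P_pair//; last exact: measurable_cell.
    congr (_ * _)%E; rewrite P_XM_itv.
    - by congr (_%:E); rewrite -natr1; ring.
    - by rewrite lerDl mulr_ge0 ?ler0n ?(ltW h0).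
    - by rewrite lerD2l ler_wpM2r ?(ltW h0)// ler_nat.
    - by rewrite lerD2l -[leRHS]h1 ler_wpM2r ?(ltW h0)// ler_nat.
  have mO : measurable (XM l @^-1` (~` `]a, a + 1])) by apply: measurable_XM; apply: measurableC.
  have mAO := measurableD mA mO.
  have -> : P A = P (A `\` XM l @^-1` (~` `]a, a + 1])).
    rewrite measureD//; last by apply: (le_lt_trans (probability_le1 _ mA)); rewrite ltry.
    rewrite [X in (_ - X)%E](_ : _ = 0%E) ?sube0//.
    apply/eqP; rewrite eq_le measure_ge0 andbT -(XM_range l).
    by apply: le_measure; rewrite ?inE//; apply: measurableI.
  apply: (@le_trans _ _ (\sum_(u < H) P (F u))%E).
    apply: measure_finU_le => // w [Aw /=]; rewrite /setC/= => /contrapT; rewrite in_itv/= => xw.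
    have [|u cu] := @cell_exists R a H%:R^-1 (XM l w) H h0; first by rewrite h1.
    by exists u => //; split => //=; rewrite -Aw.
  under eq_bigr do rewrite PF.
  rewrite -ge0_sume_distrl; last by move=> u _; apply: measure_ge0.
  rewrite -[leRHS]mul1e; apply: lee_wpmul2r; first by rewrite lee_fin ltW.
  pose E := [set w | exists2 u : 'I_H, true & (XM k @^-1` (tau @^-1` cell a H%:R^-1 u)) w].
  have mE : measurable E by apply: measurable_finU => u _; apply: measurable_XM.
  rewrite -(@measure_finU_eq _ _ _ P _ _ xpredT E)//.
  - exact: probability_le1.
  - by move=> u _; apply: measurable_XM.
  - by move=> u v w _ _ cu cv; apply/val_inj/(cell_inj h0 cu cv).
apply/eqP; rewrite eq_le measure_ge0 andbT; apply/lee_addgt0Pr => e e0; rewrite add0e.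
apply: (le_trans (bound (Num.truncn e^-1).+1 isT)); rewrite lee_fin.
rewrite -[leRHS]invrK lef_pV2 ?posrE ?ltr0n ?invr_gt0//.
exact/ltW/Num.Theory.truncnS_gt.
Qed.

Hypothesis hg : is_kernel g.
Hypothesis hrho : is_profile rho.
Hypothesis beta0 : 0 < beta.
Hypothesis n0 : (0 < n)%N.

Let below (c s : R) : set R := fun t => (0 < t < 1) /\ exists u, (0 < u < 1) /\ (s <= u /\ g u t <= c).
Let tau (c s : R) := sup (below c s).

Let below_ub c s : ubound (below c s) 1.
Proof. by move=> t [/andP[_ /ltW]]. Qed.

Let tau_measurable c : measurable_fun setT (tau c).
Proof.
apply: nonincreasing_measurable => // s s' ss'; rewrite /tau.
have sub : below c s' `<=` below c s.
  by move=> t [t01 [u [u01 [su gu]]]]; split => //; exists u; split => //; split=> //; apply: le_trans su.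
have sup_ge0 u : 0 <= sup (below c u).
  have [->|/set0P[t bt]] := eqVneq (below c u) set0; first by rewrite sup0.
  have [/andP[/ltW t0 _] _] := bt; apply: (le_trans t0).
  by apply: ub_le_sup => //; exists 1; exact: below_ub.
have [->|/set0P[t bt]] := eqVneq (below c s') set0; first by rewrite sup0.
apply: ge_sup; first by exists t.
move=> u /sub bu; apply: ub_le_sup => //; exists 1; exact: below_ub.
Qed.

Let tauP c s t : 0 < s < 1 -> 0 < t < 1 -> t <> tau c s -> (g s t <= c) = (t < tau c s).
Proof.
move=> s01 t01 /eqP tn; apply/idP/idP => [gc|].
  rewrite lt_neqAle tn/=; apply: ub_le_sup; first by exists 1; exact: below_ub.
  by split => //; exists s.
move=> ts; have ne : below c s !=set0.
  apply/set0P/eqP => E0; move: ts t01; rewrite /tau E0 sup0 => t0 /andP[].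
  by rewrite ltNge (ltW t0).
case: (sup_gt ne ts) => t' [t'01 [s' [s'01 [ss' gc]]]] tt'.
apply: le_trans gc; apply: (le_trans (kernel_homor hg s01 t01 t'01 (ltW tt'))).
exact: (kernel_homol hg t'01 s01 s'01 ss').
Qed.

Let rare i j : set (rg_space G) := [set w | X i w = X j w] `|` M i @^-1` (~` `]0, 1[) `|` M j @^-1` (~` `]0, 1[)
  `|` \bigcup_(q : rat) [set w | M j w = tau (ratr q) (M i w)].

Let null_set1 k l : k != l -> P (XM k @^-1` (~` `]left_end k, left_end k + 1[)) = 0%E.
Proof.
move=> kl; apply/eqP; rewrite eq_le measure_ge0 andbT.
have mE : measurable (XM k @^-1` [set left_end k + 1]) by apply: measurable_XM.
have mR : measurable (XM k @^-1` (~` `]left_end k, left_end k + 1])) by apply: measurable_XM; apply: measurableC.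
have <- : P (XM k @^-1` (~` `]left_end k, left_end k + 1]) `|` XM k @^-1` [set left_end k + 1]) = 0%E.
  rewrite measureU0//; first exact: XM_range.
  rewrite -(null_graph (k := l) (l := k) (tau := cst (left_end k + 1)))//; last by rewrite eq_sym.
apply: le_measure; rewrite ?inE.
- by apply: measurable_XM; apply: measurableC.
- exact: measurableU.
move=> w /= nw; have [e|e] := eqVneq (XM k w) (left_end k + 1); [by right|left].
by move: nw; apply: contra_not; rewrite !in_itv/= => /andP[-> ]; rewrite le_eqVlt (negPf e).
Qed.

Let rare_measurable i j : measurable (rare i j).
Proof.
have mX k : measurable_fun setT (X k) by exact: measurable_funP.
have mM k : measurable_fun setT (M k) by exact: measurable_funP.
have mEq (u v : rg_space G -> R) : measurable_fun setT u -> measurable_fun setT v ->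
    measurable [set w | u w = v w].
  move=> mu mv; rewrite (_ : [set w | _] = (fun w => u w - v w) @^-1` [set 0]).
    by rewrite -[X in measurable X]setTI; apply: measurable_funB.
  by apply/seteqP; split => w /= => [->|/eqP]; rewrite ?subrr// subr_eq0 => /eqP.
apply: measurableU; last first.
  by apply: bigcupT_measurable_rat => q; apply: mEq => //; apply: measurableT_comp.
apply: measurableU; last by apply: (measurable_XM G (inr j)); apply: measurableC.
apply: measurableU; last by apply: (measurable_XM G (inr i)); apply: measurableC.
exact: mEq.
Qed.

Let rare_null i j : i != j -> P (rare i j) = 0%E.
Proof.
move=> ij.
have mX k : measurable_fun setT (X k) by exact: measurable_funP.
have mM k : measurable_fun setT (M k) by exact: measurable_funP.
have mEq (u v : rg_space G -> R) : measurable_fun setT u -> measurable_fun setT v ->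
    measurable [set w | u w = v w].
  move=> mu mv; rewrite (_ : [set w | _] = (fun w => u w - v w) @^-1` [set 0]).
    by rewrite -[X in measurable X]setTI; apply: measurable_funB.
  by apply/seteqP; split => w /= => [->|/eqP]; rewrite ?subrr// subr_eq0 => /eqP.
have m1 : measurable [set w | X i w = X j w] by exact: mEq.
have m2 k : measurable (M k @^-1` (~` `]0, 1[)) by apply: (measurable_XM G (inr k)); apply: measurableC.
have m4 q : measurable [set w | M j w = tau (ratr q) (M i w)].
  by apply: mEq => //; apply: measurableT_comp.
have nM k : P (M k @^-1` (~` `]0, 1[)) = 0%E.
  have := @null_set1 (inr k) (inl k) isT.
  by rewrite /= add0r.
have nl : inl i != inl j :> 'I_n + 'I_n by apply/eqP => -[e]; rewrite e eqxx in ij.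
have nr : inr i != inr j :> 'I_n + 'I_n by apply/eqP => -[e]; rewrite e eqxx in ij.
have m5 := bigcupT_measurable_rat m4.
have m12 := measurableU _ _ m1 (m2 i).
have m123 := measurableU _ _ m12 (m2 j).
rewrite /rare measureU0//.
- rewrite measureU0 ?nM//.
  rewrite measureU0 ?nM//.
  rewrite (_ : [set w | _] = [set w | XM (inl j) w = idfun (XM (inl i) w)]).
    by apply: (null_graph (k := inl i) (l := inl j)) => //; exact: measurable_id.
  by apply/seteqP; split => w.
- exact: nM.
- exact: nM.
- apply: null_bigcup_countable => // q.
  by apply: (null_graph (k := inr i) (l := inr j)).
Qed.

Definition rare_set : set (rg_space G) :=
  [set w | exists2 e : 'I_n * 'I_n, e.1 != e.2 & rare e.1 e.2 w].

Lemma measurable_rare_set : measurable rare_set.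
Proof. by apply: measurable_finU => e _; exact: rare_measurable. Qed.

(** Two locations coincide, or a mark leaves the unit interval, or the pair of marks sits on the boundary
    of a level set of the kernel. Such a boundary is the graph of a monotone function, hence null. *)
Lemma rare_set_null : P rare_set = 0%E.
Proof.
apply/eqP; rewrite eq_le measure_ge0 andbT.
apply: (@le_trans _ _ (\sum_(e : 'I_n * 'I_n | e.1 != e.2) P (rare e.1 e.2))%E).
  by apply: measure_finU_le => //; exact: measurable_rare_set.
by rewrite big1// => e ee; exact: rare_null.
Qed.

Lemma not_rare i j w : i != j -> (~` rare_set) w ->
  [/\ X i w != X j w, 0 < M i w < 1 & 0 < M j w < 1].
Proof.
move=> ij nr; split.
- apply/eqP => e; apply: nr; exists (i, j) => //=; do 3 left; exact: e.
- apply: contrapT => nm; apply: nr; exists (i, j) => //=; left; left; right => /=.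
  by rewrite in_itv.
- apply: contrapT => nm; apply: nr; exists (i, j) => //=; left; right => /=.
  by rewrite in_itv.
Qed.

Notation edge_p i j w := (edge_prob g rho beta n (X i w) (M i w) (X j w) (M j w)).

Let arg i j w := beta^-1 * g (M j w) (M i w) * n%:R * `|X i w - X j w|.

Let arg_gt0 i j w : i != j -> (~` rare_set) w -> 0 < arg i j w.
Proof.
move=> ij /(not_rare ij)[Xij Mi Mj]; rewrite /arg !mulr_gt0 ?invr_gt0 ?ltr0n//.
- by apply: (kernel_gt0 hg); rewrite in_itv.
- by rewrite normr_gt0 subr_eq0.
Qed.

Lemma edge_prob01 i j w : i != j -> (~` rare_set) w -> 0 <= edge_p i j w <= 1.
Proof.
by move=> ij nr; apply: (profile_itv hrho); rewrite in_itv/= andbT; exact: (arg_gt0 ij nr).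
Qed.

Let g_measurable i j : i != j -> measurable_fun (~` rare_set) (fun w => g (M i w) (M j w)).
Proof.
move=> ij mD; apply: (measurability _ (RGenOInfty.measurableE R)) => //.
move=> /= _ [_ [c ->] <-].
have mM k : measurable_fun setT (M k) by exact: measurable_funP.
rewrite (_ : _ `&` _ = \bigcup_(q : rat) (if c < ratr q then
   (~` rare_set) `&` [set w | tau (ratr q) (M i w) <= M j w] else set0)).
  apply: bigcupT_measurable_rat => q; case: ifP => // _.
  apply: measurableI => //.
  rewrite -[X in measurable X]setTI (_ : [set w | _] = (fun w => M j w - tau (ratr q) (M i w)) @^-1` `[0, +oo[).
    by apply: measurable_funB => //; apply: measurableT_comp.
  by apply/seteqP; split => w /=; rewrite in_itv/= andbT subr_ge0.
apply/seteqP; split => w /=.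
  move=> [nr]; rewrite in_itv/= andbT => cg.
  have [q] := rat_in_itvoo cg; rewrite in_itv/= => /andP[cq qg].
  exists q => //; rewrite cq; split => //=.
  have [_ Mi Mj] := not_rare ij nr; rewrite leNgt -tauP//; first by rewrite -ltNge.
  by move=> e; apply: nr; exists (i, j) => //=; right; exists q.
case=> q _; case: ifP => // cq [nr /= tM]; split => //.
have [_ Mi Mj] := not_rare ij nr; rewrite in_itv/= andbT; apply: (lt_trans cq).
rewrite ltNge tauP -?leNgt//.
by move=> e; apply: nr; exists (i, j) => //=; right; exists q.
Qed.

Let rho' x := if 0 < x then rho x else 1.

Let rho'_measurable : measurable_fun setT rho'.
Proof.
apply: nonincreasing_measurable => // x y xy; rewrite /rho'.
have [y0|y0] := ltP 0 y; have [x0|x0] := ltP 0 x.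
- by apply: (profile_nonincr hrho) => //; rewrite in_itv/= andbT.
- by have /andP[] : 0 <= rho y <= 1 by apply: (profile_itv hrho); rewrite in_itv/= andbT.
- by have := lt_le_trans x0 (le_trans xy y0); rewrite ltxx.
- by [].
Qed.

(** A kernel that is monotone in each argument need not be jointly Borel; off the exceptional null set its
    level sets are countable unions of boxes. *)
Lemma edge_prob_measurable i j : i != j ->
  measurable_fun (~` rare_set) (fun w => edge_p i j w).
Proof.
move=> ij.
apply: (@eq_measurable_fun _ _ _ _ _ (rho' \o arg i j)).
  move=> w; rewrite inE => nr /=; rewrite /rho' arg_gt0//.
apply: measurableT_comp => //; rewrite /arg.
have mX k : measurable_fun (~` rare_set) (X k) by apply: measurable_funTS; exact: measurable_funP.
apply: measurable_funM; last by apply: measurableT_comp => //; exact: measurable_funB.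
apply: measurable_funM => //; apply: measurable_funM => //; by apply: g_measurable; rewrite eq_sym.
Qed.
End EdgeMeasurability.

(** * The law of the whole edge configuration *)

Lemma measurable_bigprod d (T : measurableType d) (R : realType) (I : Type) (r : seq I) (Q : pred I)
    (h : I -> T -> R) : (forall i, measurable_fun setT (h i)) ->
  measurable_fun setT (fun w => \prod_(i <- r | Q i) h i w).
Proof.
move=> mh; elim: r => [|i r IH]; first by under eq_fun do rewrite big_nil; exact: measurable_cst.
under eq_fun do rewrite big_cons; case: (Q i) => //.
exact: measurable_funM.
Qed.

Section ConditionalLaw.
Context {R : realType} {g : R -> R -> R} {rho : R -> R} {beta : R} {n : nat}.
Variable G : random_graph g rho beta n.
Hypothesis hg : is_kernel g.
Hypothesis hrho : is_profile rho.
Hypothesis beta0 : 0 < beta.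
Hypothesis n0 : (0 < n)%N.
Notation P := (rg_prob G).
Notation X := (rg_loc G).
Notation M := (rg_mark G).
Notation XM := (loc_mark (fun i => X i : _ -> R) (fun i => M i : _ -> R)).
Notation pair := ('I_n * 'I_n)%type.
Notation rare := (@rare_set R g rho beta n G).
Implicit Types (e : pair) (S : {set pair}) (A : set (rg_space G)).

Definition ep e w : R := edge_prob g rho beta n (X e.1 w) (M e.1 w) (X e.2 w) (M e.2 w).

(** A measurable version of the edge probabilities, also defined to be zero off
    the increasing pairs. *)
Definition epm e : rg_space G -> R :=
  if (e.1 < e.2)%N then ep e \_ (~` rare) else cst 0.

Let mrare : measurable rare. Proof. exact: measurable_rare_set. Qed.

Let ltn_neq e : (e.1 < e.2)%N -> e.1 != e.2.
Proof. by move=> /ltn_eqF; rewrite -val_eqE => ->. Qed.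

Lemma epm_measurable e : measurable_fun setT (epm e).
Proof.
rewrite /epm; case: ifP => [e12|_]; last exact: measurable_cst.
apply/(measurable_restrictT _ (measurableC mrare)).
exact: edge_prob_measurable (ltn_neq e12).
Qed.

Lemma epmE e w : (e.1 < e.2)%N -> ~ rare w -> epm e w = ep e w.
Proof. by move=> e12 nr; rewrite /epm e12 patchE mem_set. Qed.

Lemma epm01 e w : 0 <= epm e w <= 1.
Proof.
rewrite /epm; case: ifP => [e12|_]; last by rewrite lexx ler01.
rewrite patchE; case: ifPn => [/set_mem nr|_]; last by rewrite lexx ler01.
exact: edge_prob01 (ltn_neq e12) nr.
Qed.

Definition absent_prod S (s : seq pair) w : R :=
  \prod_(e in S) epm e w * \prod_(e <- s) (1 - epm e w).

Lemma absent_prod01 S s w : 0 <= absent_prod S s w <= 1.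
Proof.
have h e := epm01 e w.
have h' e : 0 <= 1 - epm e w <= 1 by have := h e; lra.
have H (I : Type) (r : seq I) (Q : pred I) (F : I -> R) : (forall i, 0 <= F i <= 1) -> 0 <= \prod_(i <- r | Q i) F i <= 1.
  move=> F01; elim/big_ind: _ => //; first by rewrite ler01 lexx.
  by move=> x y /andP[x0 x1] /andP[y0 y1]; rewrite mulr_ge0//= mulr_ile1.
have /andP[a0 a1] := H _ (index_enum _) (mem S) _ h; have /andP[b0 b1] := H _ s xpredT _ h'.
by rewrite mulr_ge0//= mulr_ile1.
Qed.

Lemma absent_prod_measurable S s : measurable_fun setT (absent_prod S s).
Proof.
apply: measurable_funM.
  by apply: measurable_bigprod => e _; exact: epm_measurable.
apply: measurable_bigprod => e _; apply: measurable_funB => //; exact: epm_measurable.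
Qed.

Definition adj_event S (s : seq pair) : set (rg_space G) :=
  [set w | (forall e, e \in S -> rg_adj G w e.1 e.2) /\ (forall e, e \in s -> ~~ rg_adj G w e.1 e.2)].

Lemma adj_event_measurable S s : measurable (adj_event S s).
Proof.
rewrite (_ : adj_event S s =
  (\bigcap_(e in [set` S]) [set w | rg_adj G w e.1 e.2]) `&`
  (\bigcap_(e in [set` s]) ~` [set w | rg_adj G w e.1 e.2])).
  apply: measurableI; apply: fin_bigcap_measurable => // e _.
    exact: rg_adj_measurable.
  by apply: measurableC; exact: rg_adj_measurable.
apply/seteqP; split => w /= [h1 h2]; split=> e /= ee.
- exact: h1.
- by have := h2 e ee => /negP.
- exact: h1.
- by apply/negP; apply: h2.
Qed.

(** Inclusion-exclusion, one absent edge at a time, from the product rule for present edges. *)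
Lemma law_absent S s A : sigma_of XM A -> uniq s ->
  (forall e, e \in S -> (e.1 < e.2)%N) -> (forall e, e \in s -> (e.1 < e.2)%N) ->
  (forall e, e \in s -> e \notin S) ->
  P (A `&` adj_event S s) = (\int[P]_(w in A) (absent_prod S s w)%:E)%E.
Proof.
move=> sA; have mA := sigma_measurable sA.
elim: s S => [|e s IH] S us Sl sl sS.
  rewrite (_ : A `&` adj_event S [::] = A `&` \bigcap_(e in [set` S]) [set w | rg_adj G w e.1 e.2]); last first.
    by apply/seteqP; split => w /= [Aw]; [case=> h _|move=> h]; split => //; split.
  rewrite rg_adj_law//; apply: (integral_off_null mA mrare).
  - exact: rare_set_null.
  - by apply/measurable_EFinP; apply: measurable_funTS; exact: absent_prod_measurable.
  - by move=> w _; rewrite lee_fin; case/andP: (absent_prod01 S [::] w).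
  - move=> w Aw nr; congr (_%:E); rewrite /absent_prod big_nil mulr1.
    by apply: eq_bigr => e eS; rewrite epmE ?Sl.
move: us => /= /andP[es us].
have el : (e.1 < e.2)%N by apply: sl; rewrite inE eqxx.
have eS : e \notin S by apply: sS; rewrite inE eqxx.
have IH1 : P (A `&` adj_event S s) = (\int[P]_(w in A) (absent_prod S s w)%:E)%E.
  by apply: IH => // f fs; [apply: sl|apply: sS]; rewrite inE fs orbT.
have IH2 : P (A `&` adj_event (e |: S)%SET s) = (\int[P]_(w in A) (absent_prod (e |: S)%SET s w)%:E)%E.
  apply: IH => // f.
  - by rewrite !inE => /orP[/eqP ->|/Sl].
  - by move=> fs; apply: sl; rewrite inE fs orbT.
  - move=> fs; rewrite !inE negb_or sS ?inE ?fs ?orbT// andbT.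
    by apply: contraNneq es => <-.
have apE w : absent_prod S s w = absent_prod S (e :: s) w + absent_prod (e |: S)%SET s w.
  by rewrite /absent_prod big_setU1//= big_cons; ring.
have PE : P (A `&` adj_event S s) = (P (A `&` adj_event S (e :: s)) + P (A `&` adj_event (e |: S)%SET s))%E.
  rewrite -measureU; [|exact: measurableI (adj_event_measurable _ _)..|].
    congr (P _); apply/seteqP; split => w /=.
      move=> [Aw [h1 h2]]; case: (boolP (rg_adj G w e.1 e.2)) => ae; [right|left]; split => //; split => //.
        by move=> f; rewrite !inE => /orP[/eqP ->|/h1].
      by move=> f; rewrite inE => /orP[/eqP ->|/h2].
    by case=> -[Aw [h1 h2]]; split => //; split => // f ff; [apply: h2; rewrite inE ff orbT|apply: h1; rewrite !inE ff orbT].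
  apply/seteqP; split => // w /= [[_ [_ h2]] [_ [h1 _]]].
  have := h1 e; rewrite !inE eqxx => /(_ isT) ae.
  by have := h2 e; rewrite inE eqxx ae => /(_ isT).
have IE : (\int[P]_(w in A) (absent_prod S s w)%:E = \int[P]_(w in A) (absent_prod S (e :: s) w)%:E
    + \int[P]_(w in A) (absent_prod (e |: S)%SET s w)%:E)%E.
  rewrite -ge0_integralD//.
  - by apply: eq_integral => w _; rewrite apE EFinD.
  - by move=> w _; rewrite lee_fin; case/andP: (absent_prod01 S (e :: s) w).
  - by apply/measurable_EFinP; apply: measurable_funTS; exact: absent_prod_measurable.
  - by move=> w _; rewrite lee_fin; case/andP: (absent_prod01 (e |: S)%SET s w).
  - by apply/measurable_EFinP; apply: measurable_funTS; exact: absent_prod_measurable.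
move: PE; rewrite IH1 IE IH2; set b := (\int[P]_(w in A) (absent_prod (e |: S)%SET s w)%:E)%E.
have bf : b \is a fin_num.
  rewrite /b -IH2 fin_num_measure//; apply: measurableI => //; exact: adj_event_measurable.
by move=> /(congr1 (fun x => x - b)%E); rewrite !addeK.
Qed.

Definition config w : {ffun pair -> bool} := [ffun e : pair => (e.1 < e.2)%N && rg_adj G w e.1 e.2].

Definition config_event (U : pred {ffun pair -> bool}) : set (rg_space G) := [set w | U (config w)].

Lemma config_eventE (f : {ffun pair -> bool}) : (forall e, f e -> (e.1 < e.2)%N) ->
  config_event (pred1 f) =
  adj_event [set e | f e]%SET (enum [set e : pair | (e.1 < e.2)%N && ~~ f e]%SET).
Proof.
move=> fl; apply/seteqP; split => w; rewrite /config_event /adj_event /=.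
  move=> /eqP <-; split => e.
    by rewrite inE ffunE => /andP[].
  by rewrite mem_enum inE ffunE => /andP[->].
move=> [h1 h2]; apply/eqP/ffunP => e; rewrite ffunE; apply/andP/idP => [[el ae]|fe].
  apply: contraTT ae => fe; apply: h2; by rewrite mem_enum inE el.
by split; [exact: fl|apply: h1; rewrite inE].
Qed.

Lemma config_event_measurable U : measurable (config_event U).
Proof.
rewrite (_ : config_event U = [set w | exists2 f, U f & config_event (pred1 f) w]); last first.
  apply/seteqP; split => w; rewrite /config_event /=; first by move=> Uw; exists (config w).
  by case=> f Uf /eqP ->.
apply: measurable_finU => f _.
case: (boolP [forall e, f e ==> (e.1 < e.2)%N]) => [/forallP fl|].
  rewrite config_eventE; first exact: adj_event_measurable.
  by move=> e; apply/implyP.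
rewrite negb_forall => /existsP[e]; rewrite negb_imply => /andP[fe ne].
have -> : config_event (pred1 f) = set0; last exact: measurable0.
apply/seteqP; split => // w /eqP cf.
by move: ne fe; rewrite -cf ffunE => /negPf ->.
Qed.

Lemma P_config f A : sigma_of XM A ->
  P (A `&` config_event (pred1 f)) = (\int[P]_(w in A) (weight (bern (epm ^~ w)) f)%:E)%E.
Proof.
move=> sA; case: (boolP [forall e, f e ==> (e.1 < e.2)%N]) => [/forallP fl|]; last first.
  rewrite negb_forall => /existsP[e]; rewrite negb_imply => /andP[fe ne].
  have -> : config_event (pred1 f) = set0.
    apply/seteqP; split => // w /eqP cf.
    by move: ne fe; rewrite -cf ffunE => /negPf ->.
  rewrite setI0 measure0 (eq_integral (cst 0%E)) ?integral0// => w _.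
  by rewrite /weight (bigD1 e)//= /bern fe /epm (negPf ne) mul0r.
have {}fl e : f e -> (e.1 < e.2)%N by apply/implyP.
rewrite config_eventE// law_absent//; last 4 first.
- exact: enum_uniq.
- by move=> e; rewrite inE; exact: fl.
- by move=> e; rewrite mem_enum inE => /andP[].
- by move=> e; rewrite mem_enum !inE => /andP[].
apply: eq_integral => w _; congr (_%:E).
rewrite /absent_prod /weight big_enum/= [RHS](bigID (fun e => f e))/=; congr (_ * _).
  apply: eq_big => [e|e]; first by rewrite inE.
  by rewrite inE => fe; rewrite /bern fe.
rewrite [RHS](bigID (fun e : pair => (e.1 < e.2)%N))/= [X in _ = _ * X]big1 ?mulr1.
  apply: eq_big => [e|e]; first by rewrite inE andbC.
  by rewrite inE => /andP[_ /negPf fe]; rewrite /bern fe.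
by move=> e /andP[/negPf fe /negPf ne]; rewrite /bern fe /epm ne subr0.
Qed.

(** Lower bounds on the edge probabilities over an event [A] give a lower bound on increasing edge events:
    integrate the conditional monotonicity over [A]. *)
Lemma P_increasing (U : pred {ffun pair -> bool}) (c : pair -> R) A : sigma_of XM A ->
  increasing U -> (forall e, 0 <= c e <= 1) ->
  (forall e w, A w -> ~ rare w -> c e <= epm e w) ->
  ((Pr (bern c) U)%:E * P A <= P (A `&` config_event U))%E.
Proof.
move=> sA inc c01 ce; have mA := sigma_measurable sA.
have wm f : measurable_fun setT (fun w => weight (bern (epm ^~ w)) f).
  apply: measurable_bigprod => e; rewrite /bern; case: (f e); first exact: epm_measurable.
  by apply: measurable_funB => //; exact: epm_measurable.
have w0 f w : 0 <= weight (bern (epm ^~ w)) f.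
  by apply: weight_ge0; apply: bern_weight => e; exact: epm01.
have -> : P (A `&` config_event U) = (\sum_(f | U f) P (A `&` config_event (pred1 f)))%E.
  apply: measure_finU_eq.
  - by apply: measurableI => //; exact: config_event_measurable.
  - by move=> f _; apply: measurableI => //; exact: config_event_measurable.
  - by move=> f f' w _ _ [_ /eqP <-] [_ /eqP <-].
  - move=> w; split=> [[Aw Uw]|[f Uf [Aw /eqP cf]]].
      by exists (config w) => //; split => //; rewrite /config_event /=.
    by split => //; rewrite /config_event /= cf.
have -> : (\sum_(f | U f) P (A `&` config_event (pred1 f)) =
    \sum_(f <- enum U) \int[P]_(w in A) (weight (bern (epm ^~ w)) f)%:E)%E.
  by rewrite big_enum/=; apply: eq_bigr => f _; exact: P_config.
rewrite -ge0_integral_sum//; last 2 first.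
- by move=> f; apply/measurable_EFinP; apply: measurable_funTS.
- by move=> f w _; rewrite lee_fin.
have -> : P A = P (A `\` rare).
  rewrite measureD//; last by rewrite (le_lt_trans (probability_le1 _ mA)) ?ltry.
  rewrite [X in (_ - X)%E](_ : _ = 0%E) ?sube0//.
  apply/eqP; rewrite eq_le measure_ge0 andbT -(rare_set_null G).
  by apply: le_measure; rewrite ?inE//; apply: measurableI.
rewrite -integral_cst; last exact: measurableD.
apply: ge0_integral_mono.
- by move=> w _; rewrite lee_fin; apply: Pr_ge0; apply: bern_weight.
- by move=> w _; rewrite sume_ge0// => f _; rewrite lee_fin.
- move=> w [Aw nr]; split => //; rewrite big_enum/= sumEFin lee_fin.
  apply: le_trans (bern_mono c01 (fun e => epm01 e w) (fun e => ce e w Aw nr) inc) _.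
  rewrite /Pr /Ex [leRHS]big_mkcond; apply: ler_sum => f _.
  by have -> : (f \in U) = U f by []; case: (U f) => /=; rewrite ?mulr1 ?mulr0.
Qed.
End ConditionalLaw.

(** * Transfer from the finite model to the random graph *)

Section Transfer.
Context {R : realType} {g : R -> R -> R} {rho : R -> R} {beta : R} {n : nat}.
Variable G : random_graph g rho beta n.
Hypothesis hg : is_kernel g.
Hypothesis hrho : is_profile rho.
Hypothesis beta0 : 0 < beta.
Hypothesis n0 : (0 < n)%N.
Notation P := (rg_prob G).
Notation X := (rg_loc G).
Notation M := (rg_mark G).
Notation rare := (@rare_set R g rho beta n G).
Notation pair := ('I_n * 'I_n)%type.
Variables (Nb Th Mg : nat).
Hypotheses (Nb0 : (0 < Nb)%N) (Th0 : (0 < Th)%N) (Mg0 : (0 < Mg)%N).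
Notation place := {ffun 'I_n -> 'I_Nb * 'I_Th}.
Notation marks := {ffun 'I_n -> 'I_Mg}.
Notation coins := {ffun 'I_n * 'I_n -> 'I_Mg}.
Variable thr : place -> 'I_n -> 'I_n -> 'I_Mg -> 'I_Mg -> nat.
Hypothesis thrC : forall s v w i j, thr s v w i j = thr s w v j i.
Hypothesis thrM : forall s v w i j, (thr s v w i j <= Mg)%N.

Definition atom (s : place) (mu : marks) : set (rg_space G) :=
  box (G := G) (fun v => cell (- 2^-1) Nb%:R^-1 (s v).1)
        (fun v => cell ((s v).2%:R / Th%:R) ((Th * Mg)%:R^-1) (mu v)).

Hypothesis thr_ok : forall s mu (v u : 'I_n) w, (v < u)%N -> atom s mu w -> ~ rare w ->
  (thr s v u (mu v) (mu u))%:R / Mg%:R <=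
    edge_prob g rho beta n (X v w) (M v w) (X u w) (M u w).

Variable V : rel 'I_n -> bool.
Hypothesis V_mono : forall e e' : rel 'I_n, (forall v w, e v w -> e' v w) -> V e -> V e'.

Definition graph_of (f : {ffun pair -> bool}) : rel 'I_n := fun v u => (v != u) && f (coin v u).

Let U (f : {ffun pair -> bool}) := V (graph_of f).

Let V_ext e e' : e =2 e' -> V e = V e'.
Proof. by move=> ee; apply/idP/idP; apply: V_mono => v w; rewrite ee. Qed.

Let U_inc : increasing U.
Proof.
by move=> f f' ff; apply: V_mono => v w /andP[vw fv]; rewrite /graph_of vw ff.
Qed.

Lemma adj_graph_of w : rg_adj G w =2 graph_of (config w).
Proof.
move=> v u; rewrite /graph_of ffunE /coin; case: (ltngtP v u) => [vu|uv|/val_inj ->] /=.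
- by rewrite vu /= -val_eqE/= ltn_eqF.
- by rewrite uv /= -val_eqE/= gtn_eqF// rg_adj_sym.
- by rewrite rg_adj_irr eqxx.
Qed.

Let thr' s (mu : marks) (e : pair) : nat :=
  if (e.1 < e.2)%N then thr s e.1 e.2 (mu e.1) (mu e.2) else 0%N.

Let thr'M s mu e : (thr' s mu e <= Mg)%N.
Proof. by rewrite /thr'; case: ifP. Qed.

Let Phi s mu (u : coins) := U [ffun e => (u e < thr' s mu e)%N].

Let diag (f : coins) : marks := [ffun v => f (v, v)].

Let model_Phi s f : V (model_graph thr s f) = Phi s (diag f) f.
Proof.
apply: V_ext => v u; rewrite /graph_of /model_graph ffunE /thr' !ffunE /coin.
case: (ltngtP v u) => [vu|uv|/val_inj ->] /=; rewrite ?vu ?uv ?eqxx//.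
by rewrite thrC.
Qed.

Let cMg : (0 < #|'I_Mg|)%N. Proof. by rewrite card_ord. Qed.
Let uc : @is_weight R pair 'I_Mg unif := unif_weight cMg.
Let um : @is_weight R 'I_n 'I_Mg unif := unif_weight cMg.

Let Pr_model s : Pr (unif : _ -> _ -> R) (fun f => V (model_graph thr s f)) =
  Ex (unif : _ -> _ -> R) (fun mu : marks => Pr unif (Phi s mu)).
Proof.
rewrite /Pr (eq_Ex _ (G := fun f => (Phi s (diag f) f)%:R)); last by move=> f; rewrite model_Phi.
rewrite -(Ex_resample uc [set e | e.1 == e.2]%SET).
transitivity (Ex unif (fun f : coins => Ex (unif : _ -> _ -> R) (fun u : coins => (Phi s (diag f) u)%:R))); last first.
  rewrite -(@Ex_marginal _ _ _ _ (fun v : 'I_n => (v, v)) unif _ uc)//.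
  by move=> v v' [].
rewrite /Ex; under eq_bigr do rewrite mulr_sumr.
under [RHS]eq_bigr do rewrite mulr_sumr.
rewrite exchange_big/=; apply: eq_bigr => f _; apply: eq_bigr => u _.
rewrite mulrCA; congr (_ * (_ * _%:R)).
have -> : diag (mix [set e | e.1 == e.2]%SET f u) = diag f.
  by apply/ffunP => v; rewrite !ffunE inE eqxx.
congr (nat_of_bool (U _)); apply/ffunP => e; rewrite !ffunE /thr' inE.
case: (ltnP e.1 e.2) => e12; rewrite ?ltn0//.
by case: eqP => // e0; rewrite e0 ltnn in e12.
Qed.

Let atom_cell_inj (h : R) (k l : nat) (i j : nat) (x : R) : (0 < Mg)%N -> (i < Mg)%N -> (j < Mg)%N ->
  cell (k%:R / Th%:R) ((Th * Mg)%:R^-1) i x -> cell (l%:R / Th%:R) ((Th * Mg)%:R^-1) j x ->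
  k = l /\ i = j.
Proof.
move=> _ iM jM; have E (a b : nat) : a%:R / Th%:R + b%:R * (Th * Mg)%:R^-1 = (a * Mg + b)%:R * (Th * Mg)%:R^-1 :> R.
  by rewrite natrD !natrM; field; rewrite !pnatr_eq0 -!lt0n Th0 Mg0.
have h0 : 0 < (Th * Mg)%:R^-1 :> R by rewrite invr_gt0 ltr0n muln_gt0 Th0.
have C a b : cell (a%:R / Th%:R) ((Th * Mg)%:R^-1) b x -> cell 0 ((Th * Mg)%:R^-1) (a * Mg + b)%N x.
  by rewrite /cell !add0r !E addnS.
move=> /C c1 /C c2; have := cell_inj h0 c1 c2 => e.
have := congr1 (fun x => x %/ Mg)%N e; have := congr1 (fun x => x %% Mg)%N e.
by rewrite !divnMDl// !modnMDl !divn_small// !modn_small// !addn0.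
Qed.

Let atom_inj s mu s' mu' w : atom s mu w -> atom s' mu' w -> s = s' /\ mu = mu'.
Proof.
move=> a1 a2.
have H v : s v = s' v /\ mu v = mu' v.
  have [x1 m1] := a1 v; have [x2 m2] := a2 v.
  have [e1 e2] := atom_cell_inj 0 Mg0 (ltn_ord _) (ltn_ord _) m1 m2.
  split; last exact: val_inj.
  rewrite [s v]surjective_pairing [s' v]surjective_pairing; congr (_, _); apply: val_inj => //.
  by apply: cell_inj x1 x2; rewrite invr_gt0 ltr0n.
by split; apply/ffunP => v; have [] := H v.
Qed.

Let P_atom s mu : P (atom s mu) = ((#|{: 'I_Nb * 'I_Th}|%:R^-1 ^+ n * #|'I_Mg|%:R^-1 ^+ n))%:E.
Proof.
rewrite P_box; [|by move=> v; exact: measurable_cell..].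
rewrite (eq_bigr (fun=> ((Nb * Th)%:R^-1 * Mg%:R^-1)%:E)).
  by rewrite prodEFin prodr_const card_ord exprMn card_prod !card_ord.
move=> v _.
have Nb0' : 0 < Nb%:R :> R by rewrite ltr0n.
have Th0' : 0 < Th%:R :> R by rewrite ltr0n.
have Mg0' : 0 < Mg%:R :> R by rewrite ltr0n.
have h1 (a : nat) (k : 'I_a) : k.+1%:R / a%:R <= 1 :> R.
  by rewrite ler_pdivrMr ?mul1r ?ler_nat// ltr0n (leq_ltn_trans _ (ltn_ord k)).
have X1 : uniform_prob (ltN_half R) (cell (- 2^-1) Nb%:R^-1 (s v).1) = (Nb%:R^-1)%:E.
  rewrite uniform_prob_itv//.
  - by congr (_%:E); rewrite -natr1; ring.
  - by lra.
  - by rewrite lerDl mulr_ge0 ?invr_ge0 ?ler0n.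
  - by rewrite lerD2l ler_wpM2r ?invr_ge0 ?ler0n// ler_nat.
  - by have := h1 Nb (s v).1; lra.
have M1 : uniform_prob (@ltr01 R) (cell ((s v).2%:R / Th%:R) ((Th * Mg)%:R^-1) (mu v)) = ((Th * Mg)%:R^-1)%:E.
  rewrite uniform_prob_itv//.
  - by congr (_%:E); rewrite -natr1; ring.
  - by rewrite subr0.
  - by rewrite lerD2l ler_wpM2r ?invr_ge0 ?ler0n// ler_nat.
  - have := h1 Th (s v).2; have := h1 Mg (mu v); rewrite natrM => m1 t1.
    apply: le_trans t1; rewrite -[(s v).2.+1%:R]natr1 [leRHS]mulrDl lerD2l invfM mulrCA mul1r.
    by rewrite -[leRHS]mulr1 ler_wpM2l ?invr_ge0 ?ler0n.
rewrite X1 M1 -EFinM; congr (_%:E); rewrite !natrM; field.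
by rewrite !gt_eqF.
Qed.

(** The atoms [atom s mu] cut space into equiprobable boxes indexed by the states of the model; on each
    of them the true edge probabilities dominate those of the model. *)
Lemma transfer :
  ((Ex (unif : _ -> _ -> R) (fun s : place => Pr (unif : _ -> _ -> R) (fun f => V (model_graph thr s f))))%:E
    <= P [set w | V (rg_adj G w)])%E.
Proof.
have -> : [set w | V (rg_adj G w)] = config_event (G := G) U.
  by apply/seteqP; split => w; rewrite /config_event /= /U -(V_ext (adj_graph_of w)).
have msigma s mu : sigma_of (loc_mark (fun i => X i : _ -> R) (fun i => M i : _ -> R)) (atom s mu).
  by apply: box_sigma => v; exact: measurable_cell.
pose F (p : place * marks) := atom p.1 p.2 `&` config_event (G := G) U.
have mF p : measurable (F p).
  apply: measurableI; last exact: config_event_measurable.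
  exact: sigma_measurable (msigma _ _).
apply: (@le_trans _ _ (\sum_(p : place * marks) P (F p))%E); last first.
  rewrite -(@measure_finU_eq _ _ _ P _ F xpredT [set w | exists2 p, true & F p w])//.
  - apply: le_measure; rewrite ?inE.
    + exact: measurable_finU.
    + exact: config_event_measurable.
    + by move=> w [p _ []].
  - exact: measurable_finU.
  - by move=> [s mu] [s' mu'] w _ _ [a1 _] [a2 _]; have [/= -> ->] := atom_inj a1 a2.
rewrite (eq_Ex _ Pr_model).
pose c s mu e : R := (thr' s mu e)%:R / Mg%:R.
have c01 s mu e : 0 <= c s mu e <= 1.
  by rewrite divr_ge0 ?ler0n//= ler_pdivrMr ?ltr0n// mul1r ler_nat thr'M.
have E s mu : (weight unif s * weight unif mu * Pr (unif : _ -> _ -> R) (Phi s mu))%:E =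
    ((Pr (bern (c s mu)) U)%:E * P (atom s mu))%E.
  rewrite P_atom -EFinM mulrC -(Pr_threshold U Mg0 (@thr'M s mu)); congr (_ * _)%:E.
  by rewrite /weight /unif !prodr_const !card_ord.
rewrite /Ex -(pair_big xpredT xpredT (fun s mu => P (F (s, mu))))/= -sumEFin.
apply: lee_sum => s _; rewrite mulr_sumr -sumEFin; apply: lee_sum => mu _.
rewrite mulrA E; apply: P_increasing => //.
move=> e w aw nr; rewrite /c /thr'; case: ifPn => [e12|ne]; last first.
  by rewrite mul0r; case/andP: (epm01 hg hrho beta0 n0 e w).
by rewrite epmE//; apply: thr_ok.
Qed.
End Transfer.

(** * Step functions and iterated integrals *)

Section StepBounds.
Context {R : realType} {I : finType}.
Notation leb := (@lebesgue_measure R).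
Implicit Types (f : R -> \bar R) (F : I -> R) (C : I -> set R) (D : set R).

Let step_integral F C (r : seq I) : (forall i, 0 <= F i) -> (forall i, measurable (C i)) ->
  (\int[leb]_x (\sum_(i <- r) (F i)%:E * (\1_(C i) x)%:E) = \sum_(i <- r) (F i)%:E * leb (C i))%E.
Proof.
move=> F0 mC.
have mI i : measurable_fun setT (fun x : R => (\1_(C i) x : R)%:E).
  by apply/measurable_EFinP; apply: measurable_indic.
rewrite ge0_integral_sum//.
- apply: eq_bigr => i _; rewrite (ge0_integralZl leb measurableT (mI i)) ?lee_fin//.
  rewrite (integral_indic leb measurableT (mC i)) setIT.
  by [].
- by move=> i; apply: (measurable_funeM (F i)%:E (mI i)).
- by move=> i x _; rewrite mule_ge0 ?lee_fin.
Qed.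

(** Only monotonicity of the integral of nonnegative functions is used, so [f] may fail to be measurable;
    the inner integrals below are of this kind. *)
Lemma integral_le_step f F C D :
  (forall i, 0 <= F i) -> (forall i, measurable (C i)) ->
  (forall x, D x -> (0 <= f x)%E) ->
  (forall x, D x -> exists2 i, C i x & (f x <= (F i)%:E)%E) ->
  (\int[leb]_(x in D) f x <= \sum_i (F i)%:E * leb (C i))%E.
Proof.
move=> F0 mC f0 fF; rewrite -step_integral//; apply: ge0_integral_mono => //.
- by move=> x _; rewrite sume_ge0// => i _; rewrite mule_ge0 ?lee_fin.
- move=> x Dx; split=> //; have [i Ci fi] := fF x Dx; apply: (le_trans fi).
  rewrite (bigD1 i)//= indicE mem_set// mule1 leeDl// sume_ge0// => j _.
  by rewrite mule_ge0 ?lee_fin.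
Qed.

Lemma step_le_integral f F C D :
  (forall i, 0 <= F i) -> (forall i, measurable (C i)) ->
  (forall i x, C i x -> D x) ->
  (forall i j x, C i x -> C j x -> i = j) ->
  (forall x, D x -> (0 <= f x)%E) ->
  (forall i x, C i x -> ((F i)%:E <= f x)%E) ->
  (\sum_i (F i)%:E * leb (C i) <= \int[leb]_(x in D) f x)%E.
Proof.
move=> F0 mC CD dC f0 fF; rewrite -step_integral// [leRHS]integral_mkcond.
apply: ge0_integral_mono => //.
- by move=> x _; rewrite sume_ge0// => i _; rewrite mule_ge0 ?lee_fin.
- by move=> x _; apply: erestrict_ge0.
move=> x _; split => //; have [[i Ci]|nC] := pselect (exists i, C i x).
  rewrite (bigD1 i)//= big1 ?adde0.
    by rewrite indicE mem_set// mule1 patchE mem_set ?fF//; exact: CD Ci.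
  by move=> j ji; rewrite indicE memNset ?mule0// => Cj; rewrite (dC _ _ _ Cj Ci) eqxx in ji.
rewrite big1 ?erestrict_ge0// => i _; rewrite indicE memNset ?mule0// => Ci.
by apply: nC; exists i.
Qed.
End StepBounds.

(** * What the two hypotheses say about the mark integral *)

Section LogRatio.
Context {R : realType} {g : R -> R -> R} {rho : R -> R}.
Hypothesis hg : is_kernel g.
Hypothesis hrho : is_profile rho.
Local Notation leb := (@lebesgue_measure R).

Definition mark_integral (a : R) (n : nat) : \bar R :=
  (\int[leb]_(s in `]a, 1%R[) \int[leb]_(t in `]a, 1%R[) (rho (g s t * n%:R)%R)%:E)%E.

Lemma rho_g01 s t c : 0 < s < 1 -> 0 < t < 1 -> 0 < c -> 0 <= rho (g s t * c) <= 1.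
Proof.
move=> s01 t01 c0; apply: (profile_itv hrho); rewrite in_itv/= andbT mulr_gt0//.
by apply: (kernel_gt0 hg); rewrite in_itv.
Qed.

Lemma rho_g_antitone s t s' t' c c' : 0 < s -> 0 < t -> s' < 1 -> t' < 1 -> 0 < c -> c <= c' ->
  s <= s' -> t <= t' -> rho (g s' t' * c') <= rho (g s t * c).
Proof.
move=> s0 t0 s'1 t'1 c0 cc ss tt.
have s01 : s \in `]0, 1[ by rewrite in_itv/= s0 (le_lt_trans ss).
have t01 : t \in `]0, 1[ by rewrite in_itv/= t0 (le_lt_trans tt).
have s'01 : s' \in `]0, 1[ by rewrite in_itv/= s'1 (lt_le_trans s0).
have t'01 : t' \in `]0, 1[ by rewrite in_itv/= t'1 (lt_le_trans t0).
have c'0 := lt_le_trans c0 cc.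
have gg : g s t <= g s' t'.
  exact: le_trans (kernel_homor hg s01 t01 t'01 tt) (kernel_homol hg t'01 s01 s'01 ss).
have g0 := kernel_gt0 hg s01 t01; have g'0 := kernel_gt0 hg s'01 t'01.
apply: (profile_nonincr hrho); rewrite ?in_itv/= ?andbT ?mulr_gt0//.
by rewrite ler_pM// ltW.
Qed.

Lemma mark_integral_ge0 a n : 0 < a -> (0 < n)%N -> (0 <= mark_integral a n)%E.
Proof.
move=> a0 n0; apply: integral_ge0 => s /=; rewrite in_itv/= => /andP[as_ s1].
apply: integral_ge0 => t /=; rewrite in_itv/= => /andP[at_ t1].
have /andP[] // : 0 <= rho (g s t * n%:R) <= 1.
by apply: rho_g01; rewrite ?ltr0n ?s1 ?t1 ?(lt_trans a0).
Qed.

Lemma mark_integral_antitone a a' n : 0 < a -> a <= a' -> (0 < n)%N ->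
  (mark_integral a' n <= mark_integral a n)%E.
Proof.
move=> a0 aa n0; have sub x : `]a', 1[%classic x -> `]a, 1[%classic x.
  by rewrite /= !in_itv/= => /andP[/(le_lt_trans aa) -> ->].
have r0 s t : `]a, 1[%classic s -> `]a, 1[%classic t -> (0 <= (rho (g s t * n%:R))%:E)%E.
  rewrite /= !in_itv/= => /andP[as_ s1] /andP[at_ t1]; rewrite lee_fin.
  by have /andP[] : 0 <= rho (g s t * n%:R) <= 1 by apply: rho_g01; rewrite ?ltr0n ?s1 ?t1 ?(lt_trans a0).
apply: ge0_integral_mono.
- by move=> s /sub as_; apply: integral_ge0 => t /sub; exact: r0.
- by move=> s as_; apply: integral_ge0 => t; exact: r0.
move=> s /[dup] /sub as_ _; split => //; apply: ge0_integral_mono.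
- by move=> t /sub; exact: r0.
- by move=> t; exact: r0.
- by move=> t /sub.
Qed.

Lemma log_ratio_mono mu mu' n : mu < 1 -> mu' < 1 -> mu <= mu' ->
  (log_ratio g rho mu' n <= log_ratio g rho mu n)%E.
Proof.
move=> mu1 mu'1 mm; rewrite /log_ratio.
have [n1|n1] := leqP n 1%N.
  have -> : ln n%:R = 0 :> R by case: n n1 => [|[|]]//; rewrite ?ln1// ln0.
  have Z (u v : \bar R) : (u * ((0 : R)^-1)%:E <= v * ((0 : R)^-1)%:E)%E.
    by rewrite invr0 (mule0 u) (mule0 v).
  exact: Z.
have n0 : (0 < n)%N by exact: ltnW.
have n0' : 0 < n%:R :> R by rewrite ltr0n.
apply: lee_wpmul2r; first by rewrite lee_fin invr_ge0 ln_ge0// ler1n.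
rewrite lee_lne ?in_itv/= ?leey ?andbT.
- apply: mark_integral_antitone; rewrite ?powR_gt0//.
  by rewrite ler_powR ?ler1n// lerD2r.
- by apply: mark_integral_ge0; rewrite ?powR_gt0.
- by apply: mark_integral_ge0; rewrite ?powR_gt0.
Qed.

Lemma limn_einf_mono (u v : (\bar R)^nat) : (forall n, (u n <= v n)%E) -> (limn_einf u <= limn_einf v)%E.
Proof.
move=> uv; rewrite !limn_einf_lim; apply: lee_lim; [exact: is_cvg_einfs..|].
apply: nearW => n; apply: le_ereal_inf_tmp => _ [k nk <-].
by apply: le_trans (uv k); apply: ereal_inf_lbound; exists k.
Qed.

Lemma limn_esup_mono (u v : (\bar R)^nat) : (forall n, (u n <= v n)%E) -> (limn_esup u <= limn_esup v)%E.
Proof.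
move=> uv; rewrite !limn_esup_lim; apply: lee_lim; [exact: is_cvg_esups..|].
apply: nearW => n; apply: ge_ereal_sup => _ [k nk <-].
by apply: (le_trans (uv k)); apply: ereal_sup_ubound; exists k.
Qed.

Lemma lt_limn_einf (u : (\bar R)^nat) (l : \bar R) : (l < limn_einf u)%E ->
  exists N, forall n, (N <= n)%N -> (l < u n)%E.
Proof.
rewrite limn_einf_lim (cvg_lim _ (@cvg_einfs_sup R u))// => /ereal_sup_gt[_ [N _ <-] lN].
by exists N => n Nn; apply: (lt_le_trans lN); apply: ereal_inf_lbound; exists n.
Qed.

Lemma gt_limn_esup (u : (\bar R)^nat) (l : \bar R) : (limn_esup u < l)%E ->
  exists N, forall n, (N <= n)%N -> (u n < l)%E.
Proof.
rewrite limn_esup_lim (cvg_lim _ (@cvg_esups_inf R u))// => /ereal_inf_lt[_ [N _ <-] lN].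
by exists N => n Nn; apply: le_lt_trans lN; apply: ereal_sup_ubound; exists n.
Qed.

Lemma lne_powR (n : nat) (y : R) : (0 < n)%N -> lne (n%:R `^ y)%:E = (y * ln n%:R)%:E.
Proof. by move=> n0; rewrite lne_EFin ?powR_gt0 ?ltr0n// ln_powR. Qed.

Lemma log_ratio_gt mu n (y : R) : (1 < n)%N -> (y%:E < log_ratio g rho mu n)%E ->
  ((n%:R `^ y)%:E < mark_integral (n%:R `^ (mu - 1)) n)%E.
Proof.
move=> n1; rewrite /log_ratio => H.
have n0 : (0 < n)%N by exact: ltnW.
have n0' : 0 < n%:R :> R by rewrite ltr0n.
have ln0 : 0 < ln n%:R :> R by rewrite ln_gt0// ltr1n.
move: H; rewrite -/(mark_integral _ n) lte_pdivlMr// => H.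
have m0 : (0 <= mark_integral (n%:R `^ (mu - 1)) n)%E by apply: mark_integral_ge0; rewrite ?powR_gt0.
have p0 : (0 <= (n%:R `^ y)%:E)%E by rewrite lee_fin powR_ge0.
by rewrite -lte_lne; [rewrite lne_powR | rewrite in_itv/= ?m0 ?p0 leey | rewrite in_itv/= ?m0 ?p0 leey].
Qed.

Lemma log_ratio_lt mu n (y : R) : (1 < n)%N -> (log_ratio g rho mu n < y%:E)%E ->
  (mark_integral (n%:R `^ (mu - 1)) n < (n%:R `^ y)%:E)%E.
Proof.
move=> n1; rewrite /log_ratio => H.
have n0 : (0 < n)%N by exact: ltnW.
have n0' : 0 < n%:R :> R by rewrite ltr0n.
have ln0 : 0 < ln n%:R :> R by rewrite ln_gt0// ltr1n.
move: H; rewrite -/(mark_integral _ n) lte_pdivrMr// => H.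
have m0 : (0 <= mark_integral (n%:R `^ (mu - 1)) n)%E by apply: mark_integral_ge0; rewrite ?powR_gt0.
have p0 : (0 <= (n%:R `^ y)%:E)%E by rewrite lee_fin powR_ge0.
by rewrite -lte_lne; [rewrite lne_powR | rewrite in_itv/= ?m0 ?p0 leey | rewrite in_itv/= ?m0 ?p0 leey].
Qed.

Lemma real_between (x : R) (y : \bar R) : (x%:E < y)%E -> exists2 z : R, x < z & (z%:E < y)%E.
Proof.
case: y => [r| |] //=; last by exists (x + 1); rewrite ?ltry// ltrDl.
by rewrite lte_fin => xr; exists ((x + r) / 2); rewrite ?lte_fin ?midf_lt.
Qed.

(** The quantity is monotone in [mu], so the limit is a supremum and a single [mu] already witnesses it. *)
Lemma slow_decay : (- lim (limn_einf (log_ratio g rho mu) @[mu --> 0^'+]) < (2%R)%:E)%E ->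
  exists mu y : R, exists N, [/\ 0 < mu < 1, - 2%R < y & forall n, (N <= n)%N ->
    ((n%:R `^ y)%:E < mark_integral (n%:R `^ (mu - 1)) n)%E].
Proof.
have H : {in `]0, 1[ &, nonincreasing_fun (fun mu : R => limn_einf (log_ratio g rho mu))}.
  move=> x y; rewrite !in_itv/= => /andP[_ x1] /andP[_ y1] xy.
  by apply: limn_einf_mono => n; exact: log_ratio_mono.
have r01 : (BRight (0 : R) < BLeft (1 : R))%O by rewrite bnd_simp.
rewrite (cvg_lim _ (@nonincreasing_at_right_cvge R _ 0 (BLeft 1) r01 H))// lteNl.
move=> /ereal_sup_gt[_ [mu /= + <-]]; rewrite in_itv/= => mu01.
move=> /real_between[y y2] /lt_limn_einf[N HN].
exists mu, y, (maxn 2 N); split => // n; rewrite geq_max => /andP[n2 nN].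
by apply: log_ratio_gt => //; exact: HN.
Qed.

Lemma fast_decay : ((2%R)%:E < - lim (limn_esup (log_ratio g rho mu) @[mu --> 0^'-]))%E ->
  exists mu y : R, exists N, [/\ 0 < mu < 1, 2 < y & forall n, (N <= n)%N ->
    (mark_integral (n%:R `^ (- mu - 1)) n < (n%:R `^ (- y))%:E)%E].
Proof.
have H : {in `]0, 1[ &, nondecreasing_fun (fun mu : R => limn_esup (log_ratio g rho (- mu)))}.
  move=> x y; rewrite !in_itv/= => /andP[x0 x1] /andP[y0 y1] xy.
  by apply: limn_esup_mono => n; apply: log_ratio_mono; lra.
have r01 : (BRight (0 : R) < BLeft (1 : R))%O by rewrite bnd_simp.
have Hc := @nondecreasing_at_right_cvge R _ 0 (BLeft 1) r01 H.
rewrite -[X in X ^'+]oppr0 in Hc; rewrite (cvg_lim _ ((cvg_at_leftNP _ _ _).2 Hc))//.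
rewrite lteNr => /ereal_inf_lt[_ [mu /= + <-]]; rewrite in_itv/= => mu01.
move=> H2.
have {H2} : (2%:E < - limn_esup (log_ratio g rho (- mu)))%E by rewrite lteNr.
move=> /real_between[y y2]; rewrite lteNr => /gt_limn_esup[N HN].
exists mu, y, (maxn 2 N); split => // n; rewrite geq_max => /andP[n2 nN].
by apply: log_ratio_lt => //; exact: HN.
Qed.

Lemma geometric_cell (q x : R) J : 0 < q -> q ^+ J <= x -> x < 1 ->
  exists i : 'I_J, `[q ^+ i.+1, q ^+ i[%classic x.
Proof.
move=> q0; elim: J => [|J IH]; first by rewrite expr0 => /le_lt_trans H /H; rewrite ltxx.
move=> xJ x1; have [Jx|xJ'] := leP (q ^+ J) x.
  by have [i Hi] := IH Jx x1; exists (widen_ord (leqnSn J) i).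
by exists ord_max; rewrite /= in_itv/= xJ xJ'.
Qed.

Lemma measure_cell_le (q : R) (i : nat) : 0 < q -> q <= 1 ->
  (leb `[(q ^+ i.+1)%R, (q ^+ i)%R[%classic <= (q ^+ i)%:E)%E.
Proof.
move=> q0 q1; rewrite lebesgue_measure_itv/=; case: ifP => _; last by rewrite lee_fin exprn_ge0// ltW.
by rewrite -EFinB lee_fin gerBl exprn_ge0// ltW.
Qed.

Lemma mark_integral_pigeon (q : R) J n : 0 < q -> q < 1 -> (0 < n)%N ->
  (mark_integral (q ^+ J) n <=
    (\sum_(i < J) \sum_(j < J) rho (g (q ^+ i.+1) (q ^+ j.+1) * n%:R) * q ^+ j * q ^+ i)%:E)%E.
Proof.
move=> q0 q1 n0; have n0' : 0 < n%:R :> R by rewrite ltr0n.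
have qi i : 0 < q ^+ i.+1 < 1 by rewrite exprn_gt0//= exprn_ilt1// ltW.
have r0 (i j : 'I_J) : 0 <= rho (g (q ^+ i.+1) (q ^+ j.+1) * n%:R).
  by have /andP[] := rho_g01 (qi i) (qi j) n0'.
have inJ (x : R) : `]q ^+ J, 1[%classic x -> 0 < x < 1 /\ exists i : 'I_J, `[q ^+ i.+1, q ^+ i[%classic x.
  rewrite /= in_itv/= => /andP[Jx x1]; split; last exact: geometric_cell q0 (ltW Jx) x1.
  by rewrite x1 andbT (lt_trans _ Jx)// exprn_gt0.
have F0 (i : 'I_J) : 0 <= \sum_(j < J) rho (g (q ^+ i.+1) (q ^+ j.+1) * n%:R) * q ^+ j.
  by apply: sumr_ge0 => j _; rewrite mulr_ge0// exprn_ge0// ltW.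
pose F (i : 'I_J) := \sum_(j < J) rho (g (q ^+ i.+1) (q ^+ j.+1) * n%:R) * q ^+ j.
pose C (i : 'I_J) := `[q ^+ i.+1, q ^+ i[%classic.
have f0 s t : 0 < s < 1 -> 0 < t < 1 -> (0 <= (rho (g s t * n%:R))%:E)%E.
  by move=> s01 t01; rewrite lee_fin; have /andP[] := rho_g01 s01 t01 n0'.
apply: (@le_trans _ _ (\sum_i (F i)%:E * leb (C i))%E).
  apply: integral_le_step => //; first by move=> i; exact: measurable_itv.
    move=> s /inJ[s01 _]; apply: integral_ge0 => t /inJ[t01 _]; exact: f0.
  move=> s /inJ[s01 [i Ci]]; exists i => //.
  apply: (@le_trans _ _ (\sum_(j < J) (rho (g (q ^+ i.+1) (q ^+ j.+1) * n%:R))%:E * leb (C j))%E).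
    apply: integral_le_step => //; first by move=> j; exact: measurable_itv.
      by move=> t /inJ[t01 _]; exact: f0.
    move=> t /inJ[t01 [j Cj]]; exists j => //; rewrite lee_fin.
    move: Ci Cj s01 t01; rewrite /= !in_itv/= => /andP[is_ _] /andP[jt _] /andP[_ s1] /andP[_ t1].
    by apply: rho_g_antitone => //; [case/andP: (qi i)|case/andP: (qi j)].
  rewrite /F -sumEFin; apply: lee_sum => j _; rewrite EFinM.
  by apply: lee_wpmul2l; rewrite ?lee_fin ?r0 ?measure_cell_le// ltW.
rewrite -sumEFin; apply: lee_sum => i _; rewrite -mulr_suml EFinM.
by apply: lee_wpmul2l; rewrite ?lee_fin ?F0 ?measure_cell_le// ltW.
Qed.

(** Along a geometric grid of marks with polynomially small ratio there are only boundedly many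
    pairs of scales, so a single pair carries the integral up to a small power of [n]. *)
Lemma dominant_scale :
  (- lim (limn_einf (log_ratio g rho mu) @[mu --> 0^'+]) < (2%R)%:E)%E ->
  exists kappa : R, exists N : nat, [/\ 0 < kappa, kappa < 1 & forall n, (N <= n)%N ->
    exists s t : R, [/\ 0 < s < 1, 0 < t < 1, n%:R `^ (kappa - 1) <= s,
      n%:R `^ (kappa - 1) <= t & n%:R `^ (kappa - 2) <= rho (g s t * n%:R) * (s * t)]].
Proof.
move=> /slow_decay[mu [y [N0 [/andP[mu0 mu1] y2 HN]]]].
pose de := (y + 2) / 3; have de0 : 0 < de by rewrite /de; lra.
pose kappa := Num.min mu de.
have [J [J0 JE]] : exists J : nat, (0 < J)%N /\ 2 / J%:R <= de.
  exists (Num.truncn (2 / de)).+1; split => //.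
  by rewrite ler_pdivrMr ?ltr0n// mulrC -ler_pdivrMr// ltW// truncnS_gt.
pose N1 := (Num.truncn ((J%:R ^+ 2) `^ de^-1 : R)).+1.
exists kappa, (maxn 2 (maxn N0 N1)); split.
- by rewrite /kappa lt_min mu0.
- by rewrite /kappa gt_min mu1.
move=> n; rewrite !geq_max => /and3P[n2 nN0 nN1].
have n0 : (0 < n)%N by exact: leq_trans n2.
have n0' : 0 < n%:R :> R by rewrite ltr0n.
have n1' : 1 <= n%:R :> R by rewrite ler1n.
pose q : R := n%:R `^ ((mu - 1) / J%:R).
have J0' : 0 < J%:R :> R by rewrite ltr0n.
have q0 : 0 < q by rewrite powR_gt0.
have q1 : q < 1.
  rewrite /q /powR gt_eqF// expR_lt1 pmulr_llt0 ?ln_gt0 ?ltr1n// pmulr_llt0 ?invr_gt0//; lra.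
have qJ : q ^+ J = n%:R `^ (mu - 1).
  by rewrite -powR_mulrn ?ltW// -powRrM divfK// gt_eqF.
have JJ : J%:R ^+ 2 <= n%:R `^ de.
  have -> : J%:R ^+ 2 = ((J%:R ^+ 2) `^ de^-1) `^ de :> R.
    by rewrite -powRrM mulVf ?gt_eqF// powRr1// exprn_ge0.
  apply: ge0_ler_powR; rewrite ?nnegrE ?ltW ?powR_gt0 ?exprn_gt0//.
  by rewrite (lt_le_trans (truncnS_gt _))// ler_nat.
have kq i : 0 < q ^+ i.+1 < 1 by rewrite exprn_gt0//= exprn_ilt1// ltW.
have klo (i : 'I_J) : n%:R `^ (kappa - 1) <= q ^+ i.+1.
  apply: (@le_trans _ _ (q ^+ J)); last by apply: ler_wiXn2l; rewrite ?ltW.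
  by rewrite qJ ler_powR// lerD2r /kappa ge_min lexx.
apply: contrapT => Hno.
have small (i j : 'I_J) : rho (g (q ^+ i.+1) (q ^+ j.+1) * n%:R) * q ^+ j * q ^+ i <=
    n%:R `^ (kappa - 2) * q ^- 2.
  rewrite ler_pdivlMr ?exprn_gt0//.
  have -> : forall r a b : R, r * a * b * q ^+ 2 = r * ((q * b) * (q * a)) by move=> *; ring.
  rewrite -!exprS leNgt; apply/negP => /ltW H; apply: Hno.
  by exists (q ^+ i.+1), (q ^+ j.+1); split.
have q2 : q ^- 2 <= n%:R `^ de.
  have -> : q ^- 2 = n%:R `^ (- ((mu - 1) / J%:R * 2%:R)).
    by rewrite powRN powRrM powR_mulrn ?powR_ge0.
  rewrite ler_powR//; apply: le_trans JE.
  rewrite -mulrA (mulrC _ 2%:R) mulrA -mulNr ler_wpM2r ?invr_ge0 ?ltW//; lra.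
have := HN n nN0; rewrite -qJ => /lt_le_trans /(_ (mark_integral_pigeon J q0 q1 n0)).
rewrite lte_fin ltNge => /negP; apply.
apply: (@le_trans _ _ (\sum_(i < J) \sum_(j < J) n%:R `^ (kappa - 2) * n%:R `^ de)).
  apply: ler_sum => i _; apply: ler_sum => j _; apply: le_trans (small i j) _.
  by rewrite ler_wpM2l ?powR_ge0.
have cst (c : R) : \sum_(i < J) c = J%:R * c by rewrite sumr_const card_ord mulr_natl.
rewrite !cst mulrA -expr2.
apply: (@le_trans _ _ (n%:R `^ de * (n%:R `^ (kappa - 2) * n%:R `^ de))).
  by rewrite ler_wpM2r ?mulr_ge0 ?powR_ge0.
have nn0 : n%:R != 0 :> R by rewrite gt_eqF.
rewrite -!powRD ?nn0 ?implybT// ler_powR//.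
have : kappa <= de by rewrite /kappa ge_min lexx orbT.
rewrite /de; lra.
Qed.
End LogRatio.

(** * Sizes and error budget of the hierarchy *)

Section Sizes.
Context {R : realFieldType}.
Variables (mh B K Mt : nat).
Hypotheses (mh0 : (0 < mh)%N) (B10 : (10 <= B)%N) (K0 : (0 < K)%N).
Hypothesis Mt4 : (4 <= Mt <= 4 * (B * 2 ^ K))%N.

Definition br k := (B * 2 ^ k)%N.
Definition branching k := if k == 0%N then (2 * mh)%N else if k == K then Mt else br k.
Definition spare k := if k == 0%N then mh else 3%N.
Notation b := branching.
Notation sp := spare.
Notation W := (width b).

Lemma br10 k : (10 <= br k)%N.
Proof. by rewrite (leq_trans B10)// leq_pmulr// expn_gt0. Qed.

Lemma brS k : br k.+1 = (2 * br k)%N.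
Proof. by rewrite /br expnS mulnCA. Qed.

Lemma branching_br k : (k.+1 < K)%N -> b k.+1 = br k.+1.
Proof. by move=> kK; rewrite /b/= ltn_eqF. Qed.

Lemma branching_le k : (b k.+1 <= 4 * br k.+1)%N.
Proof.
rewrite /b/=; case: eqP => [->|_]; first by case/andP: Mt4.
by rewrite leq_pmull.
Qed.

Lemma branching_ge4 k : (4 <= b k.+1)%N.
Proof.
rewrite /b/=; case: eqP => [_|_]; first by case/andP: Mt4.
by rewrite (leq_trans _ (br10 _)).
Qed.

Lemma branching_gt0 k : (0 < b k)%N.
Proof. by case: k => [|k]; [rewrite /b/= muln_gt0|rewrite (leq_trans _ (branching_ge4 k))]. Qed.

Lemma width_gt0 k : (0 < W k)%N.
Proof. by rewrite prodn_gt0// => i; exact: branching_gt0. Qed.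

Lemma width_ge k : (k < K)%N -> (B ^ k <= W k)%N.
Proof.
elim: k => [|k IH] kK; first by rewrite expn0 width_gt0.
rewrite widthS branching_br// expnSr leq_mul//; first exact: IH (ltnW kK).
by rewrite /br leq_pmulr// expn_gt0.
Qed.

Lemma width_mono : {homo W : j k / (j <= k)%N}.
Proof.
by apply: homo_leq => //; [exact: leq_trans | move=> k; rewrite widthS leq_pmulr// branching_gt0].
Qed.

Let half k : R := 2^-1 + 2^-1 / 2 ^+ k.

Let half_ge k : 2^-1 <= half k.
Proof. by rewrite lerDl divr_ge0 ?invr_ge0 ?exprn_ge0. Qed.

(* the spare and missing children of a block cost at most a fraction 5 / br of it *)
Let half_step k c : (c <= 5)%N -> half k.+1 * (br k.+1)%:R <= half k * (br k.+1 - c)%:R :> R.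
Proof.
move=> c5; rewrite natrB ?(leq_trans c5)// ?(leq_trans _ (br10 _))//.
have c5' : c%:R <= 5 :> R by rewrite ler_nat.
have B10' : 10 <= B%:R :> R by rewrite ler_nat.
rewrite /half /br natrM natrX exprS.
set z : R := 2 ^+ k; have z1 : 1 <= z by rewrite exprn_ege1// ler1n.
have z0 : z != 0 by rewrite gt_eqF// (lt_le_trans _ z1).
have -> : (2^-1 + 2^-1 / (2 * z)) * (B%:R * (2 * z)) = B%:R * z + B%:R / 2 :> R by field.
have -> : (2^-1 + 2^-1 / z) * (B%:R * (2 * z) - c%:R) = B%:R * z + B%:R - c%:R / 2 - c%:R / 2 / z :> R.
  by field.
have : c%:R / 2 / z <= c%:R / 2 :> R.
  by rewrite ler_pdivrMr ?(lt_le_trans ltr01 z1)// ler_peMr// divr_ge0.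
lra.
Qed.

Let grow (c a : nat) (N : nat -> nat) : (c <= 5)%N -> (a <= N 0)%N ->
  (forall k, N k.+1 = ((b k.+1 - c) * N k)%N) ->
  forall k, (k < K)%N -> (a * W k)%:R * half k <= (N k)%:R.
Proof.
move=> c5 a0 NS; elim=> [|k IH] kK.
  rewrite /width big_ord0 muln1 /half expr0 divr1.
  have -> : (2^-1 + 2^-1 : R) = 1 by lra.
  by rewrite mulr1 ler_nat.
rewrite NS widthS branching_br// mulnA natrM [leRHS]natrM -mulrA (mulrC (br _)%:R).
apply: (@le_trans _ _ ((a * W k)%:R * (half k * (br k.+1 - c)%:R))).
  by rewrite ler_wpM2l ?ler0n ?half_step.
by rewrite mulrA mulrC ler_wpM2l ?ler0n// IH// ltnW.
Qed.

Let ge_half (x y : R) k : 0 <= x -> x * half k <= y -> x / 2 <= y.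
Proof. by move=> x0; apply: le_trans; rewrite ler_wpM2l. Qed.

Lemma nfree_ge k : (k < K)%N -> (mh * W k)%:R / 2 <= (nfree b sp k)%:R :> R.
Proof.
move=> kK; apply: ge_half (ler0n _ _) (grow (c := 5) _ _ _ kK) => //.
by rewrite /= /b /sp/= mul2n -addnn addnK.
Qed.

Lemma nclass_gt0 k : (k < K)%N -> (0 < nclass b sp k)%N.
Proof.
case: k => [|k] kK //=; rewrite -(ltr0n R); apply: lt_le_trans (nfree_ge (ltnW kK)).
by rewrite divr_gt0// ltr0n muln_gt0 mh0 width_gt0.
Qed.

Lemma nclass_ge k : (k < K)%N ->
  (mh * W k.+1)%:R <= (nclass b sp k)%:R * (4 * (br k.+1)%:R ^+ 2) :> R.
Proof.
case: k => [|k] kK /=.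
  rewrite /sp/= natrM ler_wpM2l ?ler0n// /width big_ord_recl big_ord0 muln1.
  apply: (@le_trans _ _ (4 * br 1)%:R); first by rewrite ler_nat branching_le.
  by rewrite natrM ler_wpM2l// ler_eXnr// ler1n (leq_trans _ (br10 _)).
have := nfree_ge (ltnW kK) => H.
apply: (@le_trans _ _ ((mh * W k)%:R / 2 * (4 * (br k.+2)%:R ^+ 2))); last first.
  by rewrite ler_wpM2r// mulr_ge0// exprn_ge0.
have bx : (b k.+2)%:R <= 4 * (2 * (br k.+1)%:R) :> R by rewrite -!natrM ler_nat -(brS k.+1) branching_le.
rewrite 2!widthS branching_br// (brS k.+1) (natrM _ 2%N) 2!mulnA.
move: bx; move: (br k.+1) (b k.+2) => x c cx.
rewrite [leLHS]natrM (natrM _ (mh * W k)%N); move: (mh * W k)%N => a.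
apply: (@le_trans _ _ (a%:R * x%:R * (4 * (2 * x%:R)))); first by rewrite ler_wpM2l// mulr_ge0.
by apply: eq_ler; field.
Qed.

Lemma ntot_ge : (mh * W K)%:R / 2 <= (ntot b K)%:R :> R.
Proof.
have Kp : K.-1.+1 = K by rewrite prednK.
have kK : (K.-1 < K)%N by rewrite Kp.
have H : (2 * mh * W K.-1)%:R / 2 <= (ntot b K.-1)%:R :> R.
  exact: ge_half (ler0n _ _) (grow (c := 2) (N := ntot b) _ _ _ kK).
rewrite -Kp /= widthS [b _.+1](_ : _ = Mt); last by rewrite /b/= Kp eqxx.
have Mt2 : (Mt <= 2 * (Mt - 2))%N by case/andP: Mt4 => ? _; lia.
apply: (@le_trans _ _ ((Mt - 2)%:R * ((2 * mh * W K.-1)%:R / 2))); last by rewrite [leRHS]natrM ler_wpM2l.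
have M2 : Mt%:R <= 2 * (Mt - 2)%:R :> R by rewrite -natrM ler_nat.
have -> : (2 * mh * W K.-1)%:R / 2 = (mh * W K.-1)%:R :> R by rewrite -mulnA natrM mulrC mulKf ?pnatr_eq0.
rewrite mulnA (natrM _ (mh * W K.-1)%N).
have : 0 <= (mh * W K.-1)%:R :> R by rewrite ler0n.
nra.
Qed.
End Sizes.

Section Errors.
Context {R : realFieldType}.
Variables (B : nat) (X : R).
Hypothesis B0 : (0 < B)%N.
Definition err_cst : R := (2 ^+ 11 * B%:R ^+ 2)^-1.
Definition err k : R := err_cst / 16 ^+ k.
Definition merge_err k : R := X * (br B k.+1)%:R ^+ 4 / (2 ^+ 10) ^+ k.

Lemma err_gt0 k : 0 < err k.
Proof. by rewrite divr_gt0 ?exprn_gt0// invr_gt0 mulr_gt0 ?exprn_gt0// ltr0n. Qed.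

Lemma errS (m : R) (c k : nat) : (c <= 4 * br B k.+1)%N -> 0 <= m ->
  2 ^+ 4 * (br B k.+1)%:R ^+ 2 * m <= err k / 32 ->
  c%:R ^+ 2 * (err k ^+ 2 + m) <= err k.+1.
Proof.
move=> cB m0 mE.
have c4 : c%:R <= 4 * (br B k.+1)%:R :> R by rewrite -natrM ler_nat.
have c2 : c%:R ^+ 2 <= 2 ^+ 4 * (br B k.+1)%:R ^+ 2 :> R.
  have -> : 2 ^+ 4 * (br B k.+1)%:R ^+ 2 = (4 * (br B k.+1)%:R) ^+ 2 :> R by ring.
  by rewrite ler_sqr ?nnegrE ?mulr_ge0.
apply: (@le_trans _ _ (2 ^+ 4 * (br B k.+1)%:R ^+ 2 * (err k ^+ 2 + m))).
  by rewrite ler_wpM2r// addr_ge0// exprn_ge0// ltW// err_gt0.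
rewrite mulrDr; have -> : err k.+1 = err k / 32 + err k / 32.
  rewrite /err exprS; set z := 16 ^+ k; have z0 : z != 0 by rewrite expf_neq0// pnatr_eq0.
  by field.
apply: lerD => //.
rewrite /br natrM natrX (exprS _ k).
set z : R := 2 ^+ k; have z1 : 1 <= z by rewrite exprn_ege1// ler1n.
have z0 : z != 0 by rewrite gt_eqF// (lt_le_trans _ z1).
have E : err k = err_cst / z ^+ 4 by rewrite /err /z -exprM mulnC exprM; congr (_ / _ ^+ _); ring.
have b0 : B%:R != 0 :> R by rewrite pnatr_eq0 -lt0n.
rewrite [X in _ <= X](_ : _ = err k * (2 ^+ 6 * B%:R ^+ 2 * err_cst)); last first.
  by rewrite /err_cst; field.
have -> : 2 ^+ 4 * (B%:R * (2 * z)) ^+ 2 * err k ^+ 2 = err k * (2 ^+ 6 * B%:R ^+ 2 * err_cst) / z ^+ 2.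
  by rewrite E; field.
have c0 : 0 <= err_cst by rewrite invr_ge0 mulr_ge0 ?exprn_ge0.
have z2 : 1 <= z ^+ 2 by rewrite exprn_ege1.
have e0 : 0 <= err k by rewrite ltW ?err_gt0.
have q0 : 0 <= 2 ^+ 6 * B%:R ^+ 2 * err_cst by rewrite mulr_ge0 ?mulr_ge0 ?exprn_ge0.
rewrite ler_pdivrMr ?(lt_le_trans ltr01)// ler_peMr//; exact: mulr_ge0.
Qed.

(** This is where the number [mh] of reserved vertices has to be large. *)
Lemma merge_err_le k : 2 ^+ 15 * X * B%:R ^+ 6 <= err_cst ->
  2 ^+ 4 * (br B k.+1)%:R ^+ 2 * merge_err k <= err k / 32.
Proof.
move=> H; rewrite /merge_err /br natrM natrX (exprS _ k).
set z : R := 2 ^+ k; have z1 : 1 <= z by rewrite exprn_ege1// ler1n.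
have z0 : 0 < z by rewrite (lt_le_trans _ z1).
have -> : err k = err_cst / z ^+ 4 by rewrite /err /z -exprM mulnC exprM; congr (_ / _ ^+ _); ring.
have -> : (2 ^+ 10) ^+ k = z ^+ 10 :> R by rewrite /z exprAC.
have -> : 2 ^+ 4 * (B%:R * (2 * z)) ^+ 2 * (X * (B%:R * (2 * z)) ^+ 4 / z ^+ 10) =
   2 ^+ 15 * X * B%:R ^+ 6 / z ^+ 4 / 32 by field; rewrite gt_eqF.
by rewrite !ler_wpM2r ?invr_ge0 ?exprn_ge0// ltW.
Qed.
End Errors.

(** The number [h] of fresh vertices is proportional to the distance [D] up to the branching factors [y],
    and [u] is the gain [D ^ kappa] over the critical decay. *)
Lemma merge_bound (R : realFieldType) (h D D0 y mh u v s t p s' t' p' : R) :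
  0 < h -> 0 < D -> 1 <= D0 -> 1 <= y -> 1 <= mh -> 0 < v -> v <= u ->
  mh * D <= h * (4 * y ^+ 2) * D0 ->
  u / D <= s -> u / D <= t -> u / D ^+ 2 <= s * t * p ->
  0 < s -> 0 < t -> 0 < p -> s / 2 <= s' -> t / 2 <= t' -> p / 2 <= p' ->
  (h * s')^-1 + (h * t')^-1 + (h ^+ 2 * (s' * t' * p'))^-1 <= (2 ^+ 8 * D0 ^+ 2 / mh) * y ^+ 4 / v.
Proof.
move=> h0 D0' D1 y1 m1 v0 vu hD su tu pu s0 t0 p0 ss tt pp.
have u0 : 0 < u by exact: lt_le_trans vu.
have m0 : 0 < mh by lra.
pose x := 4 * (y ^+ 2 * D0) / mh.
have Dh : D / h <= x by rewrite ler_pdivrMr// /x mulrAC ler_pdivlMr//; nra.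
have one a a' : 0 < a -> u / D <= a -> a / 2 <= a' -> (h * a')^-1 <= 2 * x / u.
  move=> a0 ua aa; apply: (@le_trans _ _ ((h * (u / D / 2))^-1)).
    have a'0 : 0 < a' by lra.
    have ud0 : 0 < u / D / 2 by do 2 apply: divr_gt0 => //.
    rewrite lef_pV2 ?posrE; [|exact: mulr_gt0..].
    by rewrite ler_pM2l//; move: ua aa; set q := u / D; lra.
  have -> : (h * (u / D / 2))^-1 = 2 * (D / h) / u by field; rewrite !gt_eqF.
  by rewrite ler_pM2r ?invr_gt0// ler_pM2l.
have two : (h ^+ 2 * (s' * t' * p'))^-1 <= 8 * x ^+ 2 / u.
  have stp : s * t * p / 8 <= s' * t' * p'.
    have -> : s * t * p / 8 = (s / 2) * (t / 2) * (p / 2) by field.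
    have [s2 t2 p2] : [/\ 0 <= s / 2, 0 <= t / 2 & 0 <= p / 2] by split; rewrite divr_ge0 ?ltW.
    by apply: ler_pM => //; [exact: mulr_ge0|exact: ler_pM].
  apply: (@le_trans _ _ ((h ^+ 2 * (u / D ^+ 2 / 8))^-1)).
    have ud0 : 0 < u / D ^+ 2 / 8 by do 2 apply: divr_gt0 => //; exact: exprn_gt0.
    have h20 : 0 < h ^+ 2 by rewrite exprn_gt0.
    have stp0 : 0 < s' * t' * p' by lra.
    rewrite lef_pV2 ?posrE; [|exact: mulr_gt0..].
    by rewrite ler_pM2l//; lra.
  have -> : (h ^+ 2 * (u / D ^+ 2 / 8))^-1 = 8 * (D / h) ^+ 2 / u by field; rewrite !gt_eqF.
  have dh0 : 0 <= D / h by rewrite divr_ge0 ?ltW.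
  by rewrite ler_pM2r ?invr_gt0// ler_pM2l// ler_sqr ?nnegrE ?(le_trans dh0).
have H1 := one s s' s0 su ss; have H2 := one t t' t0 tu tt.
pose q := y ^+ 2 * D0; have q1 : 1 <= q by rewrite /q -[leLHS]mulr1 ler_pM ?exprn_ege1.
apply: (@le_trans _ _ ((4 * x + 8 * x ^+ 2) / u)).
  have -> : (4 * x + 8 * x ^+ 2) / u = 2 * x / u + 2 * x / u + 8 * x ^+ 2 / u by field; rewrite gt_eqF.
  lra.
apply: (@le_trans _ _ ((2 ^+ 8 * D0 ^+ 2 / mh * y ^+ 4) / u)); last first.
  rewrite ler_wpM2l ?lef_pV2 ?posrE// mulr_ge0 ?exprn_ge0//; try lra.
  by rewrite divr_ge0 ?mulr_ge0 ?exprn_ge0//; lra.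
rewrite ler_pM2r ?invr_gt0//.
have -> : 2 ^+ 8 * D0 ^+ 2 / mh * y ^+ 4 = 256 * q ^+ 2 / mh by rewrite /q; field; rewrite gt_eqF.
have -> : 4 * x + 8 * x ^+ 2 = (16 * q + 128 * q ^+ 2 / mh) / mh by rewrite /x /q; field; rewrite gt_eqF.
rewrite ler_pM2r ?invr_gt0//.
have : 128 * q ^+ 2 / mh <= 128 * q ^+ 2 by rewrite ler_pdivrMr// ler_peMr// mulr_ge0// exprn_ge0//; lra.
nra.
Qed.

(** * Lower bound for the probability of a giant component *)

Lemma truncn_grid (R : realType) (M : nat) (x : R) : (0 < M)%N -> M%:R^-1 <= x -> x <= 1 ->
  [/\ (0 < Num.truncn (M%:R * x) <= M)%N, (Num.truncn (M%:R * x))%:R / M%:R <= x &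
      x / 2 <= (Num.truncn (M%:R * x))%:R / M%:R].
Proof.
move=> M0 Mx x1; have M0' : 0 < M%:R :> R by rewrite ltr0n.
have M1 : 1 <= M%:R * x by rewrite mulrC -ler_pdivrMr ?div1r.
have x0 : 0 <= M%:R * x by exact: le_trans M1.
have tr := truncn_le (M%:R * x); rewrite x0 in tr;
have t1 : (0 < Num.truncn (M%:R * x))%N by rewrite truncn_gt_nat.
split.
- by rewrite t1 -(ler_nat R) (le_trans tr)// ler_piMr.
- by rewrite ler_pdivrMr// [leRHS]mulrC.
- rewrite ler_pdivlMr//; have -> : x / 2 * M%:R = M%:R * x / 2 by ring.
  have := truncnS_gt (M%:R * x); rewrite -natr1.
  have : 1 <= (Num.truncn (M%:R * x))%:R :> R by rewrite ler1n.
  lra.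
Qed.

Section EdgeBound.
Context {R : realType} {g : R -> R -> R} {rho : R -> R}.
Hypothesis hg : is_kernel g.
Hypothesis hrho : is_profile rho.

Lemma edge_prob_ge beta n (x y m1 m2 s t D : R) : 0 < beta -> (0 < n)%N ->
  0 < m1 -> 0 < m2 -> 0 < s < 1 -> 0 < t < 1 -> x != y ->
  (m1 <= s /\ m2 <= t) \/ (m2 <= s /\ m1 <= t) ->
  beta^-1 * n%:R * `|x - y| <= D ->
  rho (g s t * D) <= edge_prob g rho beta n x m1 y m2.
Proof.
move=> b0 n0 m10 m20 s01 t01 xy st cD.
have c0 : 0 < beta^-1 * n%:R * `|x - y|.
  by rewrite !mulr_gt0 ?invr_gt0 ?ltr0n// normr_gt0 subr_eq0.
have -> : edge_prob g rho beta n x m1 y m2 = rho (g m2 m1 * (beta^-1 * n%:R * `|x - y|)).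
  by rewrite /edge_prob; congr rho; ring.
case/andP: s01 => s0 s1; case/andP: t01 => t0 t1.
case: st => -[h1 h2]; last exact: (rho_g_antitone hg hrho).
have -> : g s t = g t s by apply: (kernel_sym hg); rewrite in_itv/= ?s0 ?t0.
exact: (rho_g_antitone hg hrho).
Qed.
End EdgeBound.

Lemma cell_dist (R : realType) (h x y c : R) (L a b : nat) : 0 < h -> (0 < L)%N ->
  (a %/ L = b %/ L)%N -> cell c h a x -> cell c h b y -> `|x - y| <= L%:R * h.
Proof.
move=> h0 L0 ab; rewrite /cell /= !in_itv/= => /andP[xa xa1] /andP[yb yb1].
have H (i j : nat) : (i %/ L = j %/ L)%N -> (i.+1 <= j + L)%N.
  by move=> ij; rewrite (divn_eq i L) (divn_eq j L) ij -addnA -addnS leq_add2l ltn_addl// ltn_mod.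
have K (i j : nat) : (i %/ L = j %/ L)%N -> i.+1%:R * h <= j%:R * h + L%:R * h.
  by move=> /H ij; rewrite -mulrDl -natrD; apply: ler_wpM2r; rewrite ?ler_nat ?ltW.
have := K a b ab; have := K b a (esym ab).
by rewrite ler_norml => *; apply/andP; split; lra.
Qed.

Section GiantBound.
Context {R : realType} {g : R -> R -> R} {rho : R -> R} {beta : R} {n : nat}.
Variable G : random_graph g rho beta n.
Hypotheses (hg : is_kernel g) (hrho : is_profile rho) (beta0 : 0 < beta) (n0 : (0 < n)%N).
Variables (B mh K Mt D0 Th : nat) (kappa s0 t0 c : R).
Hypotheses (mh0 : (0 < mh)%N) (B10 : (10 <= B)%N) (K0 : (0 < K)%N) (D00 : (0 < D0)%N) (Th0 : (0 < Th)%N).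
Hypothesis Mt4 : (4 <= Mt <= 4 * (B * 2 ^ K))%N.
Hypothesis kappa01 : 0 < kappa < 1.
Hypothesis Bk : 2 ^+ 10 <= B%:R `^ kappa :> R.
Hypothesis key : forall n, (D0 <= n)%N ->
  exists s t : R, [/\ 0 < s < 1, 0 < t < 1, n%:R `^ (kappa - 1) <= s,
      n%:R `^ (kappa - 1) <= t & n%:R `^ (kappa - 2) <= rho (g s t * n%:R) * (s * t)].
Hypotheses (s01 : 0 < s0 < 1) (t01 : 0 < t0 < 1) (Ths : Th%:R^-1 <= s0) (Tht : Th%:R^-1 <= t0).
Notation p0 := (rho (g s0 t0 * D0%:R)).
Hypothesis p0D : (D0 ^ 2)%:R^-1 <= p0.
Notation b := (branching mh B K Mt).
Notation W := (width b).
Notation ec := (@err_cst R B).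
Hypothesis mh_merge : 2 ^+ 15 * (2 ^+ 8 * D0%:R ^+ 2 / mh%:R) * B%:R ^+ 6 <= ec.
Hypothesis mh_base : (2 * mh)%:R ^+ 2 * (1 - (p0 / 2) ^+ 2) ^+ (2 * mh - 2) <= ec.
Hypothesis n_ge : 2 ^+ (2 * mh) * (1 - (2 * (W K * Th))%:R^-1) ^+ n <= ec.
Hypothesis n_le : n%:R <= beta * D0%:R * (W K)%:R.
Hypothesis c_le : c * n%:R <= (mh * W K)%:R / 2.

Let W0 k : (0 < W k)%N := width_gt0 mh0 B10 Mt4 k.
Let D k := (D0 * W k.+1)%N.
Let Mg := ((D0 * W K) ^ 2)%N.
Let Mg0 : (0 < Mg)%N. Proof. by rewrite expn_gt0 muln_gt0 D00 W0. Qed.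

Let scales : exists st : nat -> R * R, forall k, let s := (st k).1 in let t := (st k).2 in
  [/\ 0 < s < 1, 0 < t < 1, (D k)%:R `^ (kappa - 1) <= s,
      (D k)%:R `^ (kappa - 1) <= t & (D k)%:R `^ (kappa - 2) <= rho (g s t * (D k)%:R) * (s * t)].
Proof.
have H k : exists st : R * R, [/\ 0 < st.1 < 1, 0 < st.2 < 1, (D k)%:R `^ (kappa - 1) <= st.1,
      (D k)%:R `^ (kappa - 1) <= st.2 &
      (D k)%:R `^ (kappa - 2) <= rho (g st.1 st.2 * (D k)%:R) * (st.1 * st.2)].
  have [|s [t H]] := key (n := D k); first by rewrite leq_pmulr.
  by exists (s, t).
by have [f Hf] := choice H; exists f => k; exact: Hf.
Qed.

(** The model is run with [K] levels of blocks of width [W K]; the thresholds at level [k] come from the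
    dominant pair of mark scales at distance [D0 * W k.+1], discretized on a grid so fine that no
    quantity is changed by more than a factor two. *)
Lemma giant_bound : ((1 - 2 * @err R B K)%:E <= prob_giant G c)%E.
Proof.
have [st stP] := scales.
pose s k := (st k).1; pose t k := (st k).2; pose p k := rho (g (s k) (t k) * (D k)%:R).
have Dgt0 k : (0 < D k)%N by rewrite muln_gt0 D00 W0.
have Dr0 k : 0 < (D k)%:R :> R by rewrite ltr0n.
have Dr1 k : 1 <= (D k)%:R :> R by rewrite ler1n.
have [k0 k1] := andP kappa01.
have p01 k : 0 <= p k <= 1 by have [a1 a2 _ _ _] := stP k; apply: (rho_g01 hg hrho).
have Dinv k : (k < K)%N -> Mg%:R^-1 <= (D k)%:R ^- 2 :> R.
  move=> kK; rewrite lef_pV2 ?posrE ?exprn_gt0 ?ltr0n//.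
  rewrite -natrX ler_nat leq_sqr leq_mul2l.
  by rewrite (width_mono mh0 B10 Mt4 kK) orbT.
have Dpow k (e : R) : - 2 <= e -> (D k)%:R ^- 2 <= (D k)%:R `^ e.
  by move=> e2; rewrite -(powR_invn 2 (ltW (Dr0 k))); apply: ler_powR.
have sM k : (k < K)%N -> Mg%:R^-1 <= s k.
  move=> kK; have [_ _ + _ _] := stP k; apply: le_trans; apply: le_trans (Dinv k kK) _.
  by apply: Dpow; lra.
have tM k : (k < K)%N -> Mg%:R^-1 <= t k.
  move=> kK; have [_ _ _ + _] := stP k; apply: le_trans; apply: le_trans (Dinv k kK) _.
  by apply: Dpow; lra.
have st1 k : 0 <= s k * t k <= 1.
  have [/andP[s_0 s_1] /andP[t_0 t_1] _ _ _] := stP k.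
  by rewrite mulr_ge0 ?mulr_ile1 ?ltW.
have pM k : (k < K)%N -> Mg%:R^-1 <= p k.
  move=> kK; have [_ _ _ _ H] := stP k; apply: le_trans (Dinv k kK) _.
  apply: (@le_trans _ _ ((D k)%:R `^ (kappa - 2))); first by apply: Dpow; lra.
  apply: le_trans H _; rewrite -/(p k) -[leRHS]mulr1; apply: ler_wpM2l; first by case/andP: (p01 k).
  by case/andP: (st1 k).
have p001 : 0 <= p0 <= 1 by apply: (rho_g01 hg hrho) => //; rewrite ltr0n.
have base_grid : (Mg%:R^-1 : R) <= p0.
  apply: le_trans p0D; rewrite lef_pV2 ?posrE ?ltr0n ?Mg0 ?expn_gt0 ?D00//.
  by rewrite ler_nat leq_sqr leq_pmulr.
pose fl (x : R) := Num.truncn (Mg%:R * x).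
pose thr (sg : {ffun 'I_n -> 'I_(W K) * 'I_Th}) (v w : 'I_n) (i j : 'I_Mg) : nat :=
  if useful sg v && useful sg w then
    maxn (if val (sg v).1 == val (sg w).1 then fl p0 else 0%N)
     (\max_(k < K | (val (sg v).1 %/ W k.+1 == val (sg w).1 %/ W k.+1)%N &&
       ((i < fl (s k)) && (j < fl (t k)) || (j < fl (s k)) && (i < fl (t k)))%N) fl (p k))
  else 0%N.
have thrC sg v w i j : thr sg v w i j = thr sg w v j i.
  rewrite /thr andbC eq_sym; case: ifP => // _; congr maxn; apply: eq_bigl => k.
  by congr andb; [exact: eq_sym | exact: orbC].
have flP (x : R) : Mg%:R^-1 <= x -> x <= 1 -> [/\ (0 < fl x <= Mg)%N, (fl x)%:R / Mg%:R <= x &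
      x / 2 <= (fl x)%:R / Mg%:R] by exact: truncn_grid.
have s1 k : s k <= 1 by have [/andP[_ /ltW]] := stP k.
have t1 k : t k <= 1 by have [_ /andP[_ /ltW]] := stP k.
have thrM sg v w i j : (thr sg v w i j <= Mg)%N.
  rewrite /thr; case: ifP => // _; rewrite geq_max; apply/andP; split.
    by case: ifP => // _; have [|/andP[]] := flP p0 base_grid; first by case/andP: p001.
  apply/bigmax_leqP => k _; have [|/andP[]] := flP (p k) (pM k (ltn_ord k)) => //.
  by case/andP: (p01 k).
pose V (e : rel 'I_n) := c * n%:R <= (largest_component e)%:R.
have Vmono (e e' : rel 'I_n) : (forall v w, e v w -> e' v w) -> V e -> V e'.
  move=> ee; rewrite /V => H; apply: (le_trans H); rewrite ler_nat; apply/bigmax_leqP => i _.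
  apply: (@leq_trans #|connect e' i|).
    by apply/subset_leq_card/fintype.subsetP => j; apply: connect_sub => v w /ee; exact: connect1.
  exact: leq_bigmax.
have thr_ok sg mu (v u : 'I_n) w : (v < u)%N -> atom (G := G) sg mu w -> ~ rare_set (G := G) w ->
  (thr sg v u (mu v) (mu u))%:R / Mg%:R <=
    edge_prob g rho beta n (rg_loc G v w) (rg_mark G v w) (rg_loc G u w) (rg_mark G u w).
  move=> vu aw nr; have vu' : v != u by rewrite -val_eqE/= ltn_eqF.
  have [xy /andP[v0 v1] /andP[u0 u1]] := not_rare vu' nr.
  have [xv mv] := aw v; have [xu mu_] := aw u.
  have Th0' : 0 < Th%:R :> R by rewrite ltr0n.
  have Mg0' : 0 < Mg%:R :> R by rewrite ltr0n.
  set ep := edge_prob _ _ _ _ _ _ _ _.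
  have ep0 : 0 <= ep by case/andP: (edge_prob01 hg hrho beta0 n0 vu' nr).
  rewrite /thr; case: ifP => [/andP[/eqP uv /eqP uu]|_]; last by rewrite mul0r.
  rewrite ler_pdivrMr//; have E0 : 0 <= ep * Mg%:R by rewrite mulr_ge0.
  have tr N : N%:R <= ep * Mg%:R -> (N <= Num.truncn (ep * Mg%:R))%N by rewrite truncn_ge_nat.
  have := truncn_le (ep * Mg%:R); rewrite E0; apply: le_trans; rewrite ler_nat geq_max.
  have dist L : (0 < L)%N -> (val (sg v).1 %/ L = val (sg u).1 %/ L)%N ->
      beta^-1 * n%:R * `|rg_loc G v w - rg_loc G u w| <= D0%:R * L%:R.
    move=> L0 vL; have W0' : 0 < (W K)%:R :> R by rewrite ltr0n.
    have h0 : 0 < (W K)%:R^-1 :> R by rewrite invr_gt0.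
    have := cell_dist h0 L0 vL xv xu => dL.
    apply: (@le_trans _ _ (beta^-1 * (beta * D0%:R * (W K)%:R) * (L%:R * (W K)%:R^-1))).
      by apply: ler_pM => //; rewrite ?mulr_ge0 ?invr_ge0 ?ler_wpM2l ?invr_ge0// ltW.
    by apply: eq_ler; field; rewrite !gt_eqF.
  have cell0 (i : nat) (m : R) : cell (0%N%:R / Th%:R) (Th * Mg)%:R^-1 i m -> m <= i.+1%:R / Mg%:R / Th%:R.
    rewrite /cell /= in_itv/= mul0r add0r => /andP[_ mi]; apply: le_trans mi _.
    by rewrite [(Th * Mg)%:R]natrM; apply: eq_ler; field; rewrite !gt_eqF.
  have div_Th (x : R) : 0 <= x -> x / Th%:R <= x.
    by move=> x0; rewrite ler_pdivrMr// ler_peMr// ler1n.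
  have markS (i : nat) (m x : R) : Mg%:R^-1 <= x -> x <= 1 ->
      cell (0%N%:R / Th%:R) (Th * Mg)%:R^-1 i m -> (i < fl x)%N -> m <= x.
    move=> xM x1 /cell0 mi ix; have [_ fx _] := flP x xM x1.
    apply: le_trans mi _; apply: le_trans (div_Th _ _) _; first by rewrite divr_ge0.
    by apply: le_trans fx; rewrite ler_wpM2r ?invr_ge0// ler_nat.
  have mark1 (i : 'I_Mg) (m : R) : cell (0%N%:R / Th%:R) (Th * Mg)%:R^-1 i m -> m <= Th%:R^-1.
    move=> /cell0 mi; apply: le_trans mi _; rewrite ler_pdivrMr// mulVf ?gt_eqF//.
    by rewrite ler_pdivrMr// mul1r ler_nat.
  rewrite uv in mv; rewrite uu in mu_.
  apply/andP; split.
    case: ifP => [/eqP same|_] //; apply: tr; rewrite -ler_pdivrMr//.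
    have [|_ + _] := flP p0 base_grid; first by case/andP: p001.
    move=> /le_trans; apply; apply: edge_prob_ge => //.
      by left; split; [apply: le_trans Ths|apply: le_trans Tht]; apply: mark1; [exact: mv|exact: mu_].
    by have := dist 1%N isT; rewrite !divn1 mulr1; apply.
  apply/bigmax_leqP => k /andP[/eqP same ij]; apply: tr; rewrite -ler_pdivrMr//.
  have kK := ltn_ord k.
  have [|_ + _] := flP (p k) (pM k kK); first by case/andP: (p01 k).
  move=> /le_trans; apply; have [a1 a2 _ _ _] := stP k; apply: edge_prob_ge => //.
    case/orP: ij => /andP[i1 i2]; [left|right]; split.
    - exact: markS (sM k kK) (s1 k) mv i1.
    - exact: markS (tM k kK) (t1 k) mu_ i2.
    - exact: markS (sM k kK) (s1 k) mu_ i1.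
    - exact: markS (tM k kK) (t1 k) mv i2.
  by rewrite natrM; apply: dist.
have H := transfer (G := G) hg hrho beta0 n0 (W0 K) Th0 Mg0 thrC thrM thr_ok Vmono.
apply: le_trans H; rewrite lee_fin.
have ntK := ntot_ge (R := R) mh0 B10 K0 Mt4.
apply: (@le_trans _ _ (Ex unif (fun sg => Pr unif (fun f =>
    [exists x, ntot b K <= #|connect (model_graph thr sg f) x|]%N)))).
  have -> : 2 * err B K = err B K + err B K :> R by lra.
  have B0 : (0 < B)%N by exact: leq_trans B10.
  have br_pos k : 1 <= (br B k)%:R :> R by rewrite ler1n (leq_trans _ (br10 B10 k)).
  have mhr : 1 <= mh%:R :> R by rewrite ler1n.
  have D0r : 1 <= D0%:R :> R by rewrite ler1n.
  pose X0 : R := 2 ^+ 8 * D0%:R ^+ 2 / mh%:R.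
  have merge0 k : 0 <= merge_err B X0 k.
    have z0 : 0 <= (2 ^+ 10) ^+ k :> R by do 2 apply: exprn_ge0.
    have x0 : 0 <= X0.
      by apply: divr_ge0; [apply: mulr_ge0; exact: exprn_ge0 | exact: ler0n].
    by apply: divr_ge0 => //; apply: mulr_ge0 => //; exact: exprn_ge0.
  have base sg (v w : 'I_n) i j : useful sg v -> useful sg w ->
      val (sg v).1 = val (sg w).1 -> (fl p0 <= thr sg v w i j)%N.
    by move=> uv uw e; rewrite /thr uv uw e eqxx leq_maxl.
  have merge k sg (v w : 'I_n) (i j : 'I_Mg) : (k < K)%N -> useful sg v -> useful sg w ->
      (val (sg v).1 %/ W k.+1 = val (sg w).1 %/ W k.+1)%N ->
      (i < fl (s k))%N -> (j < fl (t k))%N -> (fl (p k) <= thr sg v w i j)%N.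
    move=> kK uv uw e i1 i2; rewrite /thr uv uw leq_max; apply/orP; right.
    by apply: (bigop.bigmax_sup (Ordinal kK)) => //=; rewrite e eqxx i1 i2.
  have range k : (k < K)%N -> [/\ (0 < fl (s k) <= Mg)%N, (0 < fl (t k) <= Mg)%N & (0 < fl (p k) <= Mg)%N].
    move=> kK; split; first by case: (flP (s k) (sM k kK) (s1 k)).
      by case: (flP (t k) (tM k kK) (t1 k)).
    by case: (flP (p k) (pM k kK)) => //; case/andP: (p01 k).
  have mergeb k : (k < K)%N ->
    ((nclass b (spare mh) k)%:R * ((fl (s k))%:R / Mg%:R))^-1 + ((nclass b (spare mh) k)%:R * ((fl (t k))%:R / Mg%:R))^-1
     + ((nclass b (spare mh) k)%:R ^+ 2 * ((fl (s k))%:R / Mg%:R * ((fl (t k))%:R / Mg%:R) * ((fl (p k))%:R / Mg%:R)))^-1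
    <= merge_err B X0 k.
    move=> kK; have [/andP[s_0 _] /andP[t_0 _] sD tD stD] := stP k.
    have Mi0 : 0 < Mg%:R^-1 :> R by rewrite invr_gt0 ltr0n.
    have [_ _ ss] := flP (s k) (sM k kK) (s1 k).
    have [_ _ tt] := flP (t k) (tM k kK) (t1 k).
    have [|_ _ pp] := flP (p k) (pM k kK); first by case/andP: (p01 k).
    have Dn0 : (D k)%:R != 0 :> R by rewrite gt_eqF.
    have powB (a : nat) : (D k)%:R `^ (kappa - a%:R) = (D k)%:R `^ kappa / (D k)%:R ^+ a.
      by rewrite powRB ?Dn0 ?implybT// powR_mulrn// ltW.
    have v0 : 0 < (2 ^+ 10) ^+ k :> R by do 2 apply: exprn_gt0.
    apply: (merge_bound (D := (D k)%:R) (v := (2 ^+ 10) ^+ k) (u := (D k)%:R `^ kappa) (s := s k) (t := t k) (p := p k)) => //.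
    - by rewrite ltr0n (nclass_gt0 (R := R) mh0 B10 Mt4).
    - apply: (@le_trans _ _ ((B ^ k)%:R `^ kappa)).
        rewrite natrX -powR_mulrn// -powRrM mulrC powRrM powR_mulrn ?powR_ge0//.
        by rewrite lerXn2r// nnegrE ?exprn_ge0// powR_ge0.
      apply: ge0_ler_powR; rewrite ?nnegrE ?ler0n ?(ltW k0)// ler_nat.
      apply: leq_trans (width_ge mh0 B10 Mt4 kK) _.
      by rewrite (leq_trans (width_mono mh0 B10 Mt4 (leqnSn k)))// leq_pmull.
    - have := nclass_ge (R := R) mh B10 Mt4 kK; rewrite natrM => H.
      by rewrite /D [(D0 * _)%:R]natrM [leLHS]mulrCA [leLHS]mulrC ler_wpM2r// (le_trans _ D0r).
    - by have := sD; rewrite (powB 1%N) expr1.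
    - by have := tD; rewrite (powB 1%N) expr1.
    - by have := stD; rewrite (powB 2%N) [leRHS]mulrC.
    - by apply: lt_le_trans (pM k kK).
  have basee : (fl p0 <= Mg)%N /\
      (b 0 ^ 2)%:R * (1 - ((fl p0)%:R / Mg%:R) ^+ 2) ^+ (b 0 - 2) <= err B 0 :> R.
    have [|/andP[_ fM] f1 f2] := flP p0 base_grid; first by case/andP: p001.
    have /andP[p_0 p_1] := p001.
    split => //; rewrite /err expr0 divr1; apply: le_trans mh_base; rewrite natrX ler_wpM2l ?exprn_ge0//.
    have p20 : 0 <= p0 / 2 by rewrite divr_ge0.
    have f0 : 0 <= (fl p0)%:R / Mg%:R :> R by rewrite divr_ge0.
    have h1 : ((fl p0)%:R / Mg%:R) ^+ 2 <= 1 :> R by rewrite exprn_ile1// (le_trans f1).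
    have h2 : (p0 / 2) ^+ 2 <= ((fl p0)%:R / Mg%:R) ^+ 2 :> R by rewrite lerXn2r// nnegrE.
    have h3 := le_trans h2 h1.
    by apply: lerXn2r; rewrite ?nnegrE ?subr_ge0// lerB.
  have errSS k : (k < K)%N -> (b k.+1)%:R ^+ 2 * (err B k ^+ 2 + merge_err B X0 k) <= err B k.+1 :> R.
    move=> kK; apply: errS => //; first exact: branching_le Mt4 k.
    exact: merge_err_le.
  have errSr k : (b k.+1)%:R ^+ 2 * err B k ^+ 2 <= err B k.+1 :> R.
    have := @errS R B B0 0 (b k.+1) k; rewrite addr0 mulr0; apply => //; first exact: branching_le Mt4 k.
    by rewrite divr_ge0// ltW// err_gt0.
  have rb : 2 ^+ b 0 * (1 - (2 * (W K * Th))%:R^-1) ^+ n <= err B 0 :> R by rewrite /err expr0 divr1.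
  have b3 k : (k < K)%N -> (3 <= b k.+1)%N.
    by move=> _; exact: ltnW (branching_ge4 mh B10 Mt4 k).
  apply: (giant_in_model thrC (W0 K) Th0 Mg0 (branching_gt0 mh0 B10 Mt4) _ _ base merge b3 range
    (nclass_gt0 (R := R) mh0 B10 Mt4) mergeb basee errSS _ rb errSr (leqnn _)) => //.
  - by rewrite /branching /spare/= leq_pmull.
  - by rewrite ltW// err_gt0.
apply: le_Ex; first by apply: unif_weight; rewrite card_prod !card_ord muln_gt0 W0.
move=> sg; apply: le_Pr; first by apply: unif_weight; rewrite card_ord.
move=> f /existsP[x xP]; rewrite /V; apply: le_trans c_le _; apply: le_trans ntK _.
by rewrite ler_nat (leq_trans xP)// /largest_component; exact: leq_bigmax.
Qed.
End GiantBound.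

(** * Convergence of probabilities *)

Section GraphEvents.
Context {R : realType} {g : R -> R -> R} {rho : R -> R} {beta : R} {n : nat}.
Variable G : random_graph g rho beta n.

Lemma measurable_giant (c : R) :
  measurable [set w | c * n%:R <= (largest_component (rg_adj G w))%:R].
Proof.
rewrite [X in measurable X](_ : _ = config_event (G := G)
  (fun f => c * n%:R <= (largest_component (graph_of f))%:R)); first exact: config_event_measurable.
have E w : largest_component (rg_adj G w) = largest_component (graph_of (config (G := G) w)).
  by apply: eq_bigr => i _; apply: eq_card => j; apply: (eq_connect (adj_graph_of w)).
by apply/seteqP; split => w; rewrite /config_event /= E.
Qed.

Lemma prob_giant01 (c : R) : (0 <= prob_giant G c <= 1)%E.
Proof. by rewrite measure_ge0 probability_le1//; exact: measurable_giant. Qed.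
End GraphEvents.

Section Limits.
Context {R : realType}.

Lemma cvge_unit (u : nat -> \bar R) (l : R) : (forall n, 0 <= u n <= 1)%E ->
  (forall e : R, 0 < e -> exists N, forall n, (N <= n)%N -> `|l - fine (u n)| <= e) ->
  u n @[n --> \oo] --> l%:E.
Proof.
move=> u01 H; have uE n : (fine (u n))%:E = u n.
  by rewrite fineK// ge0_fin_numE; case/andP: (u01 n) => // _ /le_lt_trans; apply; exact: ltry.
rewrite -(_ : (fun n => (fine (u n))%:E) = u); last by apply/funext.
apply: cvg_EFin; first exact: nearW.
rewrite /comp /=; apply/cvgrPdist_le => e e0; have [N HN] := H e e0.
by exists N => // n /= Nn; exact: HN.
Qed.

Lemma decay_exp (x : R) n : x <= 1 -> (1 - x) ^+ n <= expR (- (x * n%:R)).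
Proof.
move=> x1; rewrite -mulNr expRM_natr.
apply: lerXn2r; rewrite ?nnegrE ?expR_ge0 ?subr_ge0//.
exact: expR_ge1Dx.
Qed.

Lemma exp_inv (z : R) : 0 < z -> expR (- z) <= z^-1.
Proof.
move=> z0; rewrite expRN lef_pV2 ?posrE ?expR_gt0//.
by apply: le_trans (expR_ge1Dx z); rewrite lerDr.
Qed.

(** The base blocks must be so large that all pairs of vertices have a common neighbour; a polynomial
    factor is beaten by an exponential one, here through its eighth power. *)
Lemma exists_dense (q c m0 : R) : 0 < q -> q <= 1 -> 0 < c ->
  exists m : nat, [/\ (0 < m)%N, m0 <= m%:R & (2 * m)%:R ^+ 2 * (1 - q) ^+ (2 * m - 2) <= c].
Proof.
move=> q0 q1 c0.
pose i := (Num.truncn (Num.max m0 (100 / (q ^+ 8 * c)))).+1.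
have iE : Num.max m0 (100 / (q ^+ 8 * c)) <= i%:R by rewrite ltW// truncnS_gt.
move: iE; rewrite ge_max => /andP[im ic].
exists (4 * i).+1; split => //.
  by apply: (le_trans im); rewrite ler_nat; lia.
have -> : (2 * (4 * i).+1 - 2 = i * 8)%N by lia.
have i1 : 1 <= i%:R :> R by rewrite ler1n.
have i0 : 0 < i%:R :> R by rewrite ltr0n.
have H : (1 - q) ^+ i <= (q * i%:R)^-1.
  by apply: le_trans (decay_exp i q1) _; apply: exp_inv; exact: mulr_gt0.
rewrite exprM; apply: (@le_trans _ _ ((10 * i%:R) ^+ 2 * (q * i%:R)^-1 ^+ 8)).
  have A : (2 * (4 * i).+1)%:R ^+ 2 <= (10 * i%:R) ^+ 2 :> R.
    by apply: lerXn2r; rewrite ?nnegrE// -?natrM ?ler0n// ler_nat; lia.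
  have Bq : (1 - q) ^+ i ^+ 8 <= (q * i%:R)^-1 ^+ 8.
    by apply: lerXn2r; rewrite ?nnegrE ?exprn_ge0 ?subr_ge0// invr_ge0 mulr_ge0// ltW.
  by apply: ler_pM => //; do ?apply: exprn_ge0; rewrite ?subr_ge0.
have q8 : 0 < q ^+ 8 by rewrite exprn_gt0.
have -> : (10 * i%:R) ^+ 2 * (q * i%:R)^-1 ^+ 8 = 100 / (q ^+ 8 * i%:R) / i%:R ^+ 5.
  by field; rewrite !gt_eqF.
have i5 : 1 <= i%:R ^+ 5 :> R by rewrite exprn_ege1.
rewrite ler_pdivrMr ?(lt_le_trans ltr01)//.
apply: (@le_trans _ _ c); last by rewrite ler_peMr// ltW.
rewrite ler_pdivrMr ?mulr_gt0//; move: ic; rewrite ler_pdivrMr ?mulr_gt0//.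
by move=> /le_trans; apply; apply: eq_ler; ring.
Qed.
End Limits.

(** * The supercritical case *)

Lemma three_quarters (a b c : nat) : (c < a + b)%N -> (4 * a <= c)%N -> (3 * c <= 4 * b)%N.
Proof. lia. Qed.

Section Supercritical.
Context {R : realType} {g : R -> R -> R} {rho : R -> R}.
Hypotheses (hg : is_kernel g) (hrho : is_profile rho).

(* the width of the blocks of a hierarchy that grows by the factors [br B k] *)
Let w B k : nat := \prod_(j < k) br B j.+1.

Let wS B k : w B k.+1 = (w B k * br B k.+1)%N. Proof. by rewrite /w big_ord_recr. Qed.

Let w_ge B k : (10 <= B)%N -> (k < w B k)%N.
Proof.
move=> B10; elim: k => [|k IH]; first by rewrite /w big_ord0.
rewrite wS; have := br10 B10 k.+1; nia.
Qed.

Let w_mono B : (10 <= B)%N -> {homo w B : j k / (j <= k)%N}.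
Proof.
move=> B10; apply: homo_leq => //; first exact: leq_trans.
by move=> k; rewrite wS leq_pmulr// (leq_trans _ (br10 B10 _)).
Qed.

Let width_w mh B K Mt k : (k < K)%N -> width (branching mh B K Mt) k = w B k.
Proof.
move=> kK; apply: eq_bigr => i _; rewrite branching_br//.
exact: leq_ltn_trans (ltn_ord i) kK.
Qed.

Let level B (Y k0 : nat) : (10 <= B)%N -> (4 * w B k0 <= Y)%N ->
  exists k, [/\ (k0 <= k)%N, (4 * w B k <= Y)%N & (Y < 4 * w B k.+1)%N].
Proof.
move=> B10 H0; pose P k := (4 * w B k <= Y)%N.
have ub k : P k -> (k <= Y)%N by rewrite /P; have := w_ge k B10; lia.
have ex : exists k, P k by exists k0.
exists (ex_maxn ex ub); case: ex_maxnP => k Pk kmax; split => //; first exact: kmax.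
by rewrite ltnNge; apply/negP => /kmax; rewrite ltnn.
Qed.

(** The branching numbers grow geometrically, so that the blocks keep a fixed proportion of their
    vertices; the last branching number is adapted to [n]. *)
Lemma supercritical :
  ((- lim (limn_einf (log_ratio g rho mu) @[mu --> 0^'+]) < (2%R)%:E)%E ->
    exists2 beta0 : R, 0 < beta0 &
    forall beta : R, beta0 <= beta ->
    exists2 c : R, 0 < c &
    forall G : forall n : nat, random_graph g rho beta n,
      prob_giant (G n) c @[n --> \oo] --> 1%E).
Proof.
move=> /(dominant_scale hg hrho)[kappa [N [k0 k1 key0]]].
pose D0 := maxn N 1.
have D00 : (0 < D0)%N by rewrite /D0 leq_max orbT.
have D0r : 0 < D0%:R :> R by rewrite ltr0n.
have D01 : 1 <= D0%:R :> R by rewrite ler1n.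
have key n : (D0 <= n)%N -> exists s t : R, [/\ 0 < s < 1, 0 < t < 1, n%:R `^ (kappa - 1) <= s,
      n%:R `^ (kappa - 1) <= t & n%:R `^ (kappa - 2) <= rho (g s t * n%:R) * (s * t)].
  by rewrite geq_max => /andP[/key0].
have [s0 [t0 [s01 t01 _ _ p0D']]] := key D0 (leqnn _).
set p0 := rho (g s0 t0 * D0%:R) in p0D'.
have [/andP[s00 s0_1] /andP[t00 t0_1]] := (s01, t01).
have p001 : 0 <= p0 <= 1 by apply: (rho_g01 hg hrho).
have /andP[p00 p0_1] := p001.
have p0D : (D0 ^ 2)%:R^-1 <= p0.
  apply: (@le_trans _ _ (D0%:R `^ (kappa - 2))).
    rewrite natrX -(powR_invn 2 (ltW D0r)); apply: ler_powR => //; lra.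
  apply: (le_trans p0D'); rewrite -[leRHS]mulr1; apply: ler_wpM2l => //.
  by rewrite mulr_ile1 ?ltW.
have p0pos : 0 < p0 by apply: lt_le_trans p0D; rewrite invr_gt0 ltr0n expn_gt0 D00.
pose Th := (Num.truncn (Num.max s0^-1 t0^-1)).+1.
have Th0 : (0 < Th)%N by [].
have ThE : Num.max s0^-1 t0^-1 <= Th%:R by rewrite ltW// truncnS_gt.
have Thr : 0 < Th%:R :> R by rewrite ltr0n.
have [Ths Tht] : Th%:R^-1 <= s0 /\ Th%:R^-1 <= t0.
  move: ThE; rewrite ge_max => /andP[h1 h2].
  by split; rewrite -[leRHS]invrK lef_pV2 ?posrE ?invr_gt0.
pose B := maxn 10 (Num.truncn (((2 : R) ^+ 10) `^ kappa^-1)).+1.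
have B10 : (10 <= B)%N by rewrite leq_maxl.
have Bk : 2 ^+ 10 <= B%:R `^ kappa :> R.
  have two0 : 0 <= (2 : R) ^+ 10 by exact: exprn_ge0.
  have -> : 2 ^+ 10 = ((2 ^+ 10) `^ kappa^-1) `^ kappa :> R.
    by rewrite -powRrM mulVf ?gt_eqF// powRr1.
  apply: ge0_ler_powR; rewrite ?nnegrE ?powR_ge0 ?ler0n ?(ltW k0)//.
  by apply: ltW; apply: (lt_le_trans (truncnS_gt _)); rewrite ler_nat leq_maxr.
have B0 : 0 < B%:R :> R by rewrite ltr0n (leq_trans _ B10).
set ec := @err_cst R B.
have ec0 : 0 < ec by rewrite invr_gt0 mulr_gt0// exprn_gt0.
have q0 : 0 < (p0 / 2) ^+ 2 by rewrite exprn_gt0// divr_gt0.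
have q1 : (p0 / 2) ^+ 2 <= 1 by rewrite exprn_ile1//; lra.
have [mh [mh0 mhC mh_base]] :=
  exists_dense (2 ^+ 15 * (2 ^+ 8 * D0%:R ^+ 2) * B%:R ^+ 6 / ec) q0 q1 ec0.
have mhr : 0 < mh%:R :> R by rewrite ltr0n.
have mh_merge : 2 ^+ 15 * (2 ^+ 8 * D0%:R ^+ 2 / mh%:R) * B%:R ^+ 6 <= ec.
  move: mhC; rewrite ler_pdivrMr// [mh%:R * _]mulrC -ler_pdivrMr// => H.
  by apply: (le_trans _ H); apply: eq_ler; field; rewrite gt_eqF.
pose A : R := 2 * Th%:R * (2 ^+ (2 * mh) / ec).
have T0 : 0 < 2 ^+ (2 * mh) / ec by apply: divr_gt0 => //; exact: exprn_gt0.
have A0 : 0 < A by apply: mulr_gt0 => //; exact: mulr_gt0.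
exists (2 * A / D0%:R); first by apply: divr_gt0 => //; exact: mulr_gt0.
move=> beta bA; pose Ab := beta * D0%:R / 2.
have AAb : A <= Ab.
  by move: bA; rewrite ler_pdivrMr// /Ab => ?; rewrite ler_pdivlMr// mulrC.
have Ab0 : 0 < Ab by exact: lt_le_trans AAb.
have beta0 : 0 < beta by apply: lt_le_trans bA; apply: divr_gt0 => //; exact: mulr_gt0.
pose c := mh%:R / (4 * Ab).
have c0 : 0 < c by apply: divr_gt0 => //; exact: mulr_gt0.
exists c => // G.
apply: cvge_unit => [n|e e0]; first exact: prob_giant01.
pose k0' := (Num.truncn (2 * ec / e)).+1.
exists (Num.truncn (Ab * (4 * w B k0')%:R)).+1 => n nN.
have nbig : Ab * (4 * w B k0')%:R <= n%:R.
  by apply: ltW; apply: lt_le_trans (truncnS_gt _) _; rewrite ler_nat.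
have n0 : (0 < n)%N by exact: leq_trans nN.
pose Y := Num.truncn (n%:R / Ab).
have nA0 : 0 <= n%:R / Ab by apply: divr_ge0 => //; exact: ltW.
have Yk : (4 * w B k0' <= Y)%N.
  by rewrite truncn_ge_nat// ler_pdivlMr// mulrC.
have [k [kk Ylo Yhi]] := level B10 Yk.
pose K := k.+1; pose Mt := (Y %/ w B k)%N.
have wk0 : (0 < w B k)%N by exact: leq_ltn_trans (leq0n k) (w_ge k B10).
have Mt4 : (4 <= Mt <= 4 * (B * 2 ^ K))%N.
  rewrite leq_divRL// Ylo /= ltnW// ltn_divLR//.
  by apply: (leq_trans Yhi); rewrite wS (mulnC (w B k)) mulnA; exact: leqnn.
have WE : width (branching mh B K Mt) K = (Mt * w B k)%N.
  by rewrite widthS (@width_w mh B K Mt k (ltnSn k)) /branching/= eqxx mulnC.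
have WY : (Mt * w B k <= Y)%N by exact: leq_trunc_div.
have YW : (3 * Y <= 4 * (Mt * w B k))%N.
  by apply: (@three_quarters (w B k)) => //; have := ltn_ceil Y wk0; rewrite -/Mt mulSn.
have W0 : (0 < Mt * w B k)%N by case/andP: Mt4 => M4 _; rewrite muln_gt0 wk0 andbT (leq_trans _ M4).
have Y4 : (4 <= Y)%N by apply: leq_trans Ylo; rewrite leq_pmulr.
have YleA : Y%:R <= n%:R / Ab by have := truncn_le (n%:R / Ab); rewrite nA0.
have AltY : n%:R / Ab < Y%:R + 1 by rewrite natr1 truncnS_gt.
have [W1 W2] : Ab * (Mt * w B k)%:R <= n%:R /\ n%:R <= 2 * Ab * (Mt * w B k)%:R.
  have h1 : (Mt * w B k)%:R <= Y%:R :> R by rewrite ler_nat.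
  have h2 : 3 * Y%:R <= 4 * (Mt * w B k)%:R :> R by rewrite -!natrM ler_nat.
  have h3 : 4 <= Y%:R :> R by rewrite ler_nat.
  split; first by rewrite mulrC -ler_pdivlMr//; lra.
  by rewrite -mulrA mulrCA mulrC -ler_pdivrMr//; lra.
have Wr : 0 < (Mt * w B k)%:R :> R by rewrite ltr0n.
have := @giant_bound R g rho beta n (G n) hg hrho beta0 n0 B mh K Mt D0 Th kappa s0 t0 c mh0 B10 isT
  D00 Th0 Mt4.
rewrite k0 k1 WE => /(_ isT Bk key s01 t01 Ths Tht p0D mh_merge mh_base) HG.
have {HG} : ((1 - 2 * err B K)%:E <= prob_giant (G n) c)%E.
  apply: HG.
  - set z := (2 * _)%:R; have z0 : 0 < z by rewrite ltr0n muln_gt0 /= muln_gt0 W0 Th0.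
    have z1 : z^-1 <= 1 by rewrite invf_le1// ler1n muln_gt0 /= muln_gt0 W0 Th0.
    apply: (@le_trans _ _ (2 ^+ (2 * mh) * expR (- (z^-1 * n%:R)))).
      by rewrite ler_wpM2l ?exprn_ge0// decay_exp.
    have n0r : 0 < z^-1 * n%:R by apply: mulr_gt0; [rewrite invr_gt0|rewrite ltr0n].
    apply: (@le_trans _ _ (2 ^+ (2 * mh) * (z^-1 * n%:R)^-1)).
      by rewrite ler_wpM2l ?exprn_ge0// exp_inv.
    rewrite ler_pdivrMr// [ec * _]mulrC -ler_pdivrMr//.
    have zE : z = 2 * (Mt * w B k)%:R * Th%:R by rewrite /z -!natrM mulnA.
    apply: (@le_trans _ _ (A * (Mt * w B k)%:R / z)).
      have alg (p u v : R) : u != 0 -> v != 0 -> p = 2 * v * p * u / (2 * u * v).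
        by move=> u0 v0; field; rewrite ?u0 ?v0.
      by rewrite /A zE; apply: eq_ler; apply: alg; rewrite gt_eqF.
    rewrite [leRHS]mulrC; apply: ler_wpM2r; first by rewrite invr_ge0 ltW.
    by apply: (le_trans _ W1); apply: ler_wpM2r => //; exact: ltW.
  - by apply: (le_trans W2); apply: eq_ler; rewrite /Ab; field.
  - rewrite /c natrM.
    have -> : mh%:R / (4 * Ab) * n%:R = n%:R * (mh%:R / (4 * Ab)) by rewrite mulrC.
    apply: (@le_trans _ _ (2 * Ab * (Mt * w B k)%:R * (mh%:R / (4 * Ab)))).
      by apply: ler_wpM2r => //; exact: ltW.
    by apply: eq_ler; field; rewrite gt_eqF.
have /andP[] := prob_giant01 (G n) c.
case: (prob_giant (G n) c) => [r| |] //=; rewrite !lee_fin => _ r1 rlo.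
rewrite ger0_norm ?subr_ge0//.
suff : 2 * err B K <= e by lra.
have p16 : 0 < (16 : R) ^+ K by exact: exprn_gt0.
rewrite /err -/ec mulrA ler_pdivrMr// [e * _]mulrC -ler_pdivrMr//.
apply: (@le_trans _ _ k0'%:R); first by apply: ltW; exact: truncnS_gt.
apply: (@le_trans _ _ (K)%:R); first by rewrite ler_nat /K leqW.
rewrite -natrX ler_nat ltnW//; exact: ltn_expl.
Qed.
End Supercritical.

(** * Indicator sums and the number of gaps *)

Section IndicatorSums.
Context d (T : measurableType d) (R : realType) (mu : probability T R).

Lemma integral_indic_sum (I : finType) (F : I -> R) (C : I -> set T) :
  (forall i, 0 <= F i) -> (forall i, measurable (C i)) ->
  (\int[mu]_x (\sum_i (F i)%:E * (\1_(C i) x)%:E) = \sum_i (F i)%:E * mu (C i))%E.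
Proof.
move=> F0 mC.
have mI i : measurable_fun setT (fun x => (\1_(C i) x : R)%:E).
  by apply/measurable_EFinP; apply: measurable_indic.
rewrite ge0_integral_sum//.
- apply: eq_bigr => i _; rewrite (ge0_integralZl mu measurableT (mI i)) ?lee_fin//.
  by rewrite (integral_indic mu measurableT (mC i)) setIT.
- by move=> i; apply: (measurable_funeM (F i)%:E (mI i)).
- by move=> i x _; rewrite mule_ge0 ?lee_fin.
Qed.

(** Linear inequalities between indicator functions pass to probabilities. *)
Lemma indic_sum_le (I J : finType) (F : I -> R) (A : I -> set T) (H : J -> R) (C : J -> set T) :
  (forall i, 0 <= F i) -> (forall i, measurable (A i)) ->
  (forall j, 0 <= H j) -> (forall j, measurable (C j)) ->
  (forall x, \sum_i F i * \1_(A i) x <= \sum_j H j * \1_(C j) x) ->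
  (\sum_i (F i)%:E * mu (A i) <= \sum_j (H j)%:E * mu (C j))%E.
Proof.
move=> F0 mA H0 mC le; rewrite -!integral_indic_sum//; apply: ge0_integral_mono.
- by move=> x _; apply: sume_ge0 => i _; rewrite -EFinM lee_fin mulr_ge0.
- by move=> x _; apply: sume_ge0 => i _; rewrite -EFinM lee_fin mulr_ge0.
- move=> x _; split => //.
  under eq_bigr do rewrite -EFinM.
  under [leRHS]eq_bigr do rewrite -EFinM.
  by rewrite !sumEFin lee_fin.
Qed.

Let cst_sum (I : finType) (c : R) : \sum_(i : I) c = #|I|%:R * c.
Proof. by rewrite sumr_const mulr_natl. Qed.

(** With [Z] the number of gaps and [N] the number of crossed gaps, the bad event forces [Z <= N], and then
    [1 <= 4 (Z / (J q) - 1)^2 + 2 N / (J q)]. Off the bad event the right-hand side is nonnegative, so the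
    inequality can be integrated. *)
Lemma many_gaps (J : nat) (q dl : R) (gp C : 'I_J -> set T) (Bad : set T) :
  (0 < J)%N -> 0 < q -> 0 <= dl ->
  measurable Bad -> (forall j, measurable (gp j)) -> (forall j, measurable (C j)) ->
  (forall j, mu (gp j) = q%:E) -> (forall j l, j != l -> (mu (gp j `&` gp l) <= (q ^+ 2)%:E)%E) ->
  (forall j, (mu (C j) <= (q * dl)%:E)%E) ->
  (forall w, Bad w -> forall j, gp j w -> C j w) ->
  (mu Bad <= (4 / (J%:R * q) + 2 * dl)%:E)%E.
Proof.
move=> J0 q0 dl0 mB mg mC pg pgg pC BgC.
have Jr : 0 < J%:R :> R by rewrite ltr0n.
set m := J%:R * q; have m0 : 0 < m by exact: mulr_gt0.
pose A (i : 'I_1 + 'I_J) : set T := match i with inl _ => Bad | inr j => gp j end.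
pose F (i : 'I_1 + 'I_J) : R := match i with inl _ => 1 | inr j => 8 / m end.
pose D (i : ('I_J * 'I_J) + ('I_1 + 'I_J)) : set T := match i with
  | inl p => gp p.1 `&` gp p.2 | inr (inl _) => setT | inr (inr j) => C j end.
pose H (i : ('I_J * 'I_J) + ('I_1 + 'I_J)) : R := match i with
  | inl p => 4 / m ^+ 2 | inr (inl _) => 4 | inr (inr j) => 2 / m end.
have F0 i : 0 <= F i by case: i => ? //=; apply: divr_ge0 => //; exact: ltW.
have H0 i : 0 <= H i.
  by case: i => [?|[?|?]] //=; apply: divr_ge0 => //; rewrite ?exprn_ge0 ?(ltW m0).
have mA i : measurable (A i) by case: i => ? /=.
have mD i : measurable (D i) by case: i => [?|[?|?]] //=; exact: measurableI.
have key x : \sum_i F i * \1_(A i) x <= \sum_i H i * \1_(D i) x.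
  rewrite !big_sumType/= !big_ord1 mul1r indicT mulr1 -!mulr_sumr.
  set b : R := \1_Bad x; set Z : R := \sum_j \1_(gp j) x; set N : R := \sum_j \1_(C j) x.
  have -> : \sum_(p : 'I_J * 'I_J) \1_(gp p.1 `&` gp p.2) x = Z ^+ 2 :> R.
    rewrite expr2 /Z mulr_suml -(pair_big xpredT xpredT (fun j l => \1_(gp j `&` gp l) x))/=.
    by apply: eq_bigr => j _; rewrite mulr_sumr; apply: eq_bigr => l _; rewrite indicI.
  pose y := Z / m.
  have -> : 8 / m * Z = 8 * y by rewrite /y; field; rewrite gt_eqF.
  have -> : 4 / m ^+ 2 * Z ^+ 2 = 4 * y ^+ 2 by rewrite /y; field; rewrite gt_eqF.
  have N0 : 0 <= N by apply: sumr_ge0.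
  have : 0 <= (2 * y - 3 / 2) ^+ 2 by exact: sqr_ge0.
  have : 0 <= (2 * y - 2) ^+ 2 by exact: sqr_ge0.
  have [Bx|nB] := pselect (Bad x).
    have -> : b = 1 by rewrite /b indicE mem_set.
    have : y <= N / m.
      apply: ler_wpM2r; first by rewrite invr_ge0 ltW.
      apply: ler_sum => j _; rewrite !indicE.
      have [gj|ng] := pselect (gp j x); last by rewrite memNset.
      by rewrite !mem_set//; apply: BgC.
    have -> : 2 / m * N = 2 * (N / m) by field; rewrite gt_eqF.
    nra.
  have -> : b = 0 by rewrite /b indicE memNset.
  have : 0 <= 2 / m * N by apply: mulr_ge0 => //; apply: divr_ge0 => //; exact: ltW.
  nra.
have := indic_sum_le F0 mA H0 mD key.
rewrite !big_sumType/= !big_ord1 mul1e probability_setT mule1.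
have -> : (\sum_(j < J) (8 / m)%:E * mu (gp j) = 8%:E)%E.
  rewrite (eq_bigr (fun=> (8 / m * q)%:E)) => [|j _]; last by rewrite pg -EFinM.
  by rewrite sumEFin cst_sum card_ord; congr (_%:E); rewrite /m; field; rewrite !gt_eqF.
have S1 : (\sum_(p : 'I_J * 'I_J) (4 / m ^+ 2)%:E * mu (gp p.1 `&` gp p.2) <= (4 / m + 4)%:E)%E.
  apply: (@le_trans _ _ (\sum_(p : 'I_J * 'I_J) (4 / m ^+ 2 * ((p.1 == p.2)%:R * q + q ^+ 2))%:E)%E).
    apply: lee_sum => -[j l] _ /=; rewrite [leRHS]EFinM; apply: lee_wpmul2l.
      by rewrite lee_fin; apply: divr_ge0 => //; apply: exprn_ge0; exact: ltW.
    have [->|jl] := eqVneq j l.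
      by rewrite setIid pg lee_fin mul1r lerDl; apply: exprn_ge0; exact: ltW.
    by rewrite mul0r add0r; exact: pgg.
  rewrite sumEFin lee_fin -mulr_sumr big_split/= cst_sum card_prod card_ord.
  rewrite -mulr_suml -(pair_big xpredT xpredT (fun j l : 'I_J => (j == l)%:R))/=.
  have -> : \sum_(j < J) \sum_(l < J) (j == l)%:R = J%:R :> R.
    rewrite -[RHS]mulr1 -[in RHS](card_ord J) -cst_sum; apply: eq_bigr => j _.
    rewrite (bigD1 j)//= eqxx big1 ?addr0// => l lj; by rewrite eq_sym (negbTE lj).
  by apply: eq_ler; rewrite /m natrM; field; rewrite !gt_eqF.
have S2 : (\sum_(j < J) (2 / m)%:E * mu (C j) <= (2 * dl)%:E)%E.
  apply: (@le_trans _ _ (\sum_(j < J) (2 / m * (q * dl))%:E)%E).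
    apply: lee_sum => j _; rewrite [leRHS]EFinM; apply: lee_wpmul2l => //.
    by rewrite lee_fin; apply: divr_ge0 => //; exact: ltW.
  rewrite sumEFin cst_sum card_ord lee_fin.
  by apply: eq_ler; rewrite /m; field; rewrite !gt_eqF.
move=> le1.
have : (mu Bad + 8%:E <= (4 / m + 4)%:E + (4%:E + (2 * dl)%:E))%E.
  by apply: (le_trans le1); apply: leeD => //; exact: leeD.
have : (mu Bad \is a fin_num) by exact: fin_num_measure.
case: (mu Bad) => [r| |] // _; rewrite -!EFinD !lee_fin; lra.
Qed.

Lemma prod_le_fin (I : finType) (f : I -> \bar R) (c : I -> R) :
  (forall i, (0 <= f i <= (c i)%:E)%E) -> (\prod_i f i <= (\prod_i c i)%:E)%E.
Proof.
move=> fc; rewrite -prodEFin.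
suff : (0 <= \prod_i f i <= \prod_i (c i)%:E)%E by case/andP.
elim/big_ind2: _ => [|x1 x2 y1 y2 /andP[a1 a2] /andP[b1 b2]|i _]; last exact: fc.
  by rewrite lee01 lexx.
by rewrite mule_ge0//= lee_pmul.
Qed.

End IndicatorSums.

Lemma uniform_prob_sub (R : realType) (a b c e : R) (ab : a < b) (S : set R) : b - a = 1 -> c <= e ->
  measurable S -> S `<=` `[c, e] -> (uniform_prob ab S <= (e - c)%:E)%E.
Proof.
move=> ba ce mS Sce; rewrite uniform_prob1E//.
apply: (@le_trans _ _ (lebesgue_measure (`[c, e]%classic : set R))).
  apply: le_measure; rewrite ?inE//; first by apply: measurableI.
  by move=> x [/Sce].
rewrite lebesgue_measure_itv/= lte_fin; case: ifP => _; first by rewrite EFinB.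
by rewrite lee_fin subr_ge0.
Qed.

Lemma uniform_prob_le (R : realType) (a b c e : R) (ab : a < b) : b - a = 1 -> c <= e ->
  (uniform_prob ab `[c, e] <= (e - c)%:E)%E.
Proof. by move=> ba ce; apply: uniform_prob_sub. Qed.

Lemma uniform_probC (R : realType) (a b c e : R) (ab : a < b) : b - a = 1 ->
  a <= c -> c <= e -> e <= b -> uniform_prob ab (~` `]c, e]) = (1 - (e - c))%:E.
Proof.
move=> ba ac ce eb; rewrite probability_setC; last exact: measurable_itv.
rewrite [X in (1 - X)%E](_ : _ = (e - c)%:E) ?EFinB//; exact: uniform_prob_itv.
Qed.

Section MarkSum.
Context {R : realType} {g : R -> R -> R} {rho : R -> R}.
Hypothesis hg : is_kernel g.
Hypothesis hrho : is_profile rho.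

(** A lower Riemann sum, shifted by one cell because the integrand is nonincreasing. *)
Lemma mark_sum_le (a : R) (N U : nat) : 0 < a -> (0 < N)%N -> U.+1%:R * a < 1 ->
  ((\sum_(u < U) \sum_(w < U) a * a * rho (g (u.+2%:R * a) (w.+2%:R * a) * N%:R))%:E
    <= mark_integral (g := g) (rho := rho) a N)%E.
Proof.
move=> a0 N0 Ua; have N0' : 0 < N%:R :> R by rewrite ltr0n.
have in01 (u : 'I_U) : 0 < u.+2%:R * a < 1.
  rewrite mulr_gt0//=; apply: le_lt_trans Ua; rewrite ler_wpM2r ?(ltW a0)// ler_nat.
  by rewrite ltnS.
pose r (u w : 'I_U) := rho (g (u.+2%:R * a) (w.+2%:R * a) * N%:R).
have r0 u w : 0 <= r u w by have /andP[] := rho_g01 hg hrho (in01 u) (in01 w) N0'.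
pose C (u : 'I_U) := `]u.+1%:R * a, u.+2%:R * a]%classic.
have mC u : measurable (C u) by exact: measurable_itv.
have lC u : lebesgue_measure (C u) = a%:E.
  rewrite lebesgue_measure_itv/= lte_fin ltr_pM2r// ltr_nat ltnSn -EFinB; congr (_%:E).
  by rewrite -[u.+2%:R]natr1; ring.
have CD u x : C u x -> `]a, 1[%classic x.
  rewrite /C /= !in_itv/= => /andP[ux xu]; apply/andP; split.
    by apply: le_lt_trans ux; rewrite ler_peMl ?(ltW a0)// ler1n.
  by apply: le_lt_trans xu _; case/andP: (in01 u).
have CC u w x : C u x -> C w x -> u = w.
  move=> h1 h2; apply: val_inj; apply: succn_inj.
  by apply: (@cell_inj _ 0 a x) => //; rewrite /cell /= !add0r.
have pos s t : `]a, 1[%classic s -> `]a, 1[%classic t -> (0 <= (rho (g s t * N%:R))%:E)%E.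
  rewrite /= !in_itv/= => /andP[as_ s1] /andP[at_ t1]; rewrite lee_fin.
  have /andP[] // : 0 <= rho (g s t * N%:R) <= 1.
  by apply: (rho_g01 hg hrho) => //; apply/andP; split => //; exact: (lt_trans a0).
pose F (u : 'I_U) := \sum_(w < U) r u w * a.
have F0 u : 0 <= F u by apply: sumr_ge0 => w _; rewrite mulr_ge0 ?(ltW a0).
apply: (@le_trans _ _ (\sum_u (F u)%:E * lebesgue_measure (C u))%E).
  rewrite -sumEFin; apply: lee_sum => u _; rewrite lC -EFinM lee_fin /F mulr_suml.
  by apply: ler_sum => w _; apply: eq_ler; rewrite /r; ring.
apply: step_le_integral => //.
  by move=> s Ds; apply: integral_ge0 => t Dt; exact: pos.
move=> u s Cu; apply: (@le_trans _ _ (\sum_w (r u w)%:E * lebesgue_measure (C w))%E).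
  by rewrite /F -sumEFin; apply: lee_sum => w _; rewrite lC EFinM.
apply: step_le_integral => //.
  by move=> t Dt; apply: pos => //; exact: CD Cu.
move=> w t Cw; rewrite lee_fin /r.
have := CD _ _ Cu; have := CD _ _ Cw; move: Cu Cw.
rewrite /C /= !in_itv/= => /andP[_ su] /andP[_ tw] /andP[at_ _] /andP[as_ _].
apply: (rho_g_antitone hg hrho) => //; rewrite ?(lt_trans a0)//.
  by case/andP: (in01 u).
by case/andP: (in01 w).
Qed.
End MarkSum.

(** * Events that prescribe one or two vertices *)

Lemma prod_one (R : numFieldType) (n : nat) (i : 'I_n) (x o : R) : 2^-1 <= o -> 0 <= x ->
  \prod_v (if v == i then x else o) <= 2 * x * o ^+ n.
Proof.
move=> o2 x0; have o0 : 0 < o by apply: lt_le_trans o2; rewrite invr_gt0.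
have E : o ^+ n = o * \prod_(v < n | v != i) o.
  by rewrite -[in LHS](card_ord n) -prodr_const (bigD1 i).
rewrite (bigD1 i)//= eqxx E (eq_bigr (fun=> o)); last by move=> v /negbTE ->.
set Q := \prod_(_ < _ | _) o; have Q0 : 0 <= Q by apply: prodr_ge0 => *; exact: ltW.
have -> : 2 * x * (o * Q) = x * Q * (2 * o) by ring.
rewrite -[leLHS]mulr1; apply: ler_wpM2l; first exact: mulr_ge0.
by rewrite mulrC -ler_pdivrMr// div1r.
Qed.

Lemma prod_two (R : numFieldType) (n : nat) (i j : 'I_n) (x y o : R) : i != j -> 2^-1 <= o -> 0 <= x -> 0 <= y ->
  \prod_v (if v == i then x else if v == j then y else o) <= 4 * x * y * o ^+ n.
Proof.
move=> ij o2 x0 y0; have o0 : 0 < o by apply: lt_le_trans o2; rewrite invr_gt0.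
have ji : j != i by rewrite eq_sym.
have E : o ^+ n = o * (o * \prod_(v < n | (v != i) && (v != j)) o).
  by rewrite -[in LHS](card_ord n) -prodr_const (bigD1 i)//= (bigD1 j).
rewrite (bigD1 i)//= eqxx (bigD1 j)//= (negbTE ji) eqxx E.
rewrite (eq_bigr (fun=> o)); last by move=> v /andP[/negbTE -> /negbTE ->].
set Q := \prod_(_ < _ | _) o; have Q0 : 0 <= Q by apply: prodr_ge0 => *; exact: ltW.
have -> : 4 * x * y * (o * (o * Q)) = x * (y * Q) * ((2 * o) * (2 * o)) by ring.
have o1 : 1 <= 2 * o by rewrite mulrC -ler_pdivrMr// div1r.
rewrite -[leLHS]mulr1; apply: ler_wpM2l; first by rewrite !mulr_ge0.
by rewrite -[leLHS]mulr1 ler_pM.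
Qed.

Section RareEvents.
Context {R : realType} {g : R -> R -> R} {rho : R -> R} {beta : R} {n : nat}.
Variable G : random_graph g rho beta n.
Hypotheses (hg : is_kernel g) (hrho : is_profile rho) (beta0 : 0 < beta) (n0 : (0 < n)%N).
Notation P := (rg_prob G).
Notation X := (rg_loc G).
Notation M := (rg_mark G).
Notation UX := (uniform_prob (ltN_half R)).
Notation UM := (uniform_prob (@ltr01 R)).
Notation adj i j := [set w | rg_adj G w i j].

Lemma half_len : 2^-1 - - 2^-1 = 1 :> R.
Proof. by field. Qed.

Lemma P_box_le (B C : 'I_n -> set R) (b c : 'I_n -> R) :
  (forall v, measurable (B v)) -> (forall v, measurable (C v)) ->
  (forall v, (UX (B v) <= (b v)%:E)%E) -> (forall v, (UM (C v) <= (c v)%:E)%E) ->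
  (P (box (G := G) B C) <= (\prod_v (b v * c v))%:E)%E.
Proof.
move=> mB mC Bb Cc; rewrite P_box//; apply: prod_le_fin => v.
by rewrite mule_ge0//= EFinM lee_pmul.
Qed.

Variable O : set R.
Variable o : R.
Hypothesis mO : measurable O.
Hypothesis UO : UX O = o%:E.
Hypothesis o2 : 2^-1 <= o.

Lemma P_one i (I C : set R) (x y : R) : measurable I -> measurable C ->
  (UX I <= x%:E)%E -> (UM C <= y%:E)%E ->
  (P [set w | I (X i w) /\ C (M i w) /\ forall v, v != i -> O (X v w)] <= (2 * (x * y) * o ^+ n)%:E)%E.
Proof.
move=> mI mC Ix Cy.
have x0 : 0 <= x by rewrite -lee_fin; apply: le_trans Ix; exact: measure_ge0.
have y0 : 0 <= y by rewrite -lee_fin; apply: le_trans Cy; exact: measure_ge0.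
have -> : [set w | I (X i w) /\ C (M i w) /\ forall v, v != i -> O (X v w)] =
    box (G := G) (fun v => if v == i then I else O) (fun v => if v == i then C else setT).
  apply/seteqP; split => w; rewrite /box /=.
    by move=> [a [b c]] v; case: eqVneq => [->|vi] //; split => //; exact: c.
  move=> H; have [] := H i; rewrite eqxx => a b; split => //; split => // v vi.
  by have [] := H v; rewrite (negbTE vi).
apply: le_trans (@P_box_le _ _ (fun v => if v == i then x else o) (fun v => if v == i then y else 1) _ _ _ _) _.
- by move=> v; case: eqP.
- by move=> v; case: eqP.
- by move=> v; case: eqP => // _; rewrite UO.
- by move=> v; case: eqP => // _; rewrite probability_setT.
rewrite lee_fin (eq_bigr (fun v => if v == i then x * y else o)).
  by apply: prod_one => //; exact: mulr_ge0.
by move=> v _; case: eqP => // _; rewrite mulr1.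
Qed.

Lemma P_two i j (I I' C C' : set R) (x x' y y' : R) : i != j ->
  measurable I -> measurable C -> measurable I' -> measurable C' ->
  (UX I <= x%:E)%E -> (UM C <= y%:E)%E -> (UX I' <= x'%:E)%E -> (UM C' <= y'%:E)%E ->
  let A := [set w | [/\ I (X i w), C (M i w), I' (X j w), C' (M j w) & forall v, v != i -> v != j -> O (X v w)]] in
  sigma_of (loc_mark (fun i => X i : _ -> R) (fun i => M i : _ -> R)) A /\
  (P A <= (4 * (x * y) * (x' * y') * o ^+ n)%:E)%E.
Proof.
move=> ij mI mC mI' mC' Ix Cy Ix' Cy' A.
have x0 : 0 <= x by rewrite -lee_fin; apply: le_trans Ix; exact: measure_ge0.
have y0 : 0 <= y by rewrite -lee_fin; apply: le_trans Cy; exact: measure_ge0.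
have x'0 : 0 <= x' by rewrite -lee_fin; apply: le_trans Ix'; exact: measure_ge0.
have y'0 : 0 <= y' by rewrite -lee_fin; apply: le_trans Cy'; exact: measure_ge0.
have ji : (j == i) = false by rewrite eq_sym (negbTE ij).
have -> : A = box (G := G) (fun v => if v == i then I else if v == j then I' else O)
     (fun v => if v == i then C else if v == j then C' else setT).
  apply/seteqP; split => w; rewrite /box /A /=.
    by move=> [a b c d e] v; case: (eqVneq v i) => [->|vi] //; case: (eqVneq v j) => [->|vj] //; split => //; exact: e.
  move=> H; have [] := H i; rewrite eqxx => a b; have [] := H j; rewrite eqxx ji => c d; split => // v vi vj.
  by have [] := H v; rewrite (negbTE vi) (negbTE vj).
split; first by apply: box_sigma => v; case: eqP => // _; case: eqP.
apply: le_trans (@P_box_le _ _ (fun v => if v == i then x else if v == j then x' else o)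
    (fun v => if v == i then y else if v == j then y' else 1) _ _ _ _) _.
- by move=> v; case: eqP => // _; case: eqP.
- by move=> v; case: eqP => // _; case: eqP.
- by move=> v; case: eqP => // _; case: eqP => // _; rewrite UO.
- by move=> v; case: eqP => // _; case: eqP => // _; rewrite probability_setT.
rewrite lee_fin (eq_bigr (fun v => if v == i then x * y else if v == j then x' * y' else o)).
  by apply: prod_two => //; exact: mulr_ge0.
by move=> v _; case: eqP => // _; case: eqP => // _; rewrite mulr1.
Qed.

Lemma P_adj_le i j A (phi : R) : i != j ->
  sigma_of (loc_mark (fun i => X i : _ -> R) (fun i => M i : _ -> R)) A ->
  (forall w, A w -> 0 <= edge_prob g rho beta n (X i w) (M i w) (X j w) (M j w) <= phi) ->
  (forall w, A w -> 0 <= edge_prob g rho beta n (X j w) (M j w) (X i w) (M i w) <= phi) ->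
  (P (A `&` adj i j) <= phi%:E * P A)%E.
Proof.
wlog ij : i j / (i < j)%N.
  move=> W ne sA h1 h2; case: (ltngtP i j) => [lt|gt|/val_inj e].
  - exact: W.
  - have -> : adj i j = adj j i by apply/seteqP; split => w /=; rewrite rg_adj_sym.
    by apply: W => //; rewrite eq_sym.
  - by rewrite e eqxx in ne.
move=> _ sA h1 _.
have -> : A `&` adj i j = A `&` \bigcap_(e in [set` [set (i, j)]%SET]) [set w | rg_adj G w e.1 e.2].
  congr (_ `&` _); apply/seteqP; split => w /=.
    by move=> a e; rewrite /= inE => /eqP ->.
  by move=> H; apply: (H (i, j)); rewrite /= inE.
rewrite rg_adj_law//; last by move=> e; rewrite inE => /eqP ->.
apply: integral_le_cst; first exact: (sigma_measurable sA).
by move=> w Aw; rewrite big_set1/= !lee_fin; exact: h1.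
Qed.

(** The square of marks is cut into cells of side [a]; in each cell the edge probability is at most its
    value at the lower corner, and the resulting sum is a lower Riemann sum of the mark integral. *)
Lemma P_long_edge i j (I I' : set R) (x x' a : R) (N : nat) : i != j ->
  measurable I -> measurable I' -> (UX I <= x%:E)%E -> (UX I' <= x'%:E)%E ->
  0 < a -> 2 * a <= 1 -> (0 < N)%N ->
  (forall u v, I u -> I' v -> N%:R <= beta^-1 * n%:R * `|u - v|) ->
  let L := [set w | [/\ I (X i w), 2 * a < M i w < 1, I' (X j w), 2 * a < M j w < 1 &
        forall v, v != i -> v != j -> O (X v w)]] in
  measurable L /\ (P (L `&` adj i j) <= (4 * x * x' * o ^+ n)%:E * mark_integral (g := g) (rho := rho) a N)%E.
Proof.
move=> ij mI mI' Ix Ix' a0 a1 N0 dist L.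
have x0 : 0 <= x by rewrite -lee_fin; apply: le_trans Ix; exact: measure_ge0.
have x'0 : 0 <= x' by rewrite -lee_fin; apply: le_trans Ix'; exact: measure_ge0.
have o0 : 0 < o by apply: lt_le_trans o2; rewrite invr_gt0.
have N0' : 0 < N%:R :> R by rewrite ltr0n.
pose m := Num.truncn a^-1.
have am : m%:R * a <= 1.
  rewrite -ler_pdivlMr// div1r; have := truncn_le a^-1.
  by rewrite invr_ge0 (ltW a0).
have ma : 1 < m.+1%:R * a by rewrite -ltr_pdivrMr// div1r truncnS_gt.
have m2 : (2 <= m)%N by rewrite truncn_ge_nat ?invr_ge0 ?(ltW a0)// -[leRHS]div1r ler_pdivlMr.
have [U [UE1 UE2]] : exists U : nat, U.+1%:R * a < 1 /\ 1 <= U.+2%:R * a.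
  have [lt|ge] := ltP (m%:R * a) 1.
    by exists m.-1; rewrite prednK ?(leq_trans _ m2)//; split => //; exact: ltW.
  exists m.-2; rewrite !prednK; [|by rewrite (leq_trans _ m2)|by rewrite -subn1 subn_gt0].
  split => //; apply: lt_le_trans am; rewrite ltr_pM2r// ltr_nat.
  by rewrite ltn_predL ltnW.
have in01 (u : 'I_U) : 0 < u.+2%:R * a < 1.
  rewrite mulr_gt0//=; apply: le_lt_trans UE1; rewrite ler_wpM2r ?(ltW a0)// ler_nat.
  by rewrite ltnS.
pose Ce (u : 'I_U) : set R := `[u.+2%:R * a, u.+3%:R * a]%classic `&` `]0, 1[%classic.
have mCe u : measurable (Ce u) by apply: measurableI; exact: measurable_itv.
have UCe u : (UM (Ce u) <= a%:E)%E.
  have ule : u.+2%:R * a <= u.+3%:R * a by rewrite ler_wpM2r ?(ltW a0)// ler_nat.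
  have one : 1 - 0 = 1 :> R by rewrite subr0.
  have sub : Ce u `<=` `[u.+2%:R * a, u.+3%:R * a] by move=> y [].
  apply: (le_trans (uniform_prob_sub (@ltr01 R) one ule (mCe u) sub)).
  by rewrite lee_fin; apply: eq_ler; rewrite -[u.+3%:R]natr1; ring.
pose A (p : 'I_U * 'I_U) := [set w | [/\ I (X i w), Ce p.1 (M i w), I' (X j w), Ce p.2 (M j w) &
   forall v, v != i -> v != j -> O (X v w)]].
have HA p := P_two ij mI (mCe p.1) mI' (mCe p.2) Ix (UCe p.1) Ix' (UCe p.2).
have mA p : measurable (A p) by apply: sigma_measurable; case: (HA p).
pose phi (p : 'I_U * 'I_U) := rho (g (p.1.+2%:R * a) (p.2.+2%:R * a) * N%:R).
have phi0 p : 0 <= phi p by have /andP[] := rho_g01 hg hrho (in01 p.1) (in01 p.2) N0'.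
have madj : measurable (adj i j) by exact: rg_adj_measurable.
have mL : measurable L.
  have m21 : measurable (`]2 * a, 1[%classic : set R) by exact: measurable_itv.
  have [||] := @P_two i j I I' `]2 * a, 1[%classic `]2 * a, 1[%classic x x' 1 1 ij mI m21 mI' m21 Ix _ Ix'.
  - by rewrite probability_le1.
  - by rewrite probability_le1.
  move=> sA _; have -> : L = [set w | [/\ I (X i w), `]2 * a, 1[%classic (M i w), I' (X j w),
      `]2 * a, 1[%classic (M j w) & forall v, v != i -> v != j -> O (X v w)]].
    by apply/seteqP; split => w /= [h1 h2 h3 h4 h5]; split => //; move: h2 h4; rewrite /= !in_itv.
  exact: (sigma_measurable sA).
split => //; have mE : measurable (L `&` adj i j) by exact: measurableI.
apply: (@le_trans _ _ (\sum_(p : 'I_U * 'I_U | true) P (A p `&` adj i j))%E).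
  apply: measure_finU_le => //; first by move=> p _; exact: measurableI.
  move=> w [[h1 /andP[h2 h2'] h3 /andP[h4 h4'] h5] aw].
  have cov (y : R) : 2 * a < y -> y < 1 -> exists u : 'I_U, Ce u y.
    move=> y2 y1; have : 2 * a < y <= 2 * a + U%:R * a.
      rewrite y2 /= -mulrDl; apply: (le_trans (ltW y1)); apply: (le_trans UE2).
      by rewrite ler_wpM2r ?(ltW a0)// -natrD ler_nat.
    move=> /(cell_exists a0)[u]; rewrite /cell /= in_itv/= -!mulrDl -!natrD => /andP[yu uy].
    exists u; split; rewrite /= in_itv/= ?y1 ?andbT.
      by apply/andP; split; [exact: ltW yu|exact: uy].
    by apply: lt_trans y2; rewrite mulr_gt0.
  have [u hu] := cov _ h2 h2'; have [u' hu'] := cov _ h4 h4'.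
  by exists (u, u') => //; split.
apply: (@le_trans _ _ (\sum_(p : 'I_U * 'I_U) (4 * x * x' * o ^+ n * (a * a * phi p))%:E)%E).
  apply: lee_sum => p _; have [sA PA] := HA p.
  have bound w : A p w -> 0 <= edge_prob g rho beta n (X i w) (M i w) (X j w) (M j w) <= phi p /\
      0 <= edge_prob g rho beta n (X j w) (M j w) (X i w) (M i w) <= phi p.
    move=> [h1 [h2 h2'] h3 [h4 h4'] _].
    move: h2 h2' h4 h4'; rewrite /= !in_itv/= => /andP[b1 _] /andP[c1 d1] /andP[b2 _] /andP[c2 d2].
    have dN := dist _ _ h1 h3.
    have [/andP[e1 f1] /andP[e2 f2]] := (in01 p.1, in01 p.2).
    have r0 : 0 < beta^-1 * n%:R * `|X i w - X j w| by exact: lt_le_trans dN.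
    have e12 : edge_prob g rho beta n (X i w) (M i w) (X j w) (M j w) =
        rho (g (M j w) (M i w) * (beta^-1 * n%:R * `|X i w - X j w|)).
      by rewrite /edge_prob; congr rho; ring.
    have e21 : edge_prob g rho beta n (X j w) (M j w) (X i w) (M i w) =
        rho (g (M i w) (M j w) * (beta^-1 * n%:R * `|X i w - X j w|)).
      by rewrite /edge_prob distrC; congr rho; ring.
    have sym : g (M j w) (M i w) = g (M i w) (M j w).
      by apply: (kernel_sym hg); rewrite in_itv/= ?c1 ?c2.
    have r01 : 0 <= rho (g (M i w) (M j w) * (beta^-1 * n%:R * `|X i w - X j w|)) <= 1.
      by apply: (rho_g01 hg hrho) => //; rewrite ?c1 ?c2.
    have rle : rho (g (M i w) (M j w) * (beta^-1 * n%:R * `|X i w - X j w|)) <= phi p.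
      exact: (rho_g_antitone hg hrho).
    by rewrite e12 e21 sym rle; case/andP: r01 => ->.
  apply: le_trans (P_adj_le (phi := phi p) ij sA _ _) _.
  - by move=> w /bound[].
  - by move=> w /bound[].
  apply: (@le_trans _ _ ((phi p)%:E * (4 * (x * a) * (x' * a) * o ^+ n)%:E)%E).
    by apply: lee_wpmul2l => //; rewrite lee_fin.
  by rewrite -EFinM lee_fin; apply: eq_ler; ring.
rewrite sumEFin -mulr_sumr EFinM; apply: lee_wpmul2l.
  by rewrite lee_fin !mulr_ge0// ltW// exprn_gt0.
rewrite -(pair_big xpredT xpredT (fun u w => a * a * phi (u, w)))/=.
exact: (mark_sum_le hg hrho).
Qed.
End RareEvents.

(** * Edges across a gap *)

Section Crossing.
Context {R : realType} {g : R -> R -> R} {rho : R -> R} {beta : R} {n : nat}.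
Variable G : random_graph g rho beta n.
Hypotheses (hg : is_kernel g) (hrho : is_profile rho) (beta0 : 0 < beta) (n0 : (0 < n)%N).
Notation P := (rg_prob G).
Notation X := (rg_loc G).
Notation M := (rg_mark G).
Notation UX := (uniform_prob (ltN_half R)).
Notation UM := (uniform_prob (@ltr01 R)).
Notation adj i j := [set w | rg_adj G w i j].
Variables (mu y : R) (N0 : nat).
Hypotheses (mu0 : 0 < mu) (y2 : 2 < y) (N02 : (2 <= N0)%N).
Hypothesis decay : forall N, (N0 <= N)%N ->
  (mark_integral (g := g) (rho := rho) (N%:R `^ (- mu - 1)) N < (N%:R `^ (- y))%:E)%E.
Definition halfwidth : R := beta * N0%:R / n%:R.
Notation h := halfwidth.
Hypotheses (h4 : 2 * h <= 2^-1) (bN : 1 <= beta * N0%:R).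
Definition cross_exp : R := Num.min mu (y - 2).
Definition cross_cst : R := 16 * (beta + beta ^+ 2) / (1 - 2 `^ (- cross_exp)).
Definition cross_bound : R := cross_cst * N0%:R `^ (- cross_exp).
Notation q := ((1 - 2 * h) ^+ n).

Definition gap (z : R) : set (rg_space G) := [set w | forall v, (~` `]z - h, z + h]%classic) (X v w)].
Definition crossed (z : R) : set (rg_space G) :=
  [set w | exists2 p : 'I_n * 'I_n, true & X p.1 w < z /\ z <= X p.2 w /\ rg_adj G w p.1 p.2].

Let n0' : 0 < n%:R :> R. Proof. by rewrite ltr0n. Qed.
Let N00 : (0 < N0)%N. Proof. exact: leq_trans N02. Qed.
Let N00' : 0 < N0%:R :> R. Proof. by rewrite ltr0n. Qed.

Lemma halfwidth_gt0 : 0 < h. Proof. by apply: divr_gt0 => //; exact: mulr_gt0. Qed.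
Let h0 := halfwidth_gt0.
Let o2 : 2^-1 <= 1 - 2 * h. Proof. by move: h4; lra. Qed.
Let kap0 : 0 < cross_exp. Proof. by rewrite lt_min mu0 subr_gt0. Qed.

Lemma two_powN : 0 < (2 : R) `^ (- cross_exp) < 1.
Proof. by rewrite powR_gt0//= /powR gt_eqF// expR_lt1 mulNr oppr_lt0 mulr_gt0// ln_gt0// ltr1n. Qed.

Lemma cross_cst_ge0 : 0 <= cross_cst.
Proof.
have /andP[_ t1] := two_powN; apply: divr_ge0; last by rewrite subr_ge0 ltW.
by apply: mulr_ge0 => //; apply: addr_ge0; [exact: ltW|exact: exprn_ge0 (ltW beta0)].
Qed.

Lemma measurable_gap z : measurable (gap z).
Proof.
have -> : gap z = box (G := G) (fun=> ~` `]z - h, z + h]%classic) (fun=> setT).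
  by apply/seteqP; split => w; rewrite /gap /box /= => H v; [split => //; exact: H|case: (H v)].
apply: sigma_measurable; apply: box_sigma => // v.
by apply: measurableC; exact: measurable_itv.
Qed.

Let UO z : - 2^-1 <= z - h -> z + h <= 2^-1 -> UX (~` `]z - h, z + h]) = (1 - 2 * h)%:E.
Proof.
move=> zl zr; rewrite uniform_probC//; first by congr (_%:E); ring.
  exact: half_len.
by move: h0; lra.
Qed.

Lemma P_gap z : - 2^-1 <= z - h -> z + h <= 2^-1 -> P (gap z) = q%:E.
Proof.
move=> zl zr; have -> : gap z = box (G := G) (fun=> ~` `]z - h, z + h]%classic) (fun=> setT).
  by apply/seteqP; split => w; rewrite /gap /box /= => H v; [split => //; exact: H|case: (H v)].
rewrite P_box//; last by move=> v; apply: measurableC; exact: measurable_itv.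
rewrite (eq_bigr (fun=> (1 - 2 * h)%:E)); first by rewrite prodEFin prodr_const card_ord.
by move=> v _; rewrite UO// probability_setT mule1.
Qed.

Lemma measurable_crossed z : measurable (crossed z).
Proof.
apply: measurable_finU => p _; apply: measurableI.
  rewrite [Y in measurable Y](_ : _ = X p.1 @^-1` `]-oo, z[%classic); last first.
    by apply/seteqP; split => w; rewrite /= in_itv.
  by rewrite -[Y in measurable Y]setTI; apply: measurable_funP => //; exact: measurable_itv.
apply: measurableI; last exact: rg_adj_measurable.
rewrite [Y in measurable Y](_ : _ = X p.2 @^-1` `[z, +oo[%classic); last first.
  by apply/seteqP; split => w; rewrite /= in_itv/= andbT.
by rewrite -[Y in measurable Y]setTI; apply: measurable_funP => //; exact: measurable_itv.
Qed.

Let Nr (r : nat) : nat := (N0 * 2 ^ r)%N.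
Let hr (r : nat) : R := h * 2 ^+ r.
Let ar (r : nat) : R := (Nr r)%:R `^ (- mu - 1).

Let Nr_ge r : (N0 <= Nr r)%N. Proof. by rewrite leq_pmulr// expn_gt0. Qed.
Let Nr2 r : 2 <= (Nr r)%:R :> R. Proof. by rewrite ler_nat (leq_trans N02). Qed.
Let Nr0 r : 0 < (Nr r)%:R :> R. Proof. by apply: lt_le_trans (Nr2 r). Qed.
Let hr0 r : 0 < hr r. Proof. by apply: mulr_gt0 => //; exact: exprn_gt0. Qed.
Let nhr r : n%:R * hr r = beta * (Nr r)%:R.
Proof. by rewrite /hr /halfwidth /Nr natrM natrX; field; rewrite gt_eqF. Qed.
Let ar0 r : 0 < ar r. Proof. by apply: powR_gt0. Qed.
Let arN r : (Nr r)%:R * ar r = (Nr r)%:R `^ (- mu).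
Proof.
rewrite -{1}[(Nr r)%:R]powRr1 ?ltW// /ar -powRD; last by apply/implyP => _; rewrite gt_eqF.
by congr (_ `^ _); ring.
Qed.
Let powN_le1 (x e : R) : 1 <= x -> 0 <= e -> x `^ (- e) <= 1.
Proof. by move=> x1 e0; rewrite -[leRHS](powRr0 x); apply: ler_powR => //; rewrite oppr_le0. Qed.
Let ar2 r : 2 * ar r <= 1.
Proof.
have : (Nr r)%:R * ar r <= 1.
  by rewrite arN; apply: powN_le1 (ltW mu0); apply: le_trans (Nr2 r); rewrite ler1n.
apply: le_trans; apply: ler_wpM2r => //; exact: ltW.
Qed.

Let Nr_small r (e : R) : cross_exp <= e -> (Nr r)%:R `^ (- e) <= (Nr r)%:R `^ (- cross_exp).
Proof.
move=> ke; apply: ler_powR; last by rewrite lerN2.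
by apply: le_trans (Nr2 r); rewrite ler1n.
Qed.

Let Nr_geom r : (Nr r)%:R `^ (- cross_exp) = N0%:R `^ (- cross_exp) * (2 `^ (- cross_exp)) ^+ r.
Proof.
rewrite /Nr natrM natrX powRM ?exprn_ge0//; congr (_ * _).
have two : 0 <= (2 : R) by [].
by rewrite -(powR_mulrn r two) -powRrM mulrC powRrM powR_mulrn// powR_ge0.
Qed.

Let geom_le (t : R) : 0 < t < 1 -> \sum_(r < n) t ^+ r <= (1 - t)^-1.
Proof.
move=> /andP[t0 t1]; have t1' : 0 < 1 - t by rewrite subr_gt0.
rewrite -[leRHS]mul1r ler_pdivlMr//.
have := subrX1 t n; set S := \sum_(_ < _) _ => E.
have : 0 <= t ^+ n by apply: exprn_ge0; exact: ltW.
have -> : S * (1 - t) = 1 - t ^+ n by rewrite -[LHS]opprK -mulrN opprB mulrC -E opprB.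
lra.
Qed.

Let side_far (z : R) (r : nat) (s : bool) : set R :=
  if s then `[z - 2 * hr r, z - hr r]%classic else `[z + hr r, z + 2 * hr r]%classic.
Let side_near (z : R) (r : nat) (s : bool) : set R :=
  if s then `[z, z + 2 * hr r]%classic else `[z - 2 * hr r, z]%classic.

Let mfar z r s : measurable (side_far z r s). Proof. by case: s; exact: measurable_itv. Qed.
Let mnear z r s : measurable (side_near z r s). Proof. by case: s; exact: measurable_itv. Qed.

Let Ufar z r s : (UX (side_far z r s) <= (hr r)%:E)%E.
Proof.
have := hr0 r; rewrite /side_far; case: s => hh.
  have le : z - 2 * hr r <= z - hr r by lra.
  by apply: (le_trans (uniform_prob_le _ half_len le)); rewrite lee_fin; lra.
have le : z + hr r <= z + 2 * hr r by lra.
by apply: (le_trans (uniform_prob_le _ half_len le)); rewrite lee_fin; lra.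
Qed.

Let Unear z r s : (UX (side_near z r s) <= (2 * hr r)%:E)%E.
Proof.
have := hr0 r; rewrite /side_near; case: s => hh.
  have le : z <= z + 2 * hr r by lra.
  by apply: (le_trans (uniform_prob_le _ half_len le)); rewrite lee_fin; lra.
have le : z - 2 * hr r <= z by lra.
by apply: (le_trans (uniform_prob_le _ half_len le)); rewrite lee_fin; lra.
Qed.

Let far_dist z r s u v : side_far z r s u -> side_near z r s v ->
  (Nr r)%:R <= beta^-1 * n%:R * `|u - v|.
Proof.
move=> hu hv; have d : hr r <= `|u - v|.
  move: hu hv; rewrite /side_far /side_near; case: s => /=; rewrite !in_itv/= => /andP[u1 u2] /andP[v1 v2].
    by rewrite distrC; apply: le_trans (ler_norm _); lra.
  by apply: le_trans (ler_norm _); lra.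
have -> : (Nr r)%:R = beta^-1 * n%:R * hr r.
  by rewrite -mulrA nhr mulrA mulVf ?mul1r// gt_eqF.
by apply: ler_wpM2l => //; apply: mulr_ge0 => //; rewrite invr_ge0 ltW.
Qed.

Let low_mark (z : R) (r : nat) (i : 'I_n) : set (rg_space G) :=
  [set w | `[z - 2 * hr r, z + 2 * hr r]%classic (X i w) /\ `[0, 2 * ar r]%classic (M i w) /\
     forall v, v != i -> (~` `]z - h, z + h]%classic) (X v w)].

Let long_edge (z : R) (r : nat) (i j : 'I_n) (s : bool) : set (rg_space G) :=
  [set w | [/\ side_far z r s (X i w), 2 * ar r < M i w < 1, side_near z r s (X j w), 2 * ar r < M j w < 1 &
        forall v, v != i -> v != j -> (~` `]z - h, z + h]%classic) (X v w)]].

Section AtPoint.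
Variable z : R.
Hypotheses (zl : - 2^-1 <= z - h) (zr : z + h <= 2^-1).
Let mO : measurable (~` `]z - h, z + h]%classic : set R).
Proof. by apply: measurableC; exact: measurable_itv. Qed.

Let P_low r i : (P (low_mark z r i) <= (16 * hr r * ar r * q)%:E)%E.
Proof.
have hh := hr0 r; have aa := ar0 r.
have le1 : z - 2 * hr r <= z + 2 * hr r by lra.
have le2 : 0 <= 2 * ar r by lra.
have one : 1 - 0 = 1 :> R by rewrite subr0.
have mI : measurable (`[z - 2 * hr r, z + 2 * hr r]%classic : set R) by exact: measurable_itv.
have mC : measurable (`[0, 2 * ar r]%classic : set R) by exact: measurable_itv.
apply: le_trans (P_one G mO (UO zl zr) o2 i mI mC (uniform_prob_le _ half_len le1)
  (uniform_prob_le _ one le2)) _.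
by rewrite lee_fin; apply: eq_ler; ring.
Qed.

Let P_long r i j s : i != j -> measurable (long_edge z r i j s) /\
  (P (long_edge z r i j s `&` adj i j) <= (8 * hr r ^+ 2 * (Nr r)%:R `^ (- y) * q)%:E)%E.
Proof.
move=> ij; have NrN : (0 < Nr r)%N by exact: leq_trans (Nr_ge r).
have [mL PL] := P_long_edge G hg hrho mO (UO zl zr) o2 ij (mfar z r s) (mnear z r s)
  (Ufar z r s) (Unear z r s) (ar0 r) (ar2 r) NrN (@far_dist z r s).
split => //; apply: (le_trans PL).
have hh := ltW (hr0 r); have q0 : 0 <= q by apply: exprn_ge0; apply: le_trans o2; rewrite invr_ge0.
apply: (@le_trans _ _ ((4 * hr r * (2 * hr r) * q)%:E * ((Nr r)%:R `^ (- y))%:E)%E).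
  apply: lee_wpmul2l; last by apply: ltW; apply: decay.
  by rewrite lee_fin; apply: mulr_ge0 => //; apply: mulr_ge0; apply: mulr_ge0.
by rewrite -EFinM lee_fin; apply: eq_ler; ring.
Qed.

Let out v : set (rg_space G) := X v @^-1` (~` `]- 2^-1, - 2^-1 + 1]%classic).

Let event (x : 'I_1 + 'I_n + ('I_n * 'I_n) + ('I_n * ('I_n * 'I_n * bool))) : set (rg_space G) :=
  match x with
  | inl (inl (inl _)) => rare_set (G := G)
  | inl (inl (inr v)) => out v
  | inl (inr p) => low_mark z p.1 p.2
  | inr p => if p.2.1.1 == p.2.1.2 then set0
      else long_edge z p.1 p.2.1.1 p.2.1.2 p.2.2 `&` adj p.2.1.1 p.2.1.2
  end.

Let mlow r i : measurable (low_mark z r i).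
Proof.
rewrite (_ : low_mark z r i = box (G := G)
  (fun v => if v == i then `[z - 2 * hr r, z + 2 * hr r]%classic else ~` `]z - h, z + h]%classic)
  (fun v => if v == i then `[0, 2 * ar r]%classic else setT)).
  apply: sigma_measurable; apply: box_sigma => v; case: eqP => // _; exact: measurable_itv.
apply/seteqP; split => w; rewrite /box /low_mark /=.
  by move=> [a [b c]] v; case: eqVneq => [->|vi] //; split => //; exact: c.
move=> H; have [] := H i; rewrite eqxx => a b; split => //; split => // v vi.
by have [] := H v; rewrite (negbTE vi).
Qed.

Let mevent x : measurable (event x).
Proof.
case: x => [[[_|v]|p]|[r [[i j] s]]] /=.
- by apply: measurable_rare_set.
- by rewrite /out -[Y in measurable Y]setTI; apply: measurable_funP => //; apply: measurableC; exact: measurable_itv.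
- exact: mlow.
- case: eqVneq => [_|ij]; first exact: measurable0.
  by apply: measurableI; [case: (P_long r s ij)|exact: rg_adj_measurable].
Qed.

Let scale (D : R) : h <= D -> D <= 1 -> exists r : 'I_n, hr r <= D <= 2 * hr r.
Proof.
move=> hD D1.
have big : exists r, D <= 2 * hr r.
  exists n; apply: (le_trans D1); rewrite /hr /halfwidth.
  have n2 : n%:R <= 2 ^+ n :> R by rewrite -natrX ler_nat ltnW// ltn_expl.
  have -> : 2 * (beta * N0%:R / n%:R * 2 ^+ n) = 2 * (beta * N0%:R) * (2 ^+ n / n%:R) by field; rewrite gt_eqF.
  have : 1 <= 2 ^+ n / n%:R :> R by rewrite ler_pdivlMr// mul1r.
  by move: bN; set u := beta * _; set v := _ / n%:R; nra.
case: (ex_minnP big) => r rD rmin.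
have rn : (r < n)%N.
  have : (r <= n.-1)%N; last by rewrite -ltnS prednK.
  apply: rmin; apply: (le_trans D1).
  rewrite /hr mulrCA -exprS prednK// /halfwidth.
  have n2 : n%:R <= 2 ^+ n :> R by rewrite -natrX ler_nat ltnW// ltn_expl.
  have -> : beta * N0%:R / n%:R * 2 ^+ n = (beta * N0%:R) * (2 ^+ n / n%:R) by field; rewrite gt_eqF.
  have : 1 <= 2 ^+ n / n%:R :> R by rewrite ler_pdivlMr// mul1r.
  by move: bN; set u := beta * _; set v := _ / n%:R; nra.
exists (Ordinal rn) => /=; rewrite rD andbT.
case: r rD rmin {rn} => [|r] rD rmin; first by rewrite /hr expr0 mulr1.
rewrite leNgt; apply/negP => lt.
have : (r.+1 <= r)%N; last by rewrite ltnn.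
by apply: rmin; apply: ltW; apply: (lt_le_trans lt); apply: eq_ler; rewrite /hr exprS; ring.
Qed.

Let cover w : (gap z `&` crossed z) w -> exists2 x, true & event x w.
Proof.
move=> [gw [[i j] _ /= [iz [zj aij]]]].
have [rw|nr] := pselect (rare_set (G := G) w); first by exists (inl (inl (inl ord0))).
have [[v ov]|no] := pselect (exists v, out v w); first by exists (inl (inl (inr v))).
have inX v : - 2^-1 < X v w <= 2^-1.
  by apply: contrapT => H; apply: no; exists v; rewrite /out /= in_itv/= (_ : - 2^-1 + 1 = 2^-1)//; field.
have ij : i != j by apply/eqP => e; move: iz; rewrite e ltNge zj.
have ji : j != i by rewrite eq_sym.
have [_ /andP[mi0 mi1] /andP[mj0 mj1]] := not_rare ij nr.
have ih : X i w <= z - h.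
  rewrite leNgt; apply/negP => lt; apply: (gw i); rewrite /= in_itv/= lt/= ltW//.
  by apply: (lt_trans iz); rewrite ltrDl.
have jh : z + h < X j w.
  rewrite ltNge; apply/negP => le; apply: (gw j); rewrite /= in_itv/= le andbT.
  by apply: lt_le_trans zj; rewrite gtrDl oppr_lt0.
have [/andP[i1 i2] /andP[j1 j2]] := (inX i, inX j).
have zz : - 2^-1 <= z <= 2^-1 by move: zl zr h0; lra.
have go (r : 'I_n) (s : bool) (k l : 'I_n) : k != l -> rg_adj G w k l ->
    0 < M k w < 1 -> 0 < M l w < 1 ->
    side_far z r s (X k w) -> side_near z r s (X l w) -> exists2 x, true & event x w.
  move=> kl akl /andP[k0 k1] /andP[l0 l1] fk nl; have hh := hr0 r.
  have wide u : side_far z r s u \/ side_near z r s u -> `[z - 2 * hr r, z + 2 * hr r]%classic u.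
    by rewrite /side_far /side_near; case: s {fk nl} => /=; rewrite !in_itv/= => -[|] /andP[u1 u2]; apply/andP; split; lra.
  have [kl2|kh] := leP (M k w) (2 * ar r).
    exists (inl (inr (r, k))) => //=; split; first by apply: wide; left.
    by split; [rewrite /= in_itv/= (ltW k0)|move=> v _; exact: gw].
  have [ll2|lh] := leP (M l w) (2 * ar r).
    exists (inl (inr (r, l))) => //=; split; first by apply: wide; right.
    by split; [rewrite /= in_itv/= (ltW l0)|move=> v _; exact: gw].
  exists (inr (r, (k, l, s))) => //=; rewrite (negbTE kl); split => //.
  by split => //; [rewrite kh|rewrite lh].
have mi : 0 < M i w < 1 by rewrite mi0.
have mj : 0 < M j w < 1 by rewrite mj0.
have [far|far] := leP (X j w - z) (z - X i w).
  have [||r /andP[r1 r2]] := @scale (z - X i w); [by lra|by move: zz; lra|].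
  by apply: (go r true i j ij aij mi mj); rewrite /side_far /side_near /= in_itv/=; apply/andP; split; lra.
have [||r /andP[r1 r2]] := @scale (X j w - z); [by lra|by move: zz; lra|].
have aji : rg_adj G w j i by rewrite rg_adj_sym.
by apply: (go r false j i ji aji mj mi); rewrite /side_far /side_near /= in_itv/=; apply/andP; split; lra.
Qed.

(** A crossing edge is sorted by the dyadic distance [hr r] of its farther endpoint. Either an endpoint has
    an exceptionally small mark [<= 2 ar r], or both marks are larger and the mark integral at scale
    [Nr r] applies; both bounds are geometric in [r]. *)
Lemma P_gap_crossed : (P (gap z `&` crossed z) <= (q * cross_bound)%:E)%E.
Proof.
have q0 : 0 <= q by apply: exprn_ge0; apply: le_trans o2; rewrite invr_ge0.
pose c (x : 'I_1 + 'I_n + ('I_n * 'I_n) + ('I_n * ('I_n * 'I_n * bool))) : R :=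
  match x with inl (inl _) => 0 | inl (inr p) => 16 * hr p.1 * ar p.1 * q
  | inr p => 8 * hr p.1 ^+ 2 * (Nr p.1)%:R `^ (- y) * q end.
have ce x : (P (event x) <= (c x)%:E)%E.
  case: x => [[[_|v]|p]|[r [[i j] s]]] /=.
  - by rewrite rare_set_null.
  - have H : P (out v) = 0%E := XM_range G (inl v).
    by rewrite H.
  - exact: P_low.
  - case: eqVneq => [_|ij]; last by case: (P_long r s ij).
    rewrite measure0 lee_fin; apply: mulr_ge0 => //; apply: mulr_ge0; last exact: powR_ge0.
    by apply: mulr_ge0 => //; exact: sqr_ge0.
have mgc : measurable (gap z `&` crossed z).
  by apply: measurableI; [exact: measurable_gap|exact: measurable_crossed].
have U1 : (P (gap z `&` crossed z) <= \sum_(x | true) P (event x))%E.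
  by apply: measure_finU_le => // x _; exact: mevent.
apply: (le_trans U1).
apply: (@le_trans _ _ (\sum_x (c x)%:E)%E); first by apply: lee_sum => x _; exact: ce.
have cs (I : finType) (u : R) : \sum_(i : I) u = #|I|%:R * u by rewrite sumr_const mulr_natl.
rewrite sumEFin lee_fin !big_sumType/= !(cs _ 0) !mulr0 !add0r.
have -> : \sum_(p : 'I_n * 'I_n) 16 * hr p.1 * ar p.1 * q =
    \sum_(r < n) 16 * beta * q * (Nr r)%:R `^ (- mu).
  rewrite -(pair_big xpredT xpredT (fun r i : 'I_n => 16 * hr r * ar r * q))/=.
  apply: eq_bigr => r _; rewrite cs card_ord -arN.
  have -> : n%:R * (16 * hr r * ar r * q) = 16 * (n%:R * hr r) * ar r * q by ring.
  by rewrite nhr; ring.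
have -> : \sum_(p : 'I_n * ('I_n * 'I_n * bool)) 8 * hr p.1 ^+ 2 * (Nr p.1)%:R `^ (- y) * q =
    \sum_(r < n) 16 * beta ^+ 2 * q * (Nr r)%:R `^ (- (y - 2)).
  rewrite -(pair_big xpredT xpredT (fun (r : 'I_n) (x : 'I_n * 'I_n * bool) => 8 * hr r ^+ 2 * (Nr r)%:R `^ (- y) * q))/=.
  apply: eq_bigr => r _; rewrite cs !card_prod card_ord card_bool (natrM _ (n * n)%N 2%N) (natrM _ n n).
  have -> : (Nr r)%:R `^ (- (y - 2)) = (Nr r)%:R ^+ 2 * (Nr r)%:R `^ (- y).
    rewrite -powR_mulrn ?ltW// -powRD; last by apply/implyP => _; rewrite gt_eqF.
    by congr (_ `^ _); ring.
  have -> : n%:R * n%:R * 2 * (8 * hr r ^+ 2 * (Nr r)%:R `^ (- y) * q) =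
     16 * (n%:R * hr r) ^+ 2 * (Nr r)%:R `^ (- y) * q by ring.
  by rewrite nhr; ring.
rewrite -big_split/=.
have b0 := ltW beta0; have b20 : 0 <= beta ^+ 2 by exact: sqr_ge0.
apply: (@le_trans _ _ (\sum_(r < n) 16 * (beta + beta ^+ 2) * q * N0%:R `^ (- cross_exp) * (2 `^ (- cross_exp)) ^+ r)).
  apply: ler_sum => r _; rewrite -[leRHS]mulrA -Nr_geom.
  have h1 := @Nr_small r mu; have h2 := @Nr_small r (y - 2).
  have -> : 16 * (beta + beta ^+ 2) * q * (Nr r)%:R `^ (- cross_exp) =
    16 * beta * q * (Nr r)%:R `^ (- cross_exp) + 16 * beta ^+ 2 * q * (Nr r)%:R `^ (- cross_exp) by ring.
  apply: lerD; apply: ler_wpM2l; try by apply: mulr_ge0 => //; apply: mulr_ge0.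
    by apply: h1; rewrite /cross_exp ge_min lexx.
  by apply: h2; rewrite /cross_exp ge_min lexx orbT.
rewrite -mulr_sumr; have tt := two_powN; have gl := geom_le tt.
have -> : q * cross_bound = 16 * (beta + beta ^+ 2) * q * N0%:R `^ (- cross_exp) * (1 - 2 `^ (- cross_exp))^-1.
  by rewrite /cross_bound /cross_cst; ring.
apply: ler_wpM2l => //; apply: mulr_ge0; last exact: powR_ge0.
by apply: mulr_ge0 => //; apply: mulr_ge0 => //; exact: addr_ge0.
Qed.
End AtPoint.
End Crossing.

(** * The subcritical case *)

Lemma connect_side (n : nat) (T : Type) (e : rel 'I_n) (X : 'I_n -> T) (below : T -> bool) :
  (forall u v, e u v -> below (X u) = below (X v)) ->
  forall i j, connect e i j -> below (X i) = below (X j).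
Proof.
move=> H i j; have C : fingraph.closed e [pred v | below (X v)] by move=> u v /H; rewrite !inE.
by move=> /(closed_connect C); rewrite !inE.
Qed.

Section Subcritical.
Context {R : realType} {g : R -> R -> R} {rho : R -> R} {beta : R} {n : nat}.
Variable G : random_graph g rho beta n.
Hypotheses (hg : is_kernel g) (hrho : is_profile rho) (beta0 : 0 < beta) (n0 : (0 < n)%N).
Notation P := (rg_prob G).
Notation X := (rg_loc G).
Notation M := (rg_mark G).
Notation UX := (uniform_prob (ltN_half R)).
Variables (mu y : R) (N0 K J : nat).
Hypotheses (mu0 : 0 < mu) (y2 : 2 < y) (N02 : (2 <= N0)%N) (K0 : (0 < K)%N) (J0 : (0 < J)%N).
Hypothesis decay : forall N, (N0 <= N)%N ->
  (mark_integral (g := g) (rho := rho) (N%:R `^ (- mu - 1)) N < (N%:R `^ (- y))%:E)%E.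
Notation h := (@halfwidth R beta n N0).
Hypotheses (h4 : 2 * h <= 2^-1) (bN : 1 <= beta * N0%:R).
Hypothesis hJ : 2 * h * (K * J)%:R <= 1.
Notation q := ((1 - 2 * h) ^+ n).
Notation dl := (@cross_bound R beta mu y N0).

Let K0' : 0 < K%:R :> R. Proof. by rewrite ltr0n. Qed.
Let J0' : 0 < J%:R :> R. Proof. by rewrite ltr0n. Qed.
Let n0' : 0 < n%:R :> R. Proof. by rewrite ltr0n. Qed.
Let h0 : 0 < h. Proof. by apply: halfwidth_gt0. Qed.

Let cut (k : nat) (j : 'I_J) : R := - 2^-1 + k%:R * K%:R^-1 + (j%:R + 2^-1) / (K * J)%:R.

Let KJ0 : 0 < (K * J)%:R :> R. Proof. by rewrite natrM mulr_gt0. Qed.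
Let h_le : h <= 2^-1 / (K * J)%:R.
Proof. by rewrite ler_pdivlMr//; move: hJ; lra. Qed.

Let KE : K%:R^-1 = J%:R / (K * J)%:R :> R.
Proof. by rewrite natrM; field; rewrite !gt_eqF. Qed.

(* the cut points of a macroscopic cell are well inside that cell *)
Let cut_in k j : - 2^-1 + k%:R * K%:R^-1 <= cut k j - h /\ cut k j + h <= - 2^-1 + k.+1%:R * K%:R^-1.
Proof.
have hl := h_le; rewrite /cut -[k.+1%:R]natr1 [(k%:R + 1) * _]mulrDl mul1r [in X in _ /\ X]KE.
have jJ : j%:R + 1 <= J%:R :> R by rewrite natr1 ler_nat.
set w := (K * J)%:R^-1; have w0 : 0 < w by rewrite invr_gt0.
have hw : h <= 2^-1 * w by exact: hl.
have j0 : 0 <= j%:R * w by apply: mulr_ge0 => //; exact: ltW.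
have jw : (j%:R + 1) * w <= J%:R * w by apply: ler_wpM2r => //; exact: ltW.
move: jw; rewrite mulrDl mul1r => jw.
have -> : (j%:R + 2^-1) * w = j%:R * w + 2^-1 * w by rewrite mulrDl.
by split; lra.
Qed.

Let cell_in (k : 'I_K) : - 2^-1 <= - 2^-1 + k%:R * K%:R^-1 :> R /\ - 2^-1 + k.+1%:R * K%:R^-1 <= 2^-1 :> R.
Proof.
split; first by rewrite lerDl; apply: mulr_ge0 => //; rewrite invr_ge0.
have : k.+1%:R / K%:R <= 1 :> R by rewrite ler_pdivrMr// mul1r ler_nat.
lra.
Qed.

Let cut_ok (k : 'I_K) j : - 2^-1 <= cut k j - h /\ cut k j + h <= 2^-1.
Proof. by have [a1 a2] := cell_in k; have [b1 b2] := cut_in k j; split; lra. Qed.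

Let gp (k : 'I_K) (j : 'I_J) := gap (G := G) N0 (cut k j).
Let cr (k : 'I_K) (j : 'I_J) := crossed (G := G) (cut k j).

Let mgp k j : measurable (gp k j). Proof. by apply: measurable_gap. Qed.
Let mcr k j : measurable (cr k j). Proof. by apply: measurable_crossed. Qed.

Definition no_cut (k : 'I_K) : set (rg_space G) :=
  ~` [set w | exists2 j : 'I_J, true & (gp k j `\` cr k j) w].

Lemma measurable_no_cut k : measurable (no_cut k).
Proof. by apply: measurableC; apply: measurable_finU => j _; apply: measurableD. Qed.

Let q0 : 0 < q. Proof. by apply: exprn_gt0; move: h4; lra. Qed.

Let pair_gap (k : 'I_K) (j l : 'I_J) : j != l -> (P (gp k j `&` gp k l) <= (q ^+ 2)%:E)%E.
Proof.
wlog jl : j l / (j < l)%N.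
  move=> W ne; case: (ltngtP j l) => [lt|gt|/val_inj e]; [exact: W| |by rewrite e eqxx in ne].
  by rewrite setIC; apply: W => //; rewrite eq_sym.
move=> _; have [a1 a2] := cut_ok k j; have [b1 b2] := cut_ok k l.
have sep : cut k j + h <= cut k l - h.
  have hl := h_le; rewrite /cut; set w := (K * J)%:R^-1; have w0 : 0 < w by rewrite invr_gt0.
  have hw : h <= 2^-1 * w by exact: hl.
  have : (j%:R + 1) * w <= l%:R * w by apply: ler_wpM2r; [exact: ltW|rewrite natr1 ler_nat].
  rewrite mulrDl mul1r => jw.
  by rewrite !mulrDl; lra.
pose W1 := `]cut k j - h, cut k j + h]%classic; pose W2 := `]cut k l - h, cut k l + h]%classic.
have mW1 : measurable (W1 : set R) by exact: measurable_itv.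
have mW2 : measurable (W2 : set R) by exact: measurable_itv.
have -> : gp k j `&` gp k l = box (G := G) (fun=> (~` W1) `\` W2) (fun=> setT).
  apply/seteqP; split => w; rewrite /gp /gap /box /=.
    by move=> [c1 c2] v; split => //; split; [exact: c1|exact: c2].
  by move=> H; split => v; have [[]] := H v.
have mD : measurable ((~` W1) `\` W2) by apply: measurableD => //; exact: measurableC.
have U1 : UX (~` W1) = (1 - 2 * h)%:E.
  by rewrite uniform_probC//; [congr (_%:E); ring|exact: half_len|move: h0; lra].
have U2 : UX W2 = (2 * h)%:E.
  by rewrite uniform_prob_itv//; [congr (_%:E); ring|exact: half_len|move: h0; lra].
have UD : (UX ((~` W1) `\` W2) <= (1 - 4 * h)%:E)%E.
  have := @measure_finU_eq _ _ _ (uniform_prob (ltN_half R)) bool (fun b : bool => if b then (~` W1) `\` W2 else W2) xpredT (~` W1).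
  rewrite big_bool/= U1 U2 => H.
  have {H} E : (1 - 2 * h)%:E = (UX ((~` W1) `\` W2) + (2 * h)%:E)%E.
    apply: H => //; first exact: measurableC.
    - by case.
    - by move=> [] [] x _ _ //=; [case=> _ u v; case: (u v)|move=> v [_ u]; case: (u v)].
    move=> x; split => [x1|[[] _ //=]].
      by have [x2|nx2] := pselect (W2 x); [exists false|exists true].
      by case.
    rewrite /W1 /W2 /= !in_itv/= => /andP[u1 u2] /andP[u3 u4].
    by move: u1 u4 sep; lra.
  have : UX ((~` W1) `\` W2) \is a fin_num by exact: fin_num_measure.
  move: E; case: (UX _) => [r| |] // [E] _; rewrite lee_fin; lra.
apply: le_trans (@P_box_le R g rho beta n G _ _ (fun=> 1 - 4 * h) (fun=> 1) _ _ _ _) _ => //.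
  by move=> v; rewrite probability_setT.
rewrite lee_fin prodr_const card_ord mulr1 -exprM mulnC exprM.
apply: lerXn2r; rewrite ?nnegrE ?sqr_ge0//; first by move: h4; lra.
have : 0 <= h ^+ 2 by exact: sqr_ge0.
by rewrite sqrrB; nra.
Qed.

Lemma P_no_cut k : (P (no_cut k) <= (4 / (J%:R * q) + 2 * dl)%:E)%E.
Proof.
have dl0 : 0 <= dl by apply: mulr_ge0; [exact: cross_cst_ge0|exact: powR_ge0].
apply: (@many_gaps _ _ _ P J q dl (gp k) (fun j => gp k j `&` cr k j)) => //.
- exact: measurable_no_cut.
- by move=> j; apply: measurableI.
- by move=> j; have [c1 c2] := cut_ok k j; apply: P_gap.
- exact: pair_gap.
- by move=> j; have [c1 c2] := cut_ok k j; apply: P_gap_crossed.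
- move=> w nw j gj; split => //; apply: contrapT => nc; apply: nw.
  by exists j.
Qed.

Let near (x : ('I_n * 'I_n) * ('I_K * 'I_3)) : set (rg_space G) :=
  [set w | [/\ cell (- 2^-1) K%:R^-1 (x.2.1 + (val x.2.2 == 2%N)) (X x.1.1 w), setT (M x.1.1 w),
     cell (- 2^-1) K%:R^-1 (x.2.1 + (val x.2.2 == 1%N)) (X x.1.2 w), setT (M x.1.2 w) &
     forall v, v != x.1.1 -> v != x.1.2 -> [set: R] (X v w)]].

Let cell_prob k : (UX (cell (- 2^-1) K%:R^-1 k) <= (K%:R^-1)%:E)%E.
Proof.
have le : - 2^-1 + k%:R * K%:R^-1 <= - 2^-1 + k.+1%:R * K%:R^-1 :> R.
  by rewrite lerD2l; apply: ler_wpM2r; rewrite ?invr_ge0// ler_nat.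
apply: (le_trans (uniform_prob_sub (ltN_half R) half_len le (measurable_cell _ _ _) _)).
  by move=> x; rewrite /cell /= !in_itv/= => /andP[/ltW -> ->].
by rewrite lee_fin -[k.+1%:R]natr1; apply: eq_ler; ring.
Qed.

Let near_spec x : x.1.1 != x.1.2 -> measurable (near x) /\ (P (near x) <= (4 * K%:R^-1 ^+ 2)%:E)%E.
Proof.
move=> ij; have one : (uniform_prob (@ltr01 R) setT <= 1%:E)%E by rewrite probability_setT.
have half1 : 2^-1 <= 1 :> R by lra.
have UT : UX setT = 1%:E by rewrite probability_setT.
have [sA PA] := P_two G measurableT UT half1 ij (measurable_cell _ _ _) measurableT (measurable_cell _ _ _)
  measurableT (cell_prob (x.2.1 + (val x.2.2 == 2%N))) one (cell_prob (x.2.1 + (val x.2.2 == 1%N))) one.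
split; first exact: sigma_measurable sA.
by apply: (le_trans PA); rewrite lee_fin expr1n; apply: eq_ler; ring.
Qed.

Let out v : set (rg_space G) := X v @^-1` (~` `]- 2^-1, - 2^-1 + 1]%classic).
Let mout v : measurable (out v).
Proof.
rewrite /out -[Y in measurable Y]setTI; apply: measurable_funP => //.
by apply: measurableC; exact: measurable_itv.
Qed.

Let sum_cst1 (I : finType) (u : R) : \sum_(i : I) u = #|I|%:R * u.
Proof. by rewrite sumr_const mulr_natl. Qed.

Let same_side w : (forall v, ~ out v w) -> (forall k, ~ no_cut k w) -> forall i j,
  connect (rg_adj G w) i j -> exists x : 'I_K * 'I_3, near ((i, j), x) w.
Proof.
move=> no nn.
have inK v : exists k : 'I_K, cell (- 2^-1) K%:R^-1 k (X v w).
  apply: cell_exists; first by rewrite invr_gt0.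
  rewrite mulfV ?gt_eqF//; apply: contrapT => H; apply: (no v).
  by rewrite /out /= in_itv.
have sep (i j : 'I_n) (a b : 'I_K) : connect (rg_adj G w) i j -> cell (- 2^-1) K%:R^-1 a (X i w) ->
    cell (- 2^-1) K%:R^-1 b (X j w) -> (b <= a.+1)%N.
  move=> cij ia jb; rewrite leqNgt; apply/negP => ab.
  have aK : (a.+1 < K)%N by exact: ltn_trans ab (ltn_ord b).
  have [l _ [gl ncl]] : exists2 l : 'I_J, true & (gp (Ordinal aK) l `\` cr (Ordinal aK) l) w.
    by apply: contrapT => H; apply: (nn (Ordinal aK)).
  have [c1 c2] := cut_in a.+1 l.
  have side u v : rg_adj G w u v -> (X u w < cut a.+1 l) = (X v w < cut a.+1 l).
    move=> uv; have [u1|u1] := ltP (X u w); have [v1|v1] := ltP (X v w) => //.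
      by case: ncl; exists (u, v).
    by case: ncl; exists (v, u) => //; rewrite /= rg_adj_sym.
  have := connect_side (X := fun v => X v w) (below := fun t => t < cut a.+1 l) side cij.
  move: ia jb; rewrite /cell /= !in_itv/= => /andP[_ i2] /andP[j1 _].
  have -> : X i w < cut a.+1 l by move: h0; lra.
  have : - 2^-1 + a.+2%:R * K%:R^-1 <= - 2^-1 + b%:R * K%:R^-1 :> R.
    by rewrite lerD2l; apply: ler_wpM2r; rewrite ?invr_ge0// ler_nat.
  by move=> ab' /esym; move: h0; lra.
move=> i j cij; have [a ia] := inK i; have [b jb] := inK j.
have ba := sep _ _ _ _ cij ia jb.
have csym : connect_sym (rg_adj G w) by apply: sym_connect_sym; exact: rg_adj_sym.
have ab : (a <= b.+1)%N by apply: (sep j i b a) => //; rewrite csym.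
case: (ltngtP a b) => [lt|gt|e].
- have e : val b = (a + 1)%N by apply/eqP; rewrite addn1 eqn_leq ba lt.
  by exists (a, inord 1); rewrite /near /= inordK//= addn0; split => //; rewrite -e.
- have e : val a = (b + 1)%N by apply/eqP; rewrite addn1 eqn_leq ab gt.
  by exists (b, inord 2); rewrite /near /= inordK//= addn0; split => //; rewrite -e.
- by exists (a, inord 0); rewrite /near /= inordK//= addn0; split => //; rewrite e.
Qed.

(** If every macroscopic cell contains a gap that no edge crosses, connected vertices lie in the same or in
    adjacent cells. A giant component has at least [(c n)^2] ordered pairs of vertices, while the expected
    number of pairs in equal or adjacent cells is of order [n^2 / K]. *)
Lemma giant_unlikely (c : R) : 0 < c ->
  (prob_giant G c <= ((n%:R^-1 + 12 / K%:R + K%:R * (4 / (J%:R * q) + 2 * dl)) / c ^+ 2)%:E)%E.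
Proof.
move=> c0; pose Gi : set (rg_space G) := [set w | c * n%:R <= (largest_component (rg_adj G w))%:R].
rewrite -[prob_giant G c]/(P Gi).
have mGi : measurable Gi by exact: measurable_giant.
pose I := ('I_n + ('I_n * 'I_n) * ('I_K * 'I_3) + ('I_K + 'I_n))%type.
pose D (x : I) : set (rg_space G) := match x with
  | inl (inl _) => setT
  | inl (inr p) => if p.1.1 == p.1.2 then set0 else near p
  | inr (inl k) => no_cut k | inr (inr v) => out v end.
pose H (x : I) : R := match x with inl _ => 1 | inr _ => n%:R ^+ 2 end.
have n20 : 0 <= n%:R ^+ 2 :> R by exact: sqr_ge0.
have H0 x : 0 <= H x by case: x.
have mD x : measurable (D x).
  case: x => [[i|p]|[k|v]] /=; [exact: measurableT| |exact: measurable_no_cut|exact: mout].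
  by case: eqVneq => [_|ij]; [exact: measurable0|case: (near_spec ij)].
pose A (_ : 'I_1) := Gi; pose F (_ : 'I_1) := c ^+ 2 * n%:R ^+ 2.
have F0 i : 0 <= F i by apply: mulr_ge0 => //; exact: sqr_ge0.
have key w : \sum_i F i * \1_(A i) w <= \sum_x H x * \1_(D x) w.
  rewrite big_ord1 /F /A.
  have S0 x : 0 <= H x * \1_(D x) w :> R by apply: mulr_ge0.
  have [gw|ng] := pselect (Gi w); last by rewrite [\1_Gi w]indicE memNset// mulr0 sumr_ge0.
  rewrite [\1_Gi w]indicE mem_set// mulr1.
  have cn : c * n%:R <= n%:R.
    apply: (le_trans gw); rewrite ler_nat; apply/bigmax_leqP => i _.
    by rewrite -[leqRHS](card_ord n) max_card.
  have c1 : c <= 1 by rewrite -(ler_pM2r n0') mul1r.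
  have cn2 : c ^+ 2 * n%:R ^+ 2 <= n%:R ^+ 2.
    by rewrite ler_piMl// exprn_ile1// ltW.
  have big x : H x = n%:R ^+ 2 -> D x w -> c ^+ 2 * n%:R ^+ 2 <= \sum_x H x * \1_(D x) w.
    move=> Hx Dx; apply: (le_trans cn2); rewrite (bigD1 x)//= Hx indicE mem_set// mulr1.
    by rewrite lerDl; apply: sumr_ge0.
  have [[v ov]|no] := pselect (exists v, out v w); first exact: (big (inr (inr v))).
  have [[k bk]|nb] := pselect (exists k, no_cut k w); first exact: (big (inr (inl k))).
  have near_ex := @same_side w (fun v H => no (ex_intro _ v H)) (fun k H => nb (ex_intro _ k H)).
  have [r rS] : exists r, c * n%:R <= #|connect (rg_adj G w) r|%:R.
    move: gw; rewrite /Gi /= /largest_component.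
    have n1 : (0 < #|'I_n|)%N by rewrite card_ord.
    have [r ->] := bigop.eq_bigmax (fun i : 'I_n => #|connect (rg_adj G w) i|) n1.
    by move=> ?; exists r.
  pose s (i : 'I_n) : R := (connect (rg_adj G w) r i)%:R.
  have sE : \sum_i s i = #|connect (rg_adj G w) r|%:R by rewrite /s -natr_sum -sum1_card [in RHS]big_mkcond/=; congr (_%:R); apply: eq_bigr => i _; rewrite unfold_in; case: connect.
  have cnS : c * n%:R <= \sum_i s i by rewrite sE.
  apply: (@le_trans _ _ ((\sum_i s i) ^+ 2)).
    by rewrite -exprMn; apply: lerXn2r; rewrite ?nnegrE ?(le_trans _ cnS)// mulr_ge0// ltW.
  rewrite !big_sumType/=.
  apply: (@le_trans _ _ (\sum_(i < n) 1 * \1_[set: rg_space G] w +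
      \sum_(p : ('I_n * 'I_n) * ('I_K * 'I_3)) 1 * \1_(if p.1.1 == p.1.2 then set0 else near p) w)); last first.
    by rewrite lerDl; apply: addr_ge0; apply: sumr_ge0 => x _; apply: mulr_ge0.
  rewrite expr2 mulr_suml.
  rewrite -(pair_big xpredT xpredT (fun p x => 1 * \1_(if p.1 == p.2 then set0 else near (p, x)) w : R))/=.
  rewrite -(pair_big xpredT xpredT (fun i j : 'I_n => \sum_(x : 'I_K * 'I_3) 1 * \1_(if i == j then set0 else near ((i, j), x)) w : R))/=.
  rewrite -big_split/=; apply: ler_sum => i _; rewrite mulr_sumr indicT mulr1.
  rewrite (bigD1 i)//= [X in _ <= _ + X](bigD1 i)//= eqxx.
  have S1 : s i * s i <= 1 by rewrite /s; case: connect; rewrite ?mulr1 ?mulr0.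
  have S2 : \sum_(j < n | j != i) s i * s j <=
     \sum_(j < n | j != i) \sum_(x : 'I_K * 'I_3) 1 * \1_(if i == j then set0 else near ((i, j), x)) w.
    apply: ler_sum => j ji; rewrite eq_sym (negbTE ji) /s.
    case ri : (connect _ r i); last by rewrite mul0r; apply: sumr_ge0 => x _; apply: mulr_ge0.
    case rj : (connect _ r j); last by rewrite mulr0; apply: sumr_ge0 => x _; apply: mulr_ge0.
    have csym : connect_sym (rg_adj G w) by apply: sym_connect_sym; exact: rg_adj_sym.
    have [x nx] : exists x, near ((i, j), x) w.
      by apply: near_ex; apply: connect_trans rj; rewrite csym.
    rewrite mulr1 (bigD1 x)//= [\1_(near _) w]indicE mem_set// mulr1 lerDl.
    by apply: sumr_ge0 => z _; apply: mulr_ge0.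
  apply: lerD => //; apply: (le_trans S2).
  by rewrite lerDr; apply: sumr_ge0 => x _; apply: mulr_ge0.
have := indic_sum_le P F0 (fun=> mGi) H0 mD key.
rewrite big_ord1 !big_sumType/=.
set B1 := (\sum_(i < n) _)%E; set B2 := (\sum_(p : 'I_n * 'I_n * _) _)%E.
set B3 := (\sum_(k < K) _)%E; set B4 := (\sum_(v < n) _)%E.
have E1 : (B1 <= n%:R%:E)%E.
  rewrite /B1 (eq_bigr (fun=> 1%:E)) => [|i _]; last by rewrite probability_setT mule1.
  by rewrite sumEFin sum_cst1 card_ord mulr1.
have E2 : (B2 <= (n%:R ^+ 2 * (12 / K%:R))%:E)%E.
  apply: (@le_trans _ _ (\sum_(p : 'I_n * 'I_n * ('I_K * 'I_3)) (4 * K%:R^-1 ^+ 2)%:E)%E).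
    apply: lee_sum => p _; rewrite mul1e; case: eqVneq => [_|ij]; last by case: (near_spec ij).
    by rewrite measure0 lee_fin; apply: mulr_ge0 => //; exact: sqr_ge0.
  rewrite sumEFin sum_cst1 !card_prod !card_ord !natrM lee_fin.
  by apply: eq_ler; field; rewrite gt_eqF.
have E3 : (B3 <= (n%:R ^+ 2 * (K%:R * (4 / (J%:R * q) + 2 * dl)))%:E)%E.
  apply: (@le_trans _ _ (\sum_(k < K) (n%:R ^+ 2 * (4 / (J%:R * q) + 2 * dl))%:E)%E).
    by apply: lee_sum => k _; rewrite [leRHS]EFinM; apply: lee_wpmul2l => //; exact: P_no_cut.
  by rewrite sumEFin sum_cst1 card_ord lee_fin; apply: eq_ler; ring.
have E4 : (B4 <= 0%:E)%E.
  rewrite /B4 big1// => v _; have Hv : P (out v) = 0%E := XM_range G (inl v).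
  by rewrite Hv mule0.
move=> le.
have {le} : ((F ord0)%:E * P Gi <= (n%:R + n%:R ^+ 2 * (12 / K%:R) +
    (n%:R ^+ 2 * (K%:R * (4 / (J%:R * q) + 2 * dl)) + 0))%:E)%E.
  by apply: (le_trans le); rewrite !EFinD; apply: leeD; apply: leeD.
have : P Gi \is a fin_num by exact: fin_num_measure.
case: (P Gi) => [p| |] // _; rewrite -EFinM !lee_fin /F => le.
rewrite ler_pdivlMr ?exprn_gt0// -(ler_pM2r (exprn_gt0 2 n0')).
have -> : p * c ^+ 2 * n%:R ^+ 2 = c ^+ 2 * n%:R ^+ 2 * p by ring.
by apply: (le_trans le); apply: eq_ler; field; rewrite !gt_eqF.
Qed.
End Subcritical.

Section SubcriticalLimit.
Context {R : realType} {g : R -> R -> R} {rho : R -> R}.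
Hypotheses (hg : is_kernel g) (hrho : is_profile rho).

Let exp_low (x : R) n : 0 <= x -> 2 * x <= 1 -> expR (- (2 * x * n%:R)) <= (1 - x) ^+ n.
Proof.
move=> x0 x1; rewrite -mulNr expRM_natr.
apply: lerXn2r; rewrite ?nnegrE ?expR_ge0 ?subr_ge0//; first by lra.
rewrite expRN; have e1 := expR_ge1Dx (2 * x).
have p1 : 0 < 1 + 2 * x by lra.
apply: (@le_trans _ _ (1 + 2 * x)^-1); first by rewrite lef_pV2 ?posrE ?expR_gt0.
by rewrite -div1r ler_pdivrMr//; nra.
Qed.

(** First the number [K] of macroscopic cells, then the width [N0] of the gaps, then the number [J] of
    candidate gaps in each cell, and finally [n] are taken large. *)
Lemma subcritical :
  (((2%R)%:E < - lim (limn_esup (log_ratio g rho mu) @[mu --> 0^'-]))%E ->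
    forall beta : R, 0 < beta ->
    forall c : R, 0 < c ->
    forall G : forall n : nat, random_graph g rho beta n,
      prob_giant (G n) c @[n --> \oo] --> 0%E).
Proof.
move=> /(fast_decay hg hrho)[mu [y [N1 [/andP[mu0 _] y2 decay1]]]] beta beta0 c c0 G.
apply: cvge_unit => [n|e e0]; first exact: prob_giant01.
have c20 : 0 < c ^+ 2 by exact: exprn_gt0.
pose t := e * c ^+ 2 / 4; have t0 : 0 < t by apply: divr_gt0 => //; exact: mulr_gt0.
pose K := (Num.truncn (12 / t)).+1.
have Kr : 0 < K%:R :> R by rewrite ltr0n.
have Kt : 12 / K%:R <= t.
  by rewrite ler_pdivrMr// mulrC -ler_pdivrMr// ltW// truncnS_gt.
pose ce := cross_exp mu y; pose C := @cross_cst R beta mu y.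
have ce0 : 0 < ce by rewrite lt_min mu0 subr_gt0.
have C0 : 0 <= C by exact: cross_cst_ge0.
pose z := K%:R * (2 * C) / t.
have z0 : 0 <= z by apply: divr_ge0; [apply: mulr_ge0; [exact: ltW|exact: mulr_ge0]|exact: ltW].
pose N0 := maxn 2 (maxn N1 (maxn (Num.truncn beta^-1).+1 (Num.truncn (z `^ ce^-1)).+1)).
have N02 : (2 <= N0)%N by rewrite leq_maxl.
have N01 : (N1 <= N0)%N by rewrite /N0 !leq_max leqnn orbT.
have N0b : beta^-1 <= N0%:R.
  by apply: ltW; apply: (lt_le_trans (truncnS_gt _)); rewrite ler_nat /N0 !leq_max leqnn !orbT.
have N0z : z `^ ce^-1 <= N0%:R.
  by apply: ltW; apply: (lt_le_trans (truncnS_gt _)); rewrite ler_nat /N0 !leq_max leqnn !orbT.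
have N0r : 0 < N0%:R :> R by rewrite ltr0n (leq_trans _ N02).
have bN : 1 <= beta * N0%:R by rewrite -ler_pdivrMl// mulr1.
have decay N : (N0 <= N)%N ->
    (mark_integral (g := g) (rho := rho) (N%:R `^ (- mu - 1)) N < (N%:R `^ (- y))%:E)%E.
  by move=> NN; apply: decay1; exact: leq_trans NN.
have zN : z <= N0%:R `^ ce.
  have -> : z = (z `^ ce^-1) `^ ce by rewrite -powRrM mulVf ?gt_eqF// powRr1.
  by apply: ge0_ler_powR; rewrite ?nnegrE ?powR_ge0 ?(ltW ce0) ?(ltW N0r).
have Kd : K%:R * (2 * @cross_bound R beta mu y N0) <= t.
  have P0 : 0 < N0%:R `^ ce by exact: powR_gt0.
  have -> : K%:R * (2 * @cross_bound R beta mu y N0) = K%:R * (2 * C) / (N0%:R `^ ce).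
    by rewrite /cross_bound -/ce -/C powRN; ring.
  by rewrite ler_pdivrMr// [t * _]mulrC -ler_pdivrMr.
pose q1 := expR (- (4 * (beta * N0%:R))).
have q10 : 0 < q1 by exact: expR_gt0.
pose J := (Num.truncn (4 * K%:R / (q1 * t))).+1.
have Jr : 0 < J%:R :> R by rewrite ltr0n.
have Jt : K%:R * (4 / (J%:R * q1)) <= t.
  have -> : K%:R * (4 / (J%:R * q1)) = (4 * K%:R / q1) / J%:R by field; rewrite !gt_eqF.
  rewrite ler_pdivrMr// [t * _]mulrC -ler_pdivrMr//.
  apply: ltW; apply: le_lt_trans (truncnS_gt _); apply: eq_ler.
  by field; rewrite !gt_eqF.
pose b := beta * N0%:R; have b0 : 0 < b by exact: mulr_gt0.
exists (maxn 1 (maxn (Num.truncn t^-1).+1 (maxn (Num.truncn (4 * b)).+1 (Num.truncn (2 * b * (K * J)%:R)).+1))).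
move=> n; rewrite !geq_max => /and4P[n0 nt nb nKJ].
have n0r : 0 < n%:R :> R by rewrite ltr0n.
have big (u : R) : (Num.truncn u < n)%N -> u <= n%:R.
  by move=> un; apply: ltW; apply: (lt_le_trans (truncnS_gt _)); rewrite ler_nat.
pose h := @halfwidth R beta n N0; have hE : h = b / n%:R by [].
have h0 : 0 < h by rewrite hE; exact: divr_gt0.
have h4 : 2 * h <= 2^-1.
  have -> : 2 * h = 4 * b / n%:R / 2 by rewrite hE; field; rewrite gt_eqF.
  have : 4 * b / n%:R <= 1 by rewrite ler_pdivrMr// mul1r big.
  by lra.
have hJ : 2 * h * (K * J)%:R <= 1.
  have -> : 2 * h * (K * J)%:R = 2 * b * (K * J)%:R / n%:R by rewrite hE; field; rewrite gt_eqF.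
  by rewrite ler_pdivrMr// mul1r big.
have qq : q1 <= (1 - 2 * h) ^+ n.
  apply: le_trans (exp_low n _ _); [|by lra|by lra].
  by rewrite ler_expR lerN2; apply: eq_ler; rewrite hE /b; field; rewrite gt_eqF.
have := giant_unlikely (G n) hg hrho beta0 n0 mu0 y2 N02 (isT : (0 < K)%N) (isT : (0 < J)%N) decay h4 bN hJ c0.
have /andP[] := prob_giant01 (G n) c.
case: (prob_giant (G n) c) => [p| |] //=; rewrite !lee_fin => p0 _ ple.
rewrite sub0r normrN ger0_norm//; apply: (le_trans ple).
rewrite ler_pdivrMr//; have nt' : n%:R^-1 <= t.
  by rewrite -[leRHS]invrK lef_pV2 ?posrE ?invr_gt0// big.
have Jq : K%:R * (4 / (J%:R * (1 - 2 * h) ^+ n)) <= t.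
  apply: le_trans Jt; apply: ler_wpM2l; first exact: ltW.
  apply: ler_wpM2l => //; rewrite lef_pV2 ?posrE ?mulr_gt0// ?(lt_le_trans q10)//.
  by apply: ler_wpM2l => //; exact: ltW.
rewrite mulrDr; have -> : e * c ^+ 2 = t + t + t + t by rewrite /t; field.
move: Jq Kd; rewrite -/h; lra.
Qed.
End SubcriticalLimit.

(** * The theorem *)

Theorem corollary1p6 (R : realType) (g : R -> R -> R) (rho : R -> R)
    (hg : is_kernel g) (hrho : is_profile rho) :
  ((- lim (limn_einf (log_ratio g rho mu) @[mu --> 0^'+]) < (2%R)%:E)%E ->
    exists2 beta0 : R, 0 < beta0 &
    forall beta : R, beta0 <= beta ->
    exists2 c : R, 0 < c &
    forall G : forall n : nat, random_graph g rho beta n,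
      prob_giant (G n) c @[n --> \oo] --> 1%E)
  /\
  (((2%R)%:E < - lim (limn_esup (log_ratio g rho mu) @[mu --> 0^'-]))%E ->
    forall beta : R, 0 < beta ->
    forall c : R, 0 < c ->
    forall G : forall n : nat, random_graph g rho beta n,
      prob_giant (G n) c @[n --> \oo] --> 0%E).
Proof. by split; [exact: supercritical|exact: subcritical]. Qed.
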